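(* Let $n=2$, $p=2$ and $u\in\mathbb{Z}_2^\times$. The conjugacy classes of maximal finite subgroups $F$ of $\mathbb{G}_2(u)$ are represented by $$\begin{cases}C_6\rtimes C_2,\ O_{48}&\text{if } u\equiv 1\bmod 8,\\ C_3\rtimes C_4,\ T_{24}\rtimes C_2&\text{if } u\equiv -1\bmod 8,\\ C_3\rtimes C_4,\ C_6\rtimes C_2,\ D_8\text{ and } T_{24}&\text{if } u\equiv 3\bmod 8,\\ C_3\rtimes C_4,\ C_6\rtimes C_2,\ Q_8\text{ and } T_{24}&\text{if } u\equiv -3\bmod 8.\end{cases}$$
   Context: $\mathbb{D}_2$ is the central division algebra over $\mathbb{Q}_2$ of Hasse invariant $1/2$ and $\mathbb{G}_2(u)=\mathbb{D}_2^\times/\langle 2u\rangle$. $C_l$ is the cyclic group of order $l$, $Q_8$ the quaternion group of order $8$, $D_8$ the dihedral group of order $8$, $T_{24}=Q_8\rtimes C_3$ the binary tetrahedral group of order $24$, and $O_{48}\cong\langle a,b,c\mid a^2=b^3=c^4=abc\rangle$ the binary octahedral group of order $48$; $\rtimes$ denotes a semidirect product with normal factor on the left. The statement means that, in each case, there is exactly one conjugacy class of maximal finite subgroups for each group in the list. *)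

(* Defs.v *)
From Stdlib Require List.
From HB Require Import structures.
From mathcomp Require Import all_boot all_order all_algebra all_fingroup.
From mathcomp Require Import all_solvable all_field generic_quotient.
From mathcomp Require Import boolp classical_sets cardinality.

Set Implicit Arguments.
Unset Strict Implicit.
Unset Printing Implicit Defensive.

Import Order.TTheory GRing.Theory Num.Theory.
Local Open Scope quotient_scope.
Local Open Scope ring_scope.

(* The 2-adic integers, as the inverse limit of the rings Z/2^(k+1); the
   exponent starts at 1 because 'Z_1 is Z/2. *)

Definition Z2_coherent (x : forall k, 'Z_(2 ^ k.+1)) : bool :=
  `[< forall k, (x k.+1 %% 2 ^ k.+1)%N = x k >].

Record Z2 := MkZ2 { Z2_seq :> forall k, 'Z_(2 ^ k.+1); _ : Z2_coherent Z2_seq }.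

HB.instance Definition _ := [isSub for Z2_seq].
HB.instance Definition _ := [Choice of Z2 by <:].

Section Z2Ring.

Implicit Types (x y z : Z2) (k : nat).

Let pow2_gt1 k : (1 < 2 ^ k.+1)%N.
Proof. by rewrite -{1}(expn0 2) ltn_exp2l. Qed.

Let cast2 k : (Zp_trunc (2 ^ k.+1)).+2 = (2 ^ k.+1)%N.
Proof. exact: Zp_cast. Qed.

Lemma Z2P x k : (x k.+1 %% 2 ^ k.+1)%N = x k.
Proof. by case: x => x /= /asboolP. Qed.

Lemma Z2_eqP x y : (forall k, x k = y k) -> x = y.
Proof. by move=> xy; apply: val_inj; apply: functional_extensionality_dep. Qed.

Let valZp1 k : nat_of_ord (1 : 'Z_(2 ^ k.+1)) = 1%N.
Proof. by rewrite /= modn_small. Qed.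

Let valZpD k (a b : 'Z_(2 ^ k.+1)) :
  nat_of_ord (a + b) = ((a + b) %% 2 ^ k.+1)%N.
Proof. exact: (congr1 (modn (a + b)%N) (cast2 k)). Qed.

Let valZpN k (a : 'Z_(2 ^ k.+1)) :
  nat_of_ord (- a) = ((2 ^ k.+1 - a) %% 2 ^ k.+1)%N.
Proof. exact: (congr1 (fun n => modn (n - a)%N n) (cast2 k)). Qed.

Let valZpM k (a b : 'Z_(2 ^ k.+1)) :
  nat_of_ord (a * b) = ((a * b) %% 2 ^ k.+1)%N.
Proof. exact: (congr1 (modn (a * b)%N) (cast2 k)). Qed.

Let dvd2 k : (2 ^ k.+1 %| 2 ^ k.+2)%N. Proof. exact: dvdn_exp2l. Qed.

Fact Z2_zero_subproof : Z2_coherent (fun k => 0).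
Proof. by apply/asboolP => k; rewrite mod0n. Qed.
Definition Z2_zero := MkZ2 Z2_zero_subproof.

Fact Z2_one_subproof : Z2_coherent (fun k => 1).
Proof. by apply/asboolP => k; rewrite !valZp1 modn_small. Qed.
Definition Z2_one := MkZ2 Z2_one_subproof.

Fact Z2_add_subproof x y : Z2_coherent (fun k => x k + y k).
Proof.
apply/asboolP => k; rewrite !valZpD modn_dvdm //.
by rewrite -(Z2P x k) -(Z2P y k) modnDm.
Qed.
Definition Z2_add x y := MkZ2 (Z2_add_subproof x y).

Fact Z2_mul_subproof x y : Z2_coherent (fun k => x k * y k).
Proof.
apply/asboolP => k; rewrite !valZpM modn_dvdm //.
by rewrite -(Z2P x k) -(Z2P y k) modnMm.
Qed.
Definition Z2_mul x y := MkZ2 (Z2_mul_subproof x y).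

Fact Z2_opp_subproof x : Z2_coherent (fun k => - x k).
Proof.
apply/asboolP => k; rewrite !valZpN modn_dvdm //.
have lt1 : (x k.+1 <= 2 ^ k.+2)%N by rewrite ltnW // -[ltnRHS]cast2.
have lt0 : (x k <= 2 ^ k.+1)%N by rewrite ltnW // -[ltnRHS]cast2.
apply/eqP; rewrite -(eqn_modDr (x k.+1)) subnK //.
by rewrite -modnDmr (Z2P x) subnK // modnn; apply: dvd2.
Qed.
Definition Z2_opp x := MkZ2 (Z2_opp_subproof x).

Fact Z2_addA : associative Z2_add.
Proof. by move=> x y z; apply: Z2_eqP => k /=; rewrite addrA. Qed.
Fact Z2_addC : commutative Z2_add.
Proof. by move=> x y; apply: Z2_eqP => k /=; rewrite addrC. Qed.
Fact Z2_add0 : left_id Z2_zero Z2_add.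
Proof. by move=> x; apply: Z2_eqP => k /=; rewrite add0r. Qed.
Fact Z2_addN : left_inverse Z2_zero Z2_opp Z2_add.
Proof. by move=> x; apply: Z2_eqP => k /=; rewrite addNr. Qed.

HB.instance Definition _ :=
  GRing.isZmodule.Build Z2 Z2_addA Z2_addC Z2_add0 Z2_addN.

Fact Z2_mulA : associative Z2_mul.
Proof. by move=> x y z; apply: Z2_eqP => k /=; rewrite mulrA. Qed.
Fact Z2_mulC : commutative Z2_mul.
Proof. by move=> x y; apply: Z2_eqP => k /=; rewrite mulrC. Qed.
Fact Z2_mul1 : left_id Z2_one Z2_mul.
Proof. by move=> x; apply: Z2_eqP => k /=; rewrite mul1r. Qed.
Fact Z2_mulD : left_distributive Z2_mul Z2_add.
Proof. by move=> x y z; apply: Z2_eqP => k /=; rewrite mulrDl. Qed.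
Fact Z2_oner_neq0 : Z2_one != 0.
Proof. by apply/eqP => /(congr1 (fun x : Z2 => x 0%N : nat)). Qed.

HB.instance Definition _ := GRing.Zmodule_isComNzRing.Build Z2
  Z2_mulA Z2_mulC Z2_mul1 Z2_mulD Z2_oner_neq0.

Definition Z2_unit : pred Z2 := fun x => `[< exists y, y * x = 1 >].
Definition Z2_inv x : Z2 :=
  if pselect (exists y, y * x = 1) is left ex then sval (cid ex) else x.

Fact Z2_mulVr : {in Z2_unit, left_inverse 1 Z2_inv *%R}.
Proof.
move=> x /asboolP xU; rewrite /Z2_inv; case: pselect => // ex.
exact: (svalP (cid ex)).
Qed.
Fact Z2_unitP x y : y * x = 1 -> Z2_unit x.
Proof. by move=> yx; apply/asboolP; exists y. Qed.
Fact Z2_inv_out : {in [predC Z2_unit], Z2_inv =1 id}.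
Proof.
move=> x; rewrite inE /= => xN; rewrite /Z2_inv; case: pselect => // ex.
by case/negP: xN; apply/asboolP.
Qed.

HB.instance Definition _ := GRing.ComNzRing_hasMulInverse.Build Z2
  Z2_mulVr Z2_unitP Z2_inv_out.

Let Z2_coh x k m : (k <= m)%N -> (x m %% 2 ^ k.+1)%N = x k.
Proof.
move=> /subnK <-; elim: (m - k)%N => [|d IHd] /=.
  by rewrite add0n modn_small // -[ltnRHS]cast2.
rewrite addSn -(modn_dvdm (m := 2 ^ (d + k).+1)) ?Z2P //.
by apply: dvdn_exp2l; rewrite ltnS leq_addl.
Qed.

Let Z2_neq0 x : x != 0 ->
  exists k, forall m, (k <= m)%N -> (0 < x m)%N /\ (logn 2 (x m) <= k)%N.
Proof.
move=> x0; have /existsNP[k xk] : ~ forall k, (x k : nat) = 0%N.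
  by move=> h; case/eqP: x0; apply: Z2_eqP => k; apply: val_inj; rewrite /= h.
exists k => m km.
have ndv : ~~ (2 ^ k.+1 %| x m)%N by rewrite /dvdn Z2_coh //; apply/eqP.
have xm0 : (0 < x m)%N by rewrite lt0n; apply: contraNneq ndv => ->.
by split=> //; rewrite leqNgt -pfactor_dvdn.
Qed.

Fact Z2_idomain : GRing.integral_domain_axiom Z2.
Proof.
move=> x y xy0; apply/norP => -[/Z2_neq0[k xk] /Z2_neq0[l yl]].
have [x_gt0 lx] := xk _ (leq_addr l k); have [y_gt0 ly] := yl _ (leq_addl k l).
have : nat_of_ord (Z2_seq (x * y) (k + l)%N) = 0%N by rewrite xy0.
rewrite valZpM => /eqP; rewrite -/(dvdn _ _) pfactor_dvdn ?muln_gt0 ?x_gt0 //.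
by rewrite lognM // ltnNge leq_add.
Qed.

HB.instance Definition _ :=
  GRing.ComUnitRing_isIntegral.Build Z2 Z2_idomain.

Lemma Z2_two_neq0 : 2%:R != 0 :> Z2.
Proof. by apply/eqP => /(congr1 (fun x : Z2 => x 1%N : nat)). Qed.

End Z2Ring.

Definition Z2_cong8 (u : Z2) (c : int) := exists z : Z2, u = c%:~R + 8%:R * z.

Notation Q2 := {fraction Z2}.
Notation "x %:F" := (tofrac x) : ring_scope.

(* x has 2-adic valuation k *)
Definition Q2_val (x : Q2) (k : int) :=
  exists2 w : Z2, w \is a GRing.unit & x = 2%:R ^ k * w%:F.

Section Hasse.

Variable D : falgType Q2.
Implicit Types (x y w : D) (v : D -> rat).

(* The value of v at 0, which should be +oo, is unspecified: every statement
   about v below excludes 0. *)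
Definition extends_Q2_val v :=
  [/\ forall x y, x != 0 -> y != 0 -> v (x * y) = v x + v y,
      forall x y, x != 0 -> y != 0 -> x + y != 0 ->
        Num.min (v x) (v y) <= v (x + y)
    & forall c k, Q2_val c k -> v c%:A = k%:~R].

Definition val_ge0 v x := x != 0 -> 0 <= v x.
Definition val_gt0 v x := x != 0 -> 0 < v x.

(* The residue field F_2 is perfect, hence unramified means that the value
   group is that of Q_2. *)
Definition unramified_subfield v (W : {aspace D}) :=
  [/\ 1 \in W,
      {in W &, forall x y, x * y = y * x}
    & {in W, forall x, x != 0 -> exists k : int, v x = k%:~R}].

Definition conj_is_frobenius v (W : {aspace D}) g :=
  {in W, forall w, g * w * g^-1 \in W /\
                   (val_ge0 v w -> val_gt0 v (g * w * g^-1 - w ^+ 2))}.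

(* If D has degree n, and conjugation by g induces the Frobenius automorphism
   of an unramified subfield W of degree n, then the Hasse invariant of D is
   the class of v(g) in Q/Z. *)
Definition has_hasse_invariant (n : nat) (r : rat) :=
  exists v (W : {aspace D}) (g : D),
    [/\ extends_Q2_val v,
        unramified_subfield v W /\ \dim W = n,
        g != 0 /\ conj_is_frobenius v W g
      & exists k : int, v g = r + k%:~R].

Definition is_division_algebra := forall x, x != 0 -> x \is a GRing.unit.

(* the algebra $\mathbb{D}_n$ over Q_2, of degree n and invariant 1/n *)
Definition is_DD (n : nat) :=
  [/\ is_division_algebra,
      ('Z({:D}) = 1)%VS,
      \dim {:D} = (n ^ 2)%N
    & has_hasse_invariant n (n%:R)^-1].

End Hasse.

Record unit_group (R : unitRingType) :=
  UnitGroup { unit_group_val :> R; _ : unit_group_val \is a GRing.unit }.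

HB.instance Definition _ (R : unitRingType) :=
  [isSub for @unit_group_val R].
HB.instance Definition _ (R : unitRingType) := [Choice of unit_group R by <:].

Section UnitGroupTheory.

Variable R : unitRingType.
Implicit Types x y z : unit_group R.

Lemma unit_groupP x : unit_group_val x \is a GRing.unit. Proof. by case: x. Qed.

Fact ug_mul_subproof x y : unit_group_val x * unit_group_val y \is a GRing.unit.
Proof. by rewrite unitrMl ?unit_groupP. Qed.
Definition ug_mul x y := UnitGroup (ug_mul_subproof x y).
Definition ug_one := UnitGroup (@unitr1 R).
Fact ug_inv_subproof x : (unit_group_val x)^-1 \is a GRing.unit.
Proof. by rewrite unitrV unit_groupP. Qed.
Definition ug_inv x := UnitGroup (ug_inv_subproof x).

Fact ug_mulA : associative ug_mul.
Proof. by move=> x y z; apply: val_inj; rewrite /= mulrA. Qed.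
Fact ug_mul1 : left_id ug_one ug_mul.
Proof. by move=> x; apply: val_inj; rewrite /= mul1r. Qed.
Fact ug_mulr1 : right_id ug_one ug_mul.
Proof. by move=> x; apply: val_inj; rewrite /= mulr1. Qed.
Fact ug_mulV : left_inverse ug_one ug_inv ug_mul.
Proof. by move=> x; apply: val_inj; rewrite /= mulVr ?unit_groupP. Qed.
Fact ug_mulrV : right_inverse ug_one ug_inv ug_mul.
Proof. by move=> x; apply: val_inj; rewrite /= divrr ?unit_groupP. Qed.

HB.instance Definition _ := isGroup.Build (unit_group R)
  ug_mulA ug_mul1 ug_mulr1 ug_mulV ug_mulrV.

End UnitGroupTheory.

Record normal_subgroup (G : groupType) := NormalSubgroup {
  nsub_pred :> {pred G};
  nsub_closed : group_closed nsub_pred;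
  nsub_conj : forall x y : G, x \in nsub_pred -> (x ^ y)%g \in nsub_pred }.

Section QuotientGroup.

Local Open Scope group_scope.
Variables (G : groupType) (N : normal_subgroup G).
Implicit Types x y z : G.

Definition coset_rel : rel G := fun x y => x * y^-1 \in nsub_pred N.

Let N1 : 1 \in nsub_pred N. Proof. exact: (nsub_closed N).1. Qed.
Let NV x : x \in nsub_pred N -> x^-1 \in nsub_pred N.
Proof. exact: (group_closedV (nsub_closed N)). Qed.
Let NM x y : x \in nsub_pred N -> y \in nsub_pred N -> x * y \in nsub_pred N.
Proof. exact: (group_closedM (nsub_closed N)). Qed.

Fact coset_rel_equiv : equiv_class_of coset_rel.
Proof.
split=> [x|x y|y x z]; first by rewrite /coset_rel mulgV.
  by apply/idP/idP => /NV; rewrite invgF.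
rewrite /coset_rel => xy yz.
by have := NM xy yz; rewrite mulgA mulgVK.
Qed.

Canonical coset_equiv := EquivRelPack coset_rel_equiv.

Definition quotient_group := {eq_quot coset_rel}.
HB.instance Definition _ := Choice.on quotient_group.
HB.instance Definition _ := EqQuotient.on quotient_group.

Definition to_quotient (x : G) : quotient_group := \pi_quotient_group x.

Lemma to_quotient_eq x y :
  to_quotient x = to_quotient y <-> x * y^-1 \in nsub_pred N.
Proof. by split=> [/eqmodP|xy]; last exact/eqmodP. Qed.

Lemma repr_to_quotient x : repr (to_quotient x) * x^-1 \in nsub_pred N.
Proof. by apply/to_quotient_eq; rewrite /to_quotient reprK. Qed.

Definition qg_mul (a b : quotient_group) := to_quotient (repr a * repr b).
Definition qg_one := to_quotient 1.
Definition qg_inv (a : quotient_group) := to_quotient (repr a)^-1.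

Lemma to_quotientM x y :
  to_quotient (x * y) = qg_mul (to_quotient x) (to_quotient y).
Proof.
apply/esym/to_quotient_eq.
have Nx := repr_to_quotient x; have Ny := repr_to_quotient y.
set a := repr _ in Nx *; set b := repr _ in Ny *.
have -> : a * b * (x * y)^-1 = conjg (b * y^-1) a^-1 * (a * x^-1).
  by rewrite conjgE invgK invgM !mulgA mulgVK.
by apply: NM => //; apply: nsub_conj.
Qed.

Lemma to_quotientV x : to_quotient x^-1 = qg_inv (to_quotient x).
Proof.
apply/to_quotient_eq; have Nx := repr_to_quotient x.
set a := repr _ in Nx *.
have -> : x^-1 * a^-1^-1 = conjg (a * x^-1) x by rewrite conjgE invgK mulgVK.
exact: nsub_conj.
Qed.

Lemma to_quotientP (a : quotient_group) : exists x, a = to_quotient x.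
Proof. by exists (repr a); rewrite /to_quotient reprK. Qed.

Fact qg_mulA : associative qg_mul.
Proof.
move=> a b c; have [x ->] := to_quotientP a; have [y ->] := to_quotientP b.
by have [z ->] := to_quotientP c; rewrite -!to_quotientM mulgA.
Qed.
Fact qg_mul1 : left_id qg_one qg_mul.
Proof.
by move=> a; have [x ->] := to_quotientP a; rewrite -to_quotientM mul1g.
Qed.
Fact qg_mulg1 : right_id qg_one qg_mul.
Proof.
by move=> a; have [x ->] := to_quotientP a; rewrite -to_quotientM mulg1.
Qed.
Fact qg_mulV : left_inverse qg_one qg_inv qg_mul.
Proof.
move=> a; have [x ->] := to_quotientP a.
by rewrite -to_quotientV -to_quotientM mulVg.
Qed.
Fact qg_mulgV : right_inverse qg_one qg_inv qg_mul.
Proof.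
move=> a; have [x ->] := to_quotientP a.
by rewrite -to_quotientV -to_quotientM mulgV.
Qed.

HB.instance Definition _ := isGroup.Build quotient_group
  qg_mulA qg_mul1 qg_mulg1 qg_mulV qg_mulgV.

End QuotientGroup.

Section CentralCyclic.

Local Open Scope group_scope.
Variables (G : groupType) (z : G) (zC : forall x : G, x * z = z * x).

(* exponents in a groupType are natural numbers, whence the two powers *)
Definition cyclic_pred : {pred G} :=
  fun x => `[< exists m n : nat, x = z ^+ m * z ^- n >].

Let zXC n (x : G) : x * z ^+ n = z ^+ n * x.
Proof.
elim: n => [|n IH]; first by rewrite expg0 mulg1 mul1g.
by rewrite expgS mulgA zC -mulgA IH mulgA.
Qed.

Let zVC n (x : G) : x * z ^- n = z ^- n * x.
Proof. by apply: (mulgI (z ^+ n)) => /=; rewrite mulgA -zXC mulgK mulVKg. Qed.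

Fact cyclic_pred_closed : group_closed cyclic_pred.
Proof.
split; first by apply/asboolP; exists 0%N, 0%N; rewrite mulgV.
move=> _ _ /asboolP[m [n ->]] /asboolP[p [q ->]]; apply/asboolP.
exists (m + q)%N, (n + p)%N; rewrite !expgnDr !invgM invgK.
rewrite -!mulgA; congr (_ * _).
by rewrite mulgA -zVC -mulgA; congr (_ * _); apply: zVC.
Qed.

Fact cyclic_pred_conj (x y : G) : x \in cyclic_pred -> x ^ y \in cyclic_pred.
Proof.
move=> /asboolP[m [n xE]]; apply/asboolP; exists m, n.
have xy : x * y = y * x by rewrite xE -mulgA -zVC mulgA -(zXC m y) mulgA.
by rewrite conjgE xy mulKg.
Qed.

Definition central_cyclic := NormalSubgroup cyclic_pred_closed cyclic_pred_conj.

End CentralCyclic.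

Section GG.

Variables (D : falgType Q2) (u : unit_group Z2).

Fact two_u_subproof : ((2%:R * unit_group_val u)%:F)%:A \is a @GRing.unit D.
Proof.
rewrite -[_%:A]/(in_alg D _) rmorph_unit // unitfE tofrac_eq0 mulf_neq0 //.
  exact: Z2_two_neq0.
by apply: contraTneq (unit_groupP u) => ->; rewrite unitr0.
Qed.

Definition two_u : unit_group D := UnitGroup two_u_subproof.

Fact two_u_central (x : unit_group D) : (x * two_u = two_u * x)%g.
Proof. by apply: val_inj; rewrite /= mulr_algl mulr_algr. Qed.

(* $\mathbb{G}_2(u)$ when D is $\mathbb{D}_2$ *)
Definition GG : groupType := quotient_group (central_cyclic two_u_central).

End GG.

Definition group_class := forall gT : finGroupType, {set gT} -> Prop.

Section Types.

Local Open Scope group_scope.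
Variable gT : finGroupType.
Implicit Types (G : {set gT}) (K H : {group gT}).

(* All semidirect products are nontrivial ones.  C_6, C_3 and Q_8 carry, up to
   conjugacy in the automorphism group and up to the choice of a generator of
   the acting group, a unique nontrivial action of C_2, C_4 and C_3. *)

Definition is_C6_C2 G := exists K H,
  [/\ K ><| H = G, cyclic K /\ #|K| = 6%N, cyclic H /\ #|H| = 2%N
    & ~~ (H \subset 'C(K))].

Definition is_C3_C4 G := exists K H,
  [/\ K ><| H = G, cyclic K /\ #|K| = 3%N, cyclic H /\ #|H| = 4%N
    & ~~ (H \subset 'C(K))].

Definition is_Q8 G : Prop := G \isog 'Q_8.

Definition is_D8 G : Prop := G \isog 'D_8.

Definition is_T24 G := exists K H,
  [/\ K ><| H = G, is_Q8 K, cyclic H /\ #|H| = 3%N & ~~ (H \subset 'C(K))].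

(* C_2 acts on T_24 by a non-inner automorphism, which is what the condition
   on the centraliser amounts to; the resulting group is GL_2(F_3). *)
Definition is_T24_C2 G := exists K H,
  [/\ K ><| H = G, is_T24 K, cyclic H /\ #|H| = 2%N & 'C_G(K) \subset K].

Definition is_O48 G :=
  G \isog Grp (a : b : c : a ^+ 2 = b ^+ 3 = c ^+ 4, c ^+ 4 = a * b * c).

End Types.

Section MaximalFinite.

Local Open Scope classical_set_scope.
Local Open Scope group_scope.
Variable G : groupType.
Implicit Types F E : set G.

Definition finite_subgroup F :=
  [/\ F 1, forall x y, F x -> F y -> F (x * y^-1) & finite_set F].

Definition maximal_finite_subgroup F :=
  finite_subgroup F /\ forall E, finite_subgroup E -> F `<=` E -> E = F.

Definition conjugate_sets F E := exists g : G, E = (fun x => x ^ g) @` F.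

Definition in_class F (C : group_class) :=
  exists (gT : finGroupType) (f : {multiplicative gT -> G}),
    [/\ injective f, range f = F & C gT [set: gT]%SET].

(* The members of L being pairwise non-isomorphic, this says that L represents
   the conjugacy classes of maximal finite subgroups. *)
Definition maximal_finite_classes (L : seq group_class) :=
  (forall F, maximal_finite_subgroup F -> exists2 C, List.In C L & in_class F C)
  /\ (forall C, List.In C L ->
       exists F, [/\ maximal_finite_subgroup F, in_class F C
         & forall E, maximal_finite_subgroup E -> in_class E C ->
             conjugate_sets F E]).

End MaximalFinite.

(* Main.v *)
(* The algebra D is the algebra of Hamilton quaternions over Q_2, and the
   extension v of the 2-adic valuation has values in Z/2.  Let F be a finite
   subgroup of G_2(u) and P the preimage in D^* of the group generated by F and
   -1.  The elements of P of valuation 0 are torsion; they form a subgroup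
   which, up to conjugation, is contained in the group T24 of Hurwitz units, and
   they contain a root of x^2 + 1 or of x^2 + x + 1 unless they are 1 and -1.
   Up to a power of 2u the other elements of P have valuation 1/2, hence P is
   generated by 2u, its elements of valuation 0 and at most one element r of
   valuation 1/2, whose square is 2u times a unit of finite order.  This leaves
   the groups T24, <T24, w(1+i)> with 2u = 2w^2 or 2u = -2w^2, <i, r> with
   r i = -i r, and <-omega, r> with omega a cube root of 1 and
   r omega = omega^2 r; in the last two cases r^2 = 2u or r^2 = -2u determines r
   up to conjugation by the centralizer of i or omega.  Both signs occur for
   omega because every unit of Z_2 is a norm from Q_2(omega), but r^2 = c with
   r i = -i r requires -c to be a sum of two squares, which selects one sign.
   Finally u or -u is a square exactly when u = 1 or -1 mod 8, and then T24,
   <i, r> and one of the two groups <-omega, r> are conjugate to subgroups of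
   the group <T24, w(1+i)>, of order 48 modulo 2u. *)

Require Import Defs.
From HB Require Import structures.
From mathcomp Require Import all_boot all_order all_algebra all_fingroup.
From mathcomp Require Import all_solvable all_field generic_quotient.
From mathcomp Require Import ring lra zify.

Set Implicit Arguments.
Unset Strict Implicit.
Unset Printing Implicit Defensive.

Import Order.TTheory GRing.Theory Num.Theory.
Local Open Scope ring_scope.

(** * Recognition of the groups of the statement *)

(** Maximality is obtained without inspecting overgroups. A finite subgroup conjugate into a
    subgroup of itself is equal to it; so once every finite subgroup is conjugate into a member of
    the list, it suffices that no member is conjugate into another one. This is read off from the
    orders, from the elements of order 4 that C_3 x| C_4 has and C_6 x| C_2 lacks, from the
    valuation 1/2, which does not occur in T24, and, for u = 1 or -1 mod 8, from reduced norms.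

    Adjoining -1 to a finite subgroup keeps its preimage a group and makes all elements of valuation
    0 torsion units of quaternions, but it leaves r^2 known only up to sign. This sign is what
    separates C_6 x| C_2 from C_3 x| C_4 and D_8 from Q_8.

    All questions about torsion rest on one fact: a torsion element congruent to 1 modulo 2 is 1 or
    -1. Since O48 is given only by generators and relations, its order has to be bounded by 48 from
    the presentation, and from below by a model inside the quotient of D^*. *)

Section SmallGroups.

Local Open Scope group_scope.
Variable gT : finGroupType.
Implicit Types (a b c x y z : gT).

Lemma setT_sdprod (K H : {group gT}) :
    H \subset 'N(K) -> K :&: H = 1 ->
    (forall z, exists2 x, x \in K & exists2 y, y \in H & z = x * y) ->
  K ><| H = [set: gT].
Proof.
move=> nKH tiKH gen; rewrite sdprodE //; apply/eqP; rewrite -subTset.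
by apply/subsetP => z _; have [x Kx [y Hy ->]] := gen z; apply: mem_mulg.
Qed.

Lemma cycle_norm x y : x ^ y = x^-1 -> <[y]> \subset 'N(<[x]>).
Proof. by move=> xy; rewrite norms_cycle xy groupV cycle_id. Qed.

Lemma cycle_not_cent x y : x ^ y = x^-1 -> x ^+ 2 != 1 ->
  ~~ (<[y]> \subset 'C(<[x]>)).
Proof.
move=> xy; apply: contra; rewrite cent_cycle cycle_subG => /cent1P xyC.
have xx : x ^ y = x by rewrite conjgE -xyC mulKg.
by rewrite expgS expg1 -{2}xx xy mulgV.
Qed.

Lemma C6_C2_of_generators a x :
    #[a] = 6%N -> x ^+ 2 = 1 -> x \notin <[a]> -> a ^ x = a^-1 ->
    (forall z, exists m n, z = a ^+ m * x ^+ n) ->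
  is_C6_C2 [set: gT].
Proof.
move=> oa x2 xa ax gen.
have x1 : x != 1 by apply: contraNneq xa => ->; apply: group1.
have ox : #[x] = 2%N by apply: nt_prime_order.
exists <[a]>%G, <[x]>%G; split.
- apply: setT_sdprod; first exact: cycle_norm.
    by rewrite setIC prime_TIg ?cycle_subG //= -orderE ox.
  move=> z; have [m [n ->]] := gen z; exists (a ^+ m); first exact: mem_cycle.
  by exists (x ^+ n); first exact: mem_cycle.
- by rewrite cycle_cyclic -orderE oa.
- by rewrite cycle_cyclic -orderE ox.
by apply: cycle_not_cent => //; rewrite -order_dvdn oa.
Qed.

Lemma C3_C4_of_generators a x :
    #[a] = 3%N -> #[x] = 4%N -> a ^ x = a^-1 ->
    (forall z, exists m n, z = a ^+ m * x ^+ n) ->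
  is_C3_C4 [set: gT].
Proof.
move=> oa ox ax gen; exists <[a]>%G, <[x]>%G; split.
- apply: setT_sdprod; first exact: cycle_norm.
    by rewrite coprime_TIg // -!orderE oa ox.
  move=> z; have [m [n ->]] := gen z; exists (a ^+ m); first exact: mem_cycle.
  by exists (x ^+ n); first exact: mem_cycle.
- by rewrite cycle_cyclic -orderE oa.
- by rewrite cycle_cyclic -orderE ox.
by apply: cycle_not_cent => //; rewrite -order_dvdn oa.
Qed.

Lemma gen2_setT a x : (forall z, exists m n, z = a ^+ m * x ^+ n) ->
  [set: gT] = <[a]> <*> <[x]>.
Proof.
move=> gen; apply/eqP; rewrite eqEsubset subsetT andbT; apply/subsetP => z _.
have [m [n ->]] := gen z.
by rewrite groupM // mem_gen // inE mem_cycle ?orbT.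
Qed.

Lemma card_gt_of_notin (K G : {group gT}) x : K \subset G -> x \in G ->
  x \notin K -> (2 * #|K| <= #|G|)%N.
Proof.
move=> sKG Gx xK; rewrite -(Lagrange sKG) mulnC leq_mul2l; apply/orP; right.
rewrite ltnNge; apply: contra xK => iK.
have : #|G : K| = 1%N by apply/eqP; rewrite eqn_leq iK indexg_gt0.
by move/eqP; rewrite indexg_eq1 => /subsetP; apply.
Qed.

(** The relations make the group a quotient of ['D_8], and the proper subgroup [<[a]>] of order 4
    forces at least 8 elements. The next lemma argues in the same way with ['Q_8]. *)
Lemma D8_of_generators a x :
    #[a] = 4%N -> x ^+ 2 = 1 -> x \notin <[a]> -> a ^ x = a^-1 ->
    (forall z, exists m n, z = a ^+ m * x ^+ n) ->
  is_D8 [set: gT].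
Proof.
move=> oa x2 xa ax gen.
have pres : [set: gT] \homg Grp (x : y : x ^+ 4, y ^+ 2, x ^ y = x^-1).
  apply/existsP; exists (a, x); rewrite /= -(gen2_setT gen) x2 ax -oa expg_order.
  by rewrite !eqxx.
have isoD := @Grp_dihedral 4 isT.
apply/(isoGrpP _ isoD); split=> //; rewrite (@card_dihedral 4) //.
apply/eqP; rewrite eqn_leq; apply/andP; split; last first.
  have := @card_gt_of_notin <[a]> [group of [set: gT]] x (subsetT _) (in_setT _) xa.
  by rewrite -orderE oa.
by rewrite -[leqRHS](@card_dihedral 4) //; apply: leq_homg; rewrite isoD.
Qed.

Lemma Q8_of_generators (G : {group gT}) a x :
    #[a] = 4%N -> x ^+ 2 = a ^+ 2 -> x \notin <[a]> -> a ^ x = a^-1 ->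
    G :=: <[a]> <*> <[x]> ->
  is_Q8 G.
Proof.
move=> oa x2 xa ax GE.
have pres : G \homg Grp (x : y : x ^+ 4, y ^+ 2 = x ^+ 2, x ^ y = x^-1).
  apply/existsP; exists (a, x); rewrite /= -GE x2 ax -oa expg_order.
  by rewrite !eqxx.
have isoQ := @Grp_quaternion 3 isT.
apply/(isoGrpP _ isoQ); split=> //.
rewrite (@card_quaternion 3) //.
apply/eqP; rewrite eqn_leq; apply/andP; split; last first.
  have [sa sx] : <[a]> \subset G /\ x \in G.
    by rewrite GE joing_subl (subsetP (joing_subr _ _)) ?cycle_id.
  by have := card_gt_of_notin sa sx xa; rewrite -orderE oa.
by rewrite -[leqRHS](@card_quaternion 3) //; apply: leq_homg; rewrite isoQ.
Qed.

End SmallGroups.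

(** * Coset enumeration for the presentation of O48 *)

Section O48Presentation.

Local Open Scope group_scope.
Variable gT : finGroupType.
Variables (b c z : gT).
(** The generator [a] of the presentation is eliminated: [a ^+ 2 = a * b * c] says [a = b * c]. *)
Hypotheses (b3 : b * b * b = z) (c4 : c * c * c * c = z) (bcbc : b * c * b * c = z).

Let zb : z * b = b * z. Proof. by rewrite -b3 !mulgA. Qed.
Let zc : z * c = c * z. Proof. by rewrite -c4 !mulgA. Qed.

Let bb : b * b = z * b^-1. Proof. by rewrite -b3 mulgK. Qed.
Let ccc : c * c * c = z * c^-1. Proof. by rewrite -c4 mulgK. Qed.
Let zVb : z * b^-1 = b^-1 * z.
Proof. by apply: (mulgI b); rewrite mulgA -zb mulgK mulKVg. Qed.
Let zVc : z * c^-1 = c^-1 * z.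
Proof. by apply: (mulgI c); rewrite mulgA -zc mulgK mulKVg. Qed.

Let zbA x : x * z * b = x * b * z. Proof. by rewrite -mulgA zb mulgA. Qed.
Let zcA x : x * z * c = x * c * z. Proof. by rewrite -mulgA zc mulgA. Qed.
Let zVbA x : x * z * b^-1 = x * b^-1 * z. Proof. by rewrite -mulgA zVb mulgA. Qed.
Let zVcA x : x * z * c^-1 = x * c^-1 * z. Proof. by rewrite -mulgA zVc mulgA. Qed.
(** Rewriting to a normal form: products associate to the left, the central [z] moves to the right,
    adjacent inverses cancel. *)
Let norm := (@mulgA gT, zb, zc, zVb, zVc, zbA, zcA, zVbA, zVcA, @mulgK gT, @mulgKV gT).

Let cbc : c * b * c = b^-1 * z.
Proof. by apply: (mulgI b); rewrite !mulgA bcbc mulgV mul1g. Qed.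

Let bcb : b * c * b = c^-1 * z.
Proof. by apply: (mulIg c); rewrite bcbc !norm mulVg mul1g. Qed.

Let cb : c * b = b^-1 * c^-1 * z.
Proof. by apply: (mulIg c); rewrite cbc !norm. Qed.

Let bc : b * c = c^-1 * b^-1 * z.
Proof. by apply: (mulIg b); rewrite bcb !norm. Qed.

Let cVc : c * b^-1 * c = b^-1 * c^-1 * c^-1 * b^-1 * z.
Proof.
apply: (mulIg z); have -> : c * b^-1 * c * z = (c * b) * (b * c).
  by rewrite !mulgA -(mulgA c b b) bb !norm.
by rewrite cb bc !norm.
Qed.

Let bVV : b^-1 * b^-1 * z = b.
Proof. by rewrite -b3 !mulgA mulgKV mulVg mul1g. Qed.

(* z = c^4 is the square of i = c^2 and of its conjugate j = b i b^-1, and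
   (i j)^2 = z, so that conjugation by i inverts j and z = z^-1. *)
Lemma O48_central_sqr : z * z = 1.
Proof.
have [i iE] : exists i, i = c * c by exists (c * c).
have ii : i * i = z by rewrite iE !mulgA.
have zi : z * i = i * z by rewrite iE !norm.
have [j jE] : exists j, j = b * i * b^-1 by exists (b * i * b^-1).
have jj : j * j = z by rewrite jE !mulgA mulgKV -(mulgA b) ii -zb mulgK.
have ij : i * j = b^-1 * i^-1 * b * z.
  rewrite jE iE invMg.
  have -> : c * c * (b * (c * c) * b^-1) = c * (c * b * c) * c * b^-1.
    by rewrite !mulgA.
  rewrite cbc; have -> : c * (b^-1 * z) * c * b^-1 = (c * b^-1 * c) * b^-1 * z.
    by rewrite !norm.
  rewrite cVc !norm; congr (_ * z).
  by rewrite -(mulgA _ b^-1 b^-1) -(mulgA _ _ z) bVV.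
have ijij : i * j * (i * j) = z.
  have zVi : z * i^-1 = i^-1 * z.
    by apply: (mulgI i); rewrite mulgA -zi mulgK mulKVg.
  have zViA x : x * z * i^-1 = x * i^-1 * z by rewrite -mulgA zVi mulgA.
  rewrite ij !(norm, zViA) -(mulgA b^-1) -invMg ii.
  by rewrite -(mulgA _ b z) -zb mulgA mulgKV mulVg mul1g.
have jij : j * i * j = i.
  by apply: (mulgI i); rewrite ii !mulgA -mulgA ijij.
have jV : i^-1 * j * i = j^-1.
  by apply: (mulgI i); apply: (mulIg j); rewrite !mulgA mulgV mul1g jij mulgKV.
have : (i^-1 * j * i) * (i^-1 * j * i) = z.
  by rewrite !mulgA mulgK -(mulgA i^-1) jj -(mulgA _ z) zi mulKg.
by rewrite jV -invMg jj => zV; rewrite -{1}zV mulVg.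
Qed.

Let T := [:: 1; b; b^-1; c * b^-1; c * c * b^-1; b * c * c * b^-1].

(* The six left cosets of <[c]> are the faces of a cube. *)
Lemma O48_card_le : (#|<<[set b; c]>>| <= 48)%N.
Proof.
pose C := <[c]>; pose X := [set x in T] * C.
have CX t x : t \in T -> x \in C -> t * x \in X.
  by move=> tT xC; apply: mem_mulg => //; rewrite in_set.
have cC : c \in C by apply: cycle_id.
have zC : z \in C by rewrite -c4 !groupM.
have ccb : c * c * c * b^-1 = b * c.
  by rewrite ccc bc !norm.
have bcVb : b * c * b^-1 = c * c * b^-1 * c^-1.
  have -> : c * c * b^-1 = c^-1 * (b * c) by rewrite -ccb -!mulgA mulKg.
  by rewrite !mulgA mulgK bc !norm -(mulgA _ b^-1 b^-1) -(mulgA _ _ z) bVV.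
have ccbV : c * c * b^-1 = b * c * b^-1 * c by rewrite bcVb mulgKV.
have stable g : (forall t, t \in T -> g * t \in X) -> forall x, x \in X -> g * x \in X.
  move=> gT' _ /mulsgP[t x + xC ->]; rewrite in_set => /gT'/mulsgP[t' x' + x'C E].
  by rewrite in_set mulgA E => t'T; rewrite -mulgA CX // groupM.
have bX : forall t, t \in T -> b * t \in X.
  move=> t; rewrite !inE => /or4P[/eqP->|/eqP->|/eqP->|/or3P[/eqP->|/eqP->|/eqP->]].
  - by rewrite mulg1 -[b]mulg1 CX // ?inE ?eqxx ?orbT.
  - by rewrite bb zVb CX // !inE eqxx !orbT.
  - by rewrite mulgV -[1]mulg1 CX // !inE eqxx.
  - rewrite mulgA bcVb CX ?groupV // !inE eqxx !orbT //.
  - by rewrite !mulgA -[_ * _]mulg1 CX // !inE eqxx !orbT.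
  - have -> : b * (b * c * c * b^-1) = c * b^-1 * (z * c).
      by rewrite -!mulgA (mulgA c c) ccbV !mulgA b3 !norm.
    by rewrite CX ?groupM // !inE eqxx !orbT.
have cX : forall t, t \in T -> c * t \in X.
  move=> t; rewrite !inE => /or4P[/eqP->|/eqP->|/eqP->|/or3P[/eqP->|/eqP->|/eqP->]].
  - by rewrite mulg1 -[c]mul1g CX // !inE eqxx.
  - by rewrite cb -mulgA CX ?groupM ?groupV // !inE eqxx !orbT.
  - by rewrite -[_ * _]mulg1 CX // !inE eqxx !orbT.
  - by rewrite mulgA -[_ * _]mulg1 CX // !inE eqxx !orbT.
  - by rewrite !mulgA ccb CX // !inE eqxx !orbT.
  - have -> : c * (b * c * c * b^-1) = b * c * c * b^-1 * c^-1.
      transitivity (b * (c * c * b^-1 * c^-1)); last by rewrite !mulgA.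
      by rewrite -bcVb !mulgA cbc bb !norm.
    by rewrite CX ?groupV // !inE eqxx !orbT.
have sHX : <<[set b; c]>> \subset X.
  (* The elements whose left multiplication preserves [X] form a subgroup containing [b] and [c];
     applied to [1], which is in [X], they lie in [X]. *)
  pose A := [set g | [forall x in X, g * x \in X]].
  have gA : group_set A.
    apply/group_setP; split=> [|g h].
      by rewrite inE; apply/forall_inP => x; rewrite mul1g.
    rewrite !inE => /forall_inP gX /forall_inP hX.
    by apply/forall_inP => x /hX/gX; rewrite mulgA.
  have sHA : <<[set b; c]>> \subset Group gA.
    rewrite gen_subG; apply/subsetP => g; rewrite !inE.
    by case/orP=> /eqP ->; apply/forall_inP; [apply: stable bX | apply: stable cX].
  apply/subsetP => g /(subsetP sHA); rewrite inE => /forall_inP/(_ 1).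
  by rewrite mulg1; apply; rewrite -[1]mulg1 CX // !inE eqxx.
apply: leq_trans (subset_leq_card sHX) _.
have oC : (#|C| <= 8)%N.
  rewrite -orderE dvdn_leq // order_dvdn -(O48_central_sqr) -c4.
  by rewrite !expgS expg0 mulg1 !mulgA.
have le6 : (#|[set x in T]| <= 6)%N by rewrite cardsE; apply: card_size.
apply: leq_trans (_ : #|[set x in T]| * #|C| <= _)%N; last exact: (leq_mul le6 oC).
rewrite -cardsX; apply: leq_trans (leq_imset_card (fun p => p.1 * p.2) _).
apply/subset_leq_card/subsetP => _ /mulsgP[t x tT xC ->].
by apply/imsetP; exists (t, x) => //; apply/setXP.
Qed.

End O48Presentation.

Section O48.

Local Open Scope group_scope.

Lemma O48_pres_card (rT : finGroupType) (H : {group rT}) :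
    H \homg Grp (a : b : c : a ^+ 2 = b ^+ 3 = c ^+ 4, c ^+ 4 = a * b * c) ->
  (#|H| <= 48)%N.
Proof.
case/existsP=> -[[a b] c] /= /eqP[HE a2 b3 abc].
have aE : a = b * c.
  by apply: (mulgI a); rewrite mulgA -abc -a2 !expgS expg0 mulg1.
have -> : H :=: <<[set b; c]>>.
  have [bG cG] : b \in <<[set b; c]>> /\ c \in <<[set b; c]>>.
    by split; apply: mem_gen; rewrite !inE eqxx ?orbT.
  apply/eqP; rewrite eqEsubset; apply/andP; split.
    by rewrite -HE !join_subG !cycle_subG aE groupM ?bG ?cG.
  rewrite gen_subG -HE; apply/subsetP => g; rewrite !inE => /orP[]/eqP->.
    apply: (subsetP (joing_subl _ _)); apply: (subsetP (joing_subr _ _)).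
    exact: cycle_id.
  by apply: (subsetP (joing_subr _ _)); apply: cycle_id.
have e3 (x : rT) : x * x * x = x ^+ 3 by rewrite !expgS expg0 mulg1 !mulgA.
have e4 (x : rT) : x * x * x * x = x ^+ 4 by rewrite !expgS expg0 mulg1 !mulgA.
apply: (@O48_card_le _ b c (c ^+ 4)); [by rewrite e3 | exact: e4 |].
by rewrite -a2 aE !expgS expg0 mulg1 !mulgA.
Qed.

(* The subgroup of gT * rT generated by the pairs of generators satisfies the
   presentation, so that it is the graph of a morphism from gT. *)
Lemma O48_of_generators (gT : finGroupType) (a b c : gT) :
    a ^+ 2 = c ^+ 4 -> b ^+ 3 = c ^+ 4 -> c ^+ 4 = a * b * c ->
    [set: gT] = <[a]> <*> <[b]> <*> <[c]> -> (48 <= #|[set: gT]|)%N ->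
  is_O48 [set: gT].
Proof.
move=> a2 b3 abc gen card48; apply: intro_isoGrp.
  by apply/existsP; exists (a, b, c); rewrite /= -gen a2 b3 -abc !eqxx.
move=> rT H; case/existsP=> -[[a' b'] c'] /= /eqP[HE a2' b3' abc'].
pose K := <[(a, a')]> <*> <[(b, b')]> <*> <[(c, c')]>.
have pX (x : gT) (y : rT) n : (x, y) ^+ n = (x ^+ n, y ^+ n).
  by elim: n => [//|n IH]; rewrite !expgS IH.
have K48 : (#|K| <= 48)%N.
  apply: (@O48_pres_card _ [group of K]); apply/existsP.
  exists ((a, a'), (b, b'), (c, c')); rewrite /= !pX a2 b3 a2' b3'.
  rewrite xpair_eqE eqxx /= !xpair_eqE !eqxx /=.
  by rewrite -abc -abc' !eqxx.
have fK : @fst gT rT @* K = [set: gT].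
  by rewrite !morphimY ?subsetT // !morphim_cycle ?inE //= -gen.
have sK : @snd gT rT @* K = H.
  by rewrite !morphimY ?subsetT // !morphim_cycle ?inE //= HE.
have isoK : [set: gT] \isog K.
  rewrite isogEcard (leq_trans K48 card48) andbT.
  have : @fst gT rT @* K \homg K by apply: morphim_homg; apply: subsetT.
  by rewrite fK.
have HK : H \homg K.
  have : @snd gT rT @* K \homg K by apply: morphim_homg; apply: subsetT.
  by rewrite sK.
by apply: homg_trans HK (isog_hom _); rewrite isog_sym.
Qed.

End O48.

(** * Criteria for T24 and its extension, orders, and an invariant of the groups of order 12 *)

Section FiniteGroupClasses.

Local Open Scope group_scope.
Variable gT : finGroupType.

Lemma T24_of_generators (G Q : {group gT}) i w :
    is_Q8 Q -> i \in Q -> #[w] = 3%N -> w \in 'N(Q) -> i ^ w != i ->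
    G :=: Q * <[w]> ->
  is_T24 G.
Proof.
move=> Q8 iQ ow wN iw GE; exists Q, <[w]>%G; split=> //.
- rewrite sdprodE ?cycle_subG // coprime_TIg // -orderE ow.
  by rewrite (card_isog Q8) (@card_quaternion 3).
- by rewrite cycle_cyclic -orderE ow.
apply: contra iw; rewrite cycle_subG => /centP/(_ i iQ) wi.
by rewrite conjgE -wi mulKg.
Qed.

Lemma T24_C2_of_generators (K : {group gT}) y :
    is_T24 K -> y ^+ 2 = 1 -> y \notin K -> y \in 'N(K) ->
    (forall z, z \notin K -> exists2 k, k \in K & k ^ z != k) ->
    (forall z, exists2 k, k \in K & exists n, z = k * y ^+ n) ->
  is_T24_C2 [set: gT].
Proof.
move=> T y2 yK yN cent gen.
have y1 : y != 1 by apply: contraNneq yK => ->.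
have oy : #[y] = 2%N by apply: nt_prime_order.
exists K, <[y]>%G; split=> //.
- apply: setT_sdprod; first by rewrite cycle_subG.
    by rewrite setIC prime_TIg ?cycle_subG //= -orderE oy.
  move=> z; have [k Kk [n ->]] := gen z; exists k => //.
  by exists (y ^+ n); first exact: mem_cycle.
- by rewrite cycle_cyclic -orderE oy.
apply/subsetP => z /setIP[_ /centP zC]; apply/negPn/negP => /cent[k Kk].
by rewrite conjgE -zC // mulKg eqxx.
Qed.

Lemma card_C6_C2 : is_C6_C2 [set: gT] -> #|gT| = 12%N.
Proof.
case=> K [H [KHG [_ oK] [_ oH] _]].
by rewrite -cardsT -(sdprod_card KHG) oK oH.
Qed.

Lemma card_C3_C4 : is_C3_C4 [set: gT] -> #|gT| = 12%N.
Proof.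
case=> K [H [KHG [_ oK] [_ oH] _]].
by rewrite -cardsT -(sdprod_card KHG) oK oH.
Qed.

Lemma card_D8 : is_D8 [set: gT] -> #|gT| = 8%N.
Proof. by move/card_isog; rewrite cardsT => ->; rewrite (@card_dihedral 4). Qed.

Lemma card_Q8 : is_Q8 [set: gT] -> #|gT| = 8%N.
Proof. by move/card_isog; rewrite cardsT => ->; rewrite (@card_quaternion 3). Qed.

Lemma card_T24 (G : {group gT}) : is_T24 G -> #|G| = 24%N.
Proof.
case=> K [H [KHG Q [_ oH] _]].
by rewrite -(sdprod_card KHG) oH (card_isog Q) (@card_quaternion 3).
Qed.

Lemma card_T24_C2 : is_T24_C2 [set: gT] -> #|gT| = 48%N.
Proof.
case=> K [H [KHG T [_ oH] _]].
by rewrite -cardsT -(sdprod_card KHG) oH (card_T24 T).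
Qed.

(** A generator of the complement has order 4. With the next lemma this separates the two classes of
    order 12. *)
Lemma C3_C4_order4 : is_C3_C4 [set: gT] ->
  exists x : gT, x ^+ 2 <> 1 /\ x ^+ 4 = 1.
Proof.
case=> K [H [_ _ [/cyclicP[x HE] oH] _]]; exists x.
have ox : #[x] = 4%N by rewrite orderE -HE.
by split; [apply/eqP; rewrite -order_dvdn ox | rewrite -ox expg_order].
Qed.

(* The exponent of a split extension of C_2 by C_6 is 6: if a generates C_6 and
   a^y = a^r then r is odd, whence (a^m y)^2 = a^(m (r + 1)) has order dividing 3. *)
Lemma C6_C2_order4 : is_C6_C2 [set: gT] ->
  forall x : gT, x ^+ 4 = 1 -> x ^+ 2 = 1.
Proof.
case=> K [H [KH [/cyclicP[a KE] oK] [/cyclicP[y HE] oH] _]] x x4.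
have oa : #[a] = 6%N by rewrite orderE -KE.
have oy : #[y] = 2%N by rewrite orderE -HE.
have [_ KHE nKH _] := sdprodP KH.
have y2 : y ^+ 2 = 1 by rewrite -oy expg_order.
have yV : y^-1 = y by apply: (mulgI y); rewrite mulgV -y2 !expgS expg0 mulg1.
have a6 : a ^+ 6 = 1 by rewrite -oa expg_order.
have [r ayE] : exists r, a ^ y = a ^+ r.
  apply/cycleP; rewrite -KE memJ_norm ?KE ?cycle_id // -KE.
  by rewrite (subsetP nKH) // HE cycle_id.
have r_odd : odd r.
  apply/negPn/negP => r_even; have : (a ^ y) ^+ 3 = 1.
    by rewrite ayE -(even_halfK r_even) -expgM -muln2 -mulnA mulnC expgM a6 expg1n.
  rewrite -conjXg => /(canRL (conjgK y)); rewrite conj1g => /eqP.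
  by rewrite -order_dvdn oa.
suff x6 : x ^+ 6 = 1 by rewrite -[LHS]mulg1 -x4 -expgD x6.
have /mulsgP[k h] : x \in K * H by rewrite KHE inE.
rewrite KE HE => /cycleP[m ->] /cycleP[n ->] ->.
rewrite -(odd_double_half n) -mul2n expgD expgM y2 expg1n mulg1.
case: (odd n) => /=; last by rewrite mulg1 -expgM mulnC expgM a6 expg1n.
have sq : (a ^+ m * y) ^+ 2 = a ^+ (m * r.+1).
  have yay : y * a ^+ m * y = a ^+ (r * m).
    by rewrite expgM -ayE -conjXg conjgE yV mulgA.
  by rewrite !expgS expg0 mulg1 -mulgA (mulgA y) yay -expgD mulnS [(m * r)%N]mulnC.
have r1 : r.+1 = (r.+1./2 * 2)%N by lia.
rewrite expg1 (expgM _ 2 3) sq -expgM r1.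
have -> : (m * (r.+1./2 * 2) * 3 = 6 * (m * r.+1./2))%N by lia.
by rewrite expgM a6 expg1n.
Qed.

End FiniteGroupClasses.

(** Groups with the same presentation are quotients of each other. This transfers to every such
    group the lower bound 48, which is available only for a concrete model. *)
Lemma card_O48 (gT gT' : finGroupType) :
  is_O48 [set: gT] -> is_O48 [set: gT'] -> #|gT| = #|gT'|.
Proof.
move=> O O'; rewrite -!cardsT; apply/eqP; rewrite eqn_leq.
have h1 : ([set: gT] \homg [set: gT'])%g.
  by rewrite (O' _ [set: gT]%G); apply: (isoGrp_hom (G := [set: gT]%G) O).
have h2 : ([set: gT'] \homg [set: gT])%g.
  by rewrite (O _ [set: gT']%G); apply: (isoGrp_hom (G := [set: gT']%G) O').
by rewrite (leq_homg (G := [set: gT']%G) h1) (leq_homg (G := [set: gT]%G) h2).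
Qed.

From mathcomp Require Import boolp classical_sets cardinality.

(** * Arithmetic of the 2-adic integers *)

Section TwoAdicIntegers.
Implicit Types (x y z w d : Z2) (k n : nat).

Let pow2_gt1 k : (1 < 2 ^ k.+1)%N.
Proof. by rewrite -{1}(expn0 2) ltn_exp2l. Qed.

Lemma Z2_levelD x y k : (x + y) k = x k + y k. Proof. by []. Qed.
Lemma Z2_levelN x k : (- x) k = - x k. Proof. by []. Qed.
Lemma Z2_levelM x y k : (x * y) k = x k * y k. Proof. by []. Qed.

Lemma Z2_level_eq x y k : (x k == y k) = ((x - y) k == 0).
Proof. by rewrite Z2_levelD Z2_levelN subr_eq0. Qed.

(** Level [k] is the residue modulo 2^(k+1), so doubling gains a level; this is what makes the maps
    of [Z2_fixpoint] contracting. *)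
Lemma Z2_level_double d k : d k = 0 -> (2%:R * d) k.+1 = 0.
Proof.
move=> d0; have /eqP := Z2P d k; rewrite d0 -/(dvdn _ _) => /dvdnP[m dE].
rewrite Z2_levelM -[d k.+1]natr_Zp dE.
rewrite (_ : Z2_seq 2%:R k.+1 = 2%:R) //.
apply: val_inj; rewrite -natrM /= val_Zp_nat ?pow2_gt1 //.
by rewrite mulnCA -expnS modnMl.
Qed.

Lemma Z2_level0_double d : (2%:R * d) 0%N = 0.
Proof.
rewrite Z2_levelM (_ : Z2_seq 2%:R 0%N = 0) ?mul0r //.
by apply: val_inj.
Qed.

Lemma Z2_half x : x 0%N = 0 -> exists z, x = 2%:R * z.
Proof.
move=> x0.
have xlt k : (x k < 2 ^ k.+1)%N.
  by rewrite -[ltnRHS](@Zp_cast (2 ^ k.+1)) // ltn_ord.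
have xeven k : (2 %| x k)%N.
  elim: k => [|k IH]; first by rewrite x0.
  move: IH; rewrite -(Z2P x k) /dvdn modn_dvdm //.
  by rewrite expnS dvdn_mulr.
(* Halving loses one level, so the residue of the half at level [k] is read off level [k.+1] of
   [x]. *)
pose zs k : 'Z_(2 ^ k.+1) := ((x k.+1)./2)%:R.
have zsE k : nat_of_ord (zs k) = (x k.+1)./2.
  rewrite /zs val_Zp_nat // modn_small // -divn2 ltn_divLR // -expnSr.
  exact: xlt.
have zP : Z2_coherent zs.
  apply/asboolP => k; rewrite !zsE -(Z2P x k.+1) -!divn2.
  by rewrite modn_divl -expnSr.
exists (MkZ2 zP); apply: Z2_eqP => k; apply: ord_inj.
rewrite Z2_levelM (_ : Z2_seq 2%:R k = 2%:R) //.
rewrite (_ : Z2_seq (MkZ2 zP) k = ((x k.+1)./2)%:R) // -natrM val_Zp_nat //.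
by rewrite mul2n even_halfK ?Z2P //; have := xeven k.+1; rewrite dvdn2.
Qed.

Lemma Z2_odd_or_even x : exists z, x = 2%:R * z \/ x = 1 + 2%:R * z.
Proof.
have [x0|x0] := eqVneq (x 0%N) 0.
  by have [z ->] := Z2_half x0; exists z; left.
have /Z2_half[z xE] : (x - 1) 0%N = 0.
  apply/eqP; rewrite -Z2_level_eq; apply/eqP; apply: val_inj => /=.
  have := ltn_ord (x 0%N); have := x0.
  rewrite -(inj_eq val_inj) /=; case: (nat_of_ord (x 0%N)) => [|[|n]] //.
by exists z; right; rewrite -xE addrCA subrr addr0.
Qed.

(** Contraction principle: each application of [f] makes one more level agree, so the iterates of 0
    stabilize at every level and their diagonal is the fixed point. It plays the part of Hensel's
    lemma, giving inverses and square roots. *)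
Lemma Z2_fixpoint (f : Z2 -> Z2) :
    (forall x y, exists c, f x - f y = 2%:R * (c * (x - y))) ->
  exists x, f x = x.
Proof.
move=> fP.
have f0 x y : f x 0%N = f y 0%N.
  apply/eqP; rewrite Z2_level_eq; have [c ->] := fP x y.
  by rewrite Z2_level0_double.
have fS x y k : x k = y k -> f x k.+1 = f y k.+1.
  move=> /eqP; rewrite Z2_level_eq => /eqP xy.
  apply/eqP; rewrite Z2_level_eq; have [c ->] := fP x y.
  by rewrite Z2_level_double // Z2_levelM xy mulr0.
pose a k := iter k.+1 f 0.
have aS k : a k.+1 k = a k k.
  by elim: k => [|k IH]; [apply: f0 | apply: fS IH].
have LP : Z2_coherent (fun k => a k k).
  by apply/asboolP => k; rewrite Z2P aS.
exists (MkZ2 LP); apply: Z2_eqP => -[|k]; first exact: f0.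
by rewrite (fS _ (a k)).
Qed.

Lemma Z2_unit_odd z : 1 + 2%:R * z \is a GRing.unit.
Proof.
have [x y|y yE] := @Z2_fixpoint (fun y => 1 - 2%:R * (z * y)).
  by exists (- z); ring.
have E : y * (1 + 2%:R * z) = 1.
  by rewrite mulrDr mulr1 -{1}yE; ring.
by apply/unitrP; exists y; split; rewrite // mulrC.
Qed.

(** Since (1 + 4t)^2 = 1 + 8(t + 2t^2), the root is [1 + 4t] for a fixed point of t -> z - 2t^2. *)
Lemma Z2_sqrt z : exists r, r ^+ 2 = 1 + 8%:R * z.
Proof.
have [x y|t tE] := @Z2_fixpoint (fun t => z - 2%:R * t ^+ 2).
  by exists (- (x + y)); ring.
exists (1 + 4%:R * t).
by rewrite -(subrK (2%:R * t ^+ 2) z) tE; ring.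
Qed.

Lemma Z2_unitE x : x \is a GRing.unit <-> exists z, x = 1 + 2%:R * z.
Proof.
split=> [xU|[z ->]]; last exact: Z2_unit_odd.
have [z [xE|xE]] := Z2_odd_or_even x; last by exists z.
have /(congr1 (fun w : Z2 => w 0%N)) := mulrV xU.
by rewrite {1}xE -mulrA Z2_level0_double => /(congr1 val).
Qed.

Lemma Z2_unit_mod8 x : x \is a GRing.unit ->
  exists z, [\/ x = 1 + 8%:R * z, x = 3%:R + 8%:R * z,
               x = 5%:R + 8%:R * z | x = 7%:R + 8%:R * z].
Proof.
move=> /Z2_unitE[a ->]; have [b [->|->]] := Z2_odd_or_even a;
  have [c [->|->]] := Z2_odd_or_even b; exists c.
- by constructor 1; ring.
- by constructor 3; ring.
- by constructor 2; ring.
- by constructor 4; ring.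
Qed.

Lemma Z2_factor x : x != 0 ->
  exists k w, w \is a GRing.unit /\ x = 2%:R ^+ k * w.
Proof.
move=> xN0; have [k] : exists k, x k != 0.
  apply/not_existsP => h; case/eqP: xN0; apply: Z2_eqP => k.
  by apply/eqP; have /negP := h k; rewrite negbK.
elim: k x {xN0} => [|k IH] x; have [z [xE|xE]] := Z2_odd_or_even x.
- by rewrite xE Z2_level0_double eqxx.
- by move=> _; exists 0%N, x; rewrite expr0 mul1r; split=> //; apply/Z2_unitE; exists z.
- move=> xk; have /IH[m [w [wU zE]]] : z k != 0.
    by apply: contraNneq xk => z0; rewrite xE Z2_level_double.
  by exists m.+1, w; split=> //; rewrite xE zE exprS mulrA.
- by move=> _; exists 0%N, x; rewrite expr0 mul1r; split=> //; apply/Z2_unitE; exists z.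
Qed.

(** [x / c] is 1 modulo 8, hence a square: the residue modulo 8 determines the square class of a
    unit. *)
Lemma Z2_square_class x c z : c \is a GRing.unit -> x = c + 8%:R * z ->
  exists r, x = c * r ^+ 2.
Proof.
move=> cU ->; have [r rE] := Z2_sqrt (z / c); exists r.
by rewrite rE mulrDr mulr1 mulrCA [c * _]mulrC divrK.
Qed.

End TwoAdicIntegers.

(** * Quaternion algebras *)

Section QuaternionCoordinates.

Variables (F : fieldType) (D : algType F).

Definition qmk (i j : D) (a b c d : F) : D :=
  a *: 1 + b *: i + c *: j + d *: (i * j).

Variables (al be : F) (i j : D).
Hypotheses (ii : i * i = al%:A) (jj : j * j = be%:A) (ji : j * i = - (i * j)).

Local Notation q := (qmk i j).

Lemma qmkD a b c d a' b' c' d' :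
  q a b c d + q a' b' c' d' = q (a + a') (b + b') (c + c') (d + d').
Proof.
by rewrite /qmk !scalerDl; do 3!(rewrite addrACA; congr (_ + _)).
Qed.

Lemma qmkZ k a b c d : k *: q a b c d = q (k * a) (k * b) (k * c) (k * d).
Proof. by rewrite /qmk !scalerDr !scalerA. Qed.

Lemma qmkN a b c d : - q a b c d = q (- a) (- b) (- c) (- d).
Proof. by rewrite -scaleN1r qmkZ !mulN1r. Qed.

Lemma qmk_const a : a%:A = q a 0 0 0.
Proof. by rewrite /qmk !scale0r !addr0. Qed.

Lemma qmk1 : 1 = q 1 0 0 0.
Proof. by rewrite -qmk_const scale1r. Qed.

Lemma qmk_i : i = q 0 1 0 0.
Proof. by rewrite /qmk !scale0r !addr0 add0r scale1r. Qed.

Lemma qmk_j : j = q 0 0 1 0.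
Proof. by rewrite /qmk !scale0r !addr0 !add0r scale1r. Qed.

Lemma qmk_ij : i * j = q 0 0 0 1.
Proof. by rewrite /qmk !scale0r !add0r scale1r. Qed.

Lemma qmk0 : 0 = q 0 0 0 0.
Proof. by rewrite /qmk !scale0r !addr0. Qed.

Lemma qmkM a b c d a' b' c' d' :
  q a b c d * q a' b' c' d' =
  q (a * a' + al * (b * b') + be * (c * c') - al * be * (d * d'))
    (a * b' + b * a' - be * (c * d') + be * (d * c'))
    (a * c' + c * a' + al * (b * d') - al * (d * b'))
    (a * d' + d * a' + b * c' - c * b').
Proof.
have i_ij : i * (i * j) = q 0 0 al 0.
  by rewrite mulrA ii -scalerAl mul1r {1}qmk_j qmkZ !mulr0 mulr1.
have ij_i : i * j * i = q 0 0 (- al) 0.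
  by rewrite -mulrA ji mulrN i_ij qmkN !oppr0.
have ij_j : i * j * j = q 0 be 0 0.
  by rewrite -mulrA jj -scalerAr mulr1 {1}qmk_i qmkZ !mulr0 mulr1.
have j_ij : j * (i * j) = q 0 (- be) 0 0.
  by rewrite mulrA ji mulNr ij_j qmkN !oppr0.
have ij_ij : i * j * (i * j) = q (- (al * be)) 0 0 0.
  rewrite mulrA ij_i -qmk_const {1}/qmk !scale0r !addr0 add0r.
  by rewrite -scalerAl jj scalerA -mulNr.
have ii' : i * i = q al 0 0 0 by rewrite ii qmk_const.
have jj' : j * j = q be 0 0 0 by rewrite jj qmk_const.
have ij' : i * j = q 0 0 0 1 by apply: qmk_ij.
have ji' : j * i = q 0 0 0 (- 1) by rewrite ji ij' qmkN !oppr0.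
have Zi x : x *: i = q 0 x 0 0 by rewrite {1}qmk_i qmkZ !mulr0 mulr1.
have Zj x : x *: j = q 0 0 x 0 by rewrite {1}qmk_j qmkZ !mulr0 mulr1.
rewrite {1 2}/qmk !(mulrDl, mulrDr) -!scalerAl -!scalerAr !scalerA.
rewrite !(mulr1, mul1r) i_ij ij_i ij_j j_ij ij_ij ii' jj' ji' ij'.
by rewrite !Zi !Zj qmk1 !qmkZ !qmkD; congr qmk; ring.
Qed.

Hypothesis (two0 : 2%:R != 0 :> F) (al0 : al != 0) (be0 : be != 0).

(** Independence of 1, i, j, ij from the relations alone: al x + i x i is 2 al times the part of x
    in 1 and i, then be x + j x j isolates the constant, and multiplication by j brings the other
    two coordinates to this position. *)
Lemma qmk_eq0 a b c d : q a b c d = 0 -> [/\ a = 0, b = 0, c = 0 & d = 0].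
Proof.
have half x : x + x = 0 -> x = 0 :> F.
  by move=> xx; apply/eqP; move/eqP: xx; rewrite -mulr2n -mulr_natl mulf_eq0 (negPf two0).
move=> x0.
have Ex e f g h :
    q e f g h = 0 -> q 0 1 0 0 * q e f g h * q 0 1 0 0 = 0 /\
                     q 0 0 1 0 * q e f g h * q 0 0 1 0 = 0.
  by move=> ->; rewrite !mulr0 !mul0r.
have E1 e f g h : q e f g h = 0 -> q e f 0 0 = 0.
  move=> e0; have [+ _] := Ex _ _ _ _ e0.
  rewrite !qmkM => E.
  have : (2%:R * al) *: q e f 0 0 = 0.
    rewrite -[RHS](addr0 0) -{1}E -(scaler0 _ al) -e0 !qmkZ qmkD.
    by congr qmk; ring.
  by move/eqP; rewrite scaler_eq0 mulf_eq0 (negPf two0) (negPf al0) => /eqP.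
have E2 e f : q e f 0 0 = 0 -> e = 0 /\ f = 0.
  move=> e0; have [_] := Ex _ _ _ _ e0; rewrite !qmkM => E.
  have /eqP : (2%:R * be * e)%:A = 0 :> D.
    rewrite -[RHS](addr0 0) -{1}E -(scaler0 _ be) -e0 !qmkZ qmkD qmk_const.
    by congr qmk; ring.
  rewrite scaler_eq0 oner_eq0 orbF !mulf_eq0 (negPf two0) (negPf be0) => /eqP e1.
  split=> //; move: e0; rewrite e1 => /(congr1 (fun x => x * q 0 1 0 0)).
  rewrite qmkM mul0r => /eqP.
  rewrite !(mul0r, mulr0, mulr1, addr0, add0r, subr0, subrr, sub0r) -qmk_const.
  by rewrite scaler_eq0 oner_eq0 orbF mulf_eq0 (negPf al0) => /eqP.
have [a0 b0] := E2 _ _ (E1 _ _ _ _ x0).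
have : q 0 0 c d * q 0 0 1 0 = 0 by move: x0; rewrite a0 b0 => ->; rewrite mul0r.
rewrite qmkM => /E1/E2[/eqP + /eqP].
rewrite !(mul0r, mulr0, mulr1, addr0, add0r, subr0, subrr, sub0r).
by rewrite oppr0 add0r !mulf_eq0 (negPf be0) /= => /eqP c0 /eqP d0.
Qed.

Lemma qmk_inj a b c d a' b' c' d' : q a b c d = q a' b' c' d' ->
  [/\ a = a', b = b', c = c' & d = d'].
Proof.
move=> E; have : q a b c d - q a' b' c' d' = 0 by rewrite E subrr.
rewrite qmkN qmkD => /qmk_eq0[].
by do 4!move=> /subr0_eq ->.
Qed.

End QuaternionCoordinates.

Lemma frac_numden (R : idomainType) (x : {fraction R}) :
  exists n d : R, d != 0 /\ x = n%:F / d%:F.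
Proof.
elim/quotW: x => r; exists (\n_r)%R, (\d_r)%R; split; first exact: denom_ratioP.
have dN0 : (\d_r)%:F != 0 :> {fraction R} by rewrite tofrac_eq0 denom_ratioP.
apply: (mulIf dN0); rewrite divfK //.
rewrite -[_ * _]/(FracField.mul _ _) !piE.
apply/eqmodP; rewrite /= FracField.equivfE /FracField.mulf.
by rewrite !numden_Ratio ?mulf_neq0 ?oner_neq0 ?denom_ratioP // !mulr1 mulrC.
Qed.

Lemma Q2_two_neq0 : 2%:R != 0 :> Q2.
Proof.
have := Z2_two_neq0.
by rewrite -(rmorph_nat (@tofrac Z2)) tofrac_eq0.
Qed.

Lemma Q2_factor (c : Q2) : c != 0 -> exists k, Q2_val c k.
Proof.
have [n [d [dN0 ->]]] := frac_numden c.
have [->|nN0 _] := eqVneq n 0; first by rewrite tofrac0 mul0r eqxx.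
have [k [w [wU nE]]] := Z2_factor nN0; have [l [w' [w'U dE]]] := Z2_factor dN0.
exists (k%:Z - l%:Z), (w / w'); first by rewrite unitrM wU unitrV w'U.
rewrite nE dE !rmorphM /= !rmorphXn /= rmorph_nat rmorphV //= invfM.
by rewrite expfzDr ?Q2_two_neq0 // -exprnP -exprnN mulrACA.
Qed.

(** * Valuation estimates, and torsion congruent to 1 modulo 2 *)

Section Valued.

Variables (D : falgType Q2) (v : D -> rat).
Hypotheses (Ddiv : is_division_algebra D) (vP : extends_Q2_val v).

Implicit Types (x y z : D) (a b c : Q2) (r s : rat).

Lemma mulD_neq0 x y : x != 0 -> y != 0 -> x * y != 0.
Proof.
move=> x0 y0; apply: contraNneq y0 => xy0.
by rewrite -[y](mulKr (Ddiv x0)) xy0 mulr0.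
Qed.

Lemma mulD_eq0 x y : x * y = 0 -> x = 0 \/ y = 0.
Proof.
have [->|x0] := eqVneq x 0; first by left.
have [->|y0] := eqVneq y 0; first by right.
by move/eqP; rewrite (negPf (mulD_neq0 x0 y0)).
Qed.

Lemma expD_neq0 x n : x != 0 -> x ^+ n != 0.
Proof.
move=> x0; elim: n => [|n IH]; first by rewrite expr0 oner_neq0.
by rewrite exprS mulD_neq0.
Qed.

Lemma invD_neq0 x : x != 0 -> x^-1 != 0.
Proof. by rewrite invr_eq0. Qed.

Lemma valuM x y : x != 0 -> y != 0 -> v (x * y) = v x + v y.
Proof. by case: vP => + _ _; apply. Qed.

Lemma val_scalar c k : Q2_val c k -> v c%:A = k%:~R.
Proof. by case: vP => _ _; apply. Qed.

Lemma scalar_neq0 c : c != 0 -> c%:A != 0 :> D.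
Proof. by rewrite scaler_eq0 oner_eq0 orbF. Qed.

Lemma val_scalar_int c : c != 0 -> exists k : int, v c%:A = k%:~R.
Proof. by move=> /Q2_factor[k /val_scalar]; exists k. Qed.

Lemma val_unit (w : Z2) : w \is a GRing.unit -> v (w%:F)%:A = 0.
Proof.
move=> wU; rewrite (@val_scalar _ 0) //; exists w => //.
by rewrite expr0z mul1r.
Qed.

Lemma valu1 : v 1 = 0.
Proof. by have := val_unit (unitr1 _); rewrite rmorph1 scale1r. Qed.

Lemma val_two : v (2%:R)%:A = 1.
Proof.
rewrite (@val_scalar _ 1) //; exists 1; first exact: unitr1.
by rewrite tofrac1 mulr1 expr1z.
Qed.

Lemma valuX x n : x != 0 -> v (x ^+ n) = n%:R * v x.
Proof.
move=> x0; elim: n => [|n IH]; first by rewrite expr0 valu1 mul0r.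
by rewrite exprS valuM ?expD_neq0 // IH -natr1; ring.
Qed.

Lemma valuN1 : v (- 1) = 0.
Proof.
have N0 : (- 1 : D) != 0 by rewrite oppr_eq0 oner_eq0.
have := valuX 2 N0; rewrite sqrrN expr1n valu1 => /esym/eqP.
by rewrite mulf_eq0 pnatr_eq0 /= => /eqP.
Qed.

Lemma valuN x : v (- x) = v x.
Proof.
have [->|x0] := eqVneq x 0; first by rewrite oppr0.
by rewrite -mulN1r valuM ?valuN1 ?add0r // oppr_eq0 oner_eq0.
Qed.

Lemma valuV x : x != 0 -> v x^-1 = - v x.
Proof.
move=> x0; apply/eqP; rewrite -addr_eq0 -valuM ?invD_neq0 //.
by rewrite mulVr ?valu1 // Ddiv.
Qed.

Lemma valuJ x z : x != 0 -> z != 0 -> v (z * x * z^-1) = v x.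
Proof.
move=> x0 z0; rewrite !valuM ?valuV ?mulD_neq0 ?invD_neq0 //.
by rewrite addrAC subrr add0r.
Qed.

Lemma val_torsion x n : (0 < n)%N -> x ^+ n = 1 -> v x = 0.
Proof.
move=> n0 xn; have x0 : x != 0.
  by apply: contra_eq_neq xn => ->; rewrite expr0n gtn_eqF // eq_sym oner_neq0.
have /eqP := valuX n x0; rewrite xn valu1 eq_sym mulf_eq0 pnatr_eq0 gtn_eqF //=.
by move/eqP.
Qed.

(** Supplies the convention v(0) = +oo, which [extends_Q2_val] leaves open, so that sums may
    vanish. *)
Definition val_ge x r := (x == 0) || (r <= v x).

Lemma val_ge_0 r : val_ge 0 r. Proof. by rewrite /val_ge eqxx. Qed.

Lemma val_geD x y r : val_ge x r -> val_ge y r -> val_ge (x + y) r.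
Proof.
rewrite /val_ge; have [->|x0] := eqVneq x 0; first by rewrite add0r.
have [->|y0] := eqVneq y 0; first by rewrite addr0 /= => -> _; rewrite orbT.
have [//|xy0] := eqVneq (x + y) 0; rewrite /= => vx vy.
by apply: le_trans (_ : Num.min (v x) (v y) <= _);
  [rewrite le_min vx | case: vP => _ + _; apply].
Qed.

Lemma val_geN x r : val_ge (- x) r = val_ge x r.
Proof. by rewrite /val_ge oppr_eq0 valuN. Qed.

Lemma val_geB x y r : val_ge x r -> val_ge y r -> val_ge (x - y) r.
Proof. by move=> xr yr; rewrite val_geD // val_geN. Qed.

Lemma val_geM x y r s : val_ge x r -> val_ge y s -> val_ge (x * y) (r + s).
Proof.
rewrite /val_ge; have [->|x0] := eqVneq x 0; first by rewrite mul0r eqxx.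
have [->|y0] := eqVneq y 0; first by rewrite mulr0 eqxx.
by rewrite /= => vx vy; rewrite valuM // lerD // orbT.
Qed.

Lemma val_ge_le x r s : r <= s -> val_ge x s -> val_ge x r.
Proof. by rewrite /val_ge => rs /orP[->|/(le_trans rs) ->]; rewrite ?orbT. Qed.

Lemma val_ge_scalar c : val_ge c%:A 0 <-> exists w : Z2, c = w%:F.
Proof.
split=> [|[w ->]]; last first.
  have [->|/Z2_factor[k [e [eU wE]]]] := eqVneq w 0.
    by rewrite rmorph0 scale0r val_ge_0.
  rewrite /val_ge (@val_scalar _ k) ?ler0z ?orbT //.
  by exists e; rewrite // wE rmorphM /= rmorphXn rmorph_nat exprnP.
have [->|c0] := eqVneq c 0; first by exists 0; rewrite rmorph0.
rewrite /val_ge (negPf (scalar_neq0 c0)) /=.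
have [k ck] := Q2_factor c0; rewrite (val_scalar ck) ler0z.
case: k ck => // k [w _ ->] _; exists (2%:R ^+ k * w).
by rewrite rmorphM /= rmorphXn rmorph_nat.
Qed.

Lemma val_ge_two (w : Z2) : val_ge ((2%:R * w)%:F)%:A 1.
Proof.
rewrite rmorphM /= -scalerA -[_%:A]mul1r scalerAl.
rewrite -[X in val_ge _ X]addr0; apply: val_geM; last by apply/val_ge_scalar; exists w.
by rewrite rmorph_nat /val_ge val_two lexx orbT.
Qed.

Lemma val_eq0_scalar c : c != 0 -> v c%:A = 0 ->
  exists2 w : Z2, w \is a GRing.unit & c = w%:F.
Proof.
move=> c0; have [k ck] := Q2_factor c0; rewrite (val_scalar ck) => /eqP.
rewrite intr_eq0 => /eqP k0; case: ck => w wU; rewrite k0 expr0z mul1r.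
by exists w.
Qed.

(** In z^n - 1 = (z - 1)(1 + z + ... + z^(n-1)) the second factor is congruent to the odd number n
    modulo 2, hence nonzero. *)
Lemma odd_pow_torsion z n : odd n -> val_ge (z - 1) 1 -> z ^+ n = 1 -> z = 1.
Proof.
move=> nodd z1 zn.
have zX m : val_ge (z ^+ m - 1) 1.
  elim: m => [|m IH]; first by rewrite expr0 subrr val_ge_0.
  rewrite (_ : _ - 1 = (z - 1) * (z ^+ m - 1) + (z - 1) + (z ^+ m - 1)).
    apply: val_geD (IH); apply: val_geD (z1).
    by apply: val_ge_le (val_geM z1 IH); lra.
  by rewrite mulrBl mul1r mulrBr mulr1 -exprS [RHS]addrAC subrK addrA subrK.
have S1 m : val_ge (\sum_(i < m) z ^+ i - m%:R) 1.
  elim: m => [|m IH]; first by rewrite big_ord0 subrr val_ge_0.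
  by rewrite big_ord_recr /= -natr1 opprD addrACA val_geD.
have := subrX1 z n; rewrite zn subrr => /esym/mulD_eq0[/subr0_eq //|S0].
have := S1 n; rewrite S0 sub0r val_geN => n1.
have : val_ge (n%:R - (2%:R * (n./2)%:R) : D) 1.
  apply: val_geB => //; have := val_ge_two (n./2)%:R.
  by rewrite rmorphM /= !rmorph_nat -natrM scaler_nat natrM.
rewrite -natrM mul2n -{1}(odd_double_half n) nodd natrD addrK.
by rewrite /val_ge oner_eq0 valu1.
Qed.

Lemma val_two_nat : v (2%:R) = 1.
Proof. by rewrite -val_two scaler_nat. Qed.

(** Otherwise (z - 1)(z + 1) = -2, where both factors on the left have valuation at least 1. *)
Lemma sq_neq_N1 z : val_ge (z - 1) 1 -> z ^+ 2 <> - 1.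
Proof.
move=> z1 zz.
have : val_ge ((z - 1) * (z + 1)) (1 + 1).
  apply: val_geM => //; rewrite (_ : z + 1 = (z - 1) + 2%:R).
    by rewrite val_geD // /val_ge val_two_nat lexx orbT.
  by rewrite (natrD _ 1 1) addrA subrK.
rewrite -subr_sqr_1 zz -opprD val_geN -(natrD _ 1 1) /val_ge val_two_nat.
rewrite -(scaler_nat 2 (1 : D)) (negPf (scalar_neq0 Q2_two_neq0)) /=.
by lra.
Qed.

(** Strong induction on n. For n even, z^(n/2) is 1 or -1, and only -1 is new; then n/2 is odd
    because -1 is not the square of a power of z, and [odd_pow_torsion] applies to -z. *)
Lemma torsion_cong1 z n : (0 < n)%N -> val_ge (z - 1) 1 -> z ^+ n = 1 ->
  z = 1 \/ z = - 1.
Proof.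
move=> + z1; elim/ltn_ind: n => n IH n0 zn.
have zX m : val_ge (z ^+ m - 1) 1.
  elim: m => [|m IHm]; first by rewrite expr0 subrr val_ge_0.
  rewrite exprS (_ : _ - 1 = z * (z ^+ m - 1) + (z - 1)).
    apply: val_geD (z1); rewrite -[X in val_ge _ X]add0r; apply: val_geM (IHm).
    rewrite -[z](subrK 1); apply: val_geD (val_ge_le _ (z1)) _ => //.
    by rewrite /val_ge valu1 lexx orbT.
  by rewrite mulrBr mulr1 addrA subrK.
have [nodd|/negP] := boolP (odd n); first by left; apply: odd_pow_torsion zn.
move=> /negP neven; have nE : n = (n./2 * 2)%N by lia.
have : (z ^+ n./2 - 1) * (z ^+ n./2 + 1) = 0.
  by rewrite -subr_sqr_1 -exprM -nE zn subrr.
case/mulD_eq0 => [/subr0_eq|/eqP]; first by apply: IH; lia.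
rewrite addr_eq0 => /eqP zh.
have [hodd|heven] := boolP (odd n./2).
  right; apply/eqP; rewrite -[z]opprK eqr_oppLR opprK; apply/eqP.
  apply: (@odd_pow_torsion _ n./2) => //.
    rewrite -opprD val_geN (_ : z + 1 = (z - 1) + 2%:R).
      by rewrite val_geD // /val_ge val_two_nat lexx orbT.
    by rewrite (natrD _ 1 1) addrA subrK.
  by rewrite exprNn -signr_odd hodd zh mulrNN mulr1.
have hE : n./2 = (n./2./2 * 2)%N by lia.
by have := sq_neq_N1 (zX n./2./2); rewrite -exprM -hE zh.
Qed.

End Valued.

(* The last clause says that Q_2(omega), for omega = (-1+i+j+ij)/2 a primitive
   cube root of 1, is unramified. *)
Definition hamilton_frame (D : falgType Q2) (v : D -> rat) (i j : D) :=
  [/\ is_division_algebra D /\ extends_Q2_val v,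
      [/\ i * i = - 1, j * j = - 1 & j * i = - (i * j)],
      forall x, exists a b c d, x = qmk i j a b c d
    & forall a b, qmk i j a b b b != 0 ->
        exists k : int, v (qmk i j a b b b) = k%:~R].

(** * Coordinates, reduced norm and intertwiners in the Hamilton quaternions *)

Section Frame.

Variables (D : falgType Q2) (v : D -> rat) (i j : D).
Hypothesis frame : hamilton_frame v i j.

Let Ddiv : is_division_algebra D. Proof. by case: frame => -[]. Qed.
Let vP : extends_Q2_val v. Proof. by case: frame => -[]. Qed.

Local Notation q := (qmk i j).
Implicit Types (x y z : D) (a b c d t n : Q2).

Let ii : i * i = (- 1)%:A.
Proof. by case: frame => _ [-> _ _] _ _; rewrite scaleN1r. Qed.
Let jj : j * j = (- 1)%:A.
Proof. by case: frame => _ [_ -> _] _ _; rewrite scaleN1r. Qed.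
Let ji : j * i = - (i * j). Proof. by case: frame => _ []. Qed.

Lemma qP x : exists a b c d, x = q a b c d.
Proof. by case: frame => _ _ + _; apply. Qed.

Lemma qM a b c d a' b' c' d' :
  q a b c d * q a' b' c' d' =
  q (a * a' - b * b' - c * c' - d * d') (a * b' + b * a' + c * d' - d * c')
    (a * c' + c * a' - b * d' + d * b') (a * d' + d * a' + b * c' - c * b').
Proof. by rewrite (qmkM ii jj ji); congr qmk; ring. Qed.

Let N1 : - 1 != 0 :> Q2. Proof. by rewrite oppr_eq0 oner_neq0. Qed.

Lemma q_inj a b c d a' b' c' d' : q a b c d = q a' b' c' d' ->
  [/\ a = a', b = b', c = c' & d = d'].
Proof. exact: (qmk_inj ii jj ji Q2_two_neq0 N1 N1). Qed.

Lemma q0 : q 0 0 0 0 = 0. Proof. exact/esym/qmk0. Qed.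
Lemma q1 : q 1 0 0 0 = 1. Proof. exact/esym/qmk1. Qed.

Lemma q_eq0 a b c d : q a b c d = 0 -> [/\ a = 0, b = 0, c = 0 & d = 0].
Proof. by rewrite -q0 => /q_inj. Qed.

Lemma qX2 a b c d : q a b c d ^+ 2 =
  q (a ^+ 2 - b ^+ 2 - c ^+ 2 - d ^+ 2) (2%:R * a * b) (2%:R * a * c) (2%:R * a * d).
Proof. by rewrite expr2 qM; congr qmk; ring. Qed.

Definition qnorm a b c d := a ^+ 2 + b ^+ 2 + c ^+ 2 + d ^+ 2.

Lemma q_conjM a b c d : q a b c d * q a (- b) (- c) (- d) = (qnorm a b c d)%:A.
Proof. by rewrite qM (qmk_const i j); congr qmk; rewrite /qnorm; ring. Qed.

Lemma qnorm_eq0 a b c d : qnorm a b c d = 0 ->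
  [/\ a = 0, b = 0, c = 0 & d = 0].
Proof.
move=> n0; have := q_conjM a b c d; rewrite n0 scale0r.
case/(mulD_eq0 Ddiv) => [/q_eq0 //|/q_eq0[-> /eqP + /eqP + /eqP]].
by rewrite !oppr_eq0 => /eqP -> /eqP -> /eqP ->.
Qed.

Lemma qnorm_neq0 a b c d : q a b c d != 0 -> qnorm a b c d != 0.
Proof. by apply: contra_neq => /qnorm_eq0[-> -> -> ->]; rewrite q0. Qed.

(** A quaternion and its conjugate are conjugate in D^*: a pure quaternion orthogonal to the
    imaginary part, such as c i - b j, or i when b = c = 0, anticommutes with that part. *)
Lemma val_conj a b c d : q a b c d != 0 ->
  v (q a (- b) (- c) (- d)) = v (q a b c d).
Proof.
move=> x0; have [z z0 zx] : exists2 z, z != 0 &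
    z * q a b c d = q a (- b) (- c) (- d) * z.
  have [/andP[/eqP b0 /eqP c0]|bc0] := boolP ((b == 0) && (c == 0)).
    exists (q 0 1 0 0); last by rewrite !qM b0 c0; congr qmk; ring.
    by apply/eqP => /q_eq0[_ /eqP]; rewrite oner_eq0.
  exists (q 0 c (- b) 0); last by rewrite !qM; congr qmk; ring.
  apply: contra bc0 => /eqP/q_eq0[_ -> /eqP + _].
  by rewrite oppr_eq0 eqxx andbT.
have -> : q a (- b) (- c) (- d) = z * q a b c d * z^-1.
  by rewrite zx mulrK // Ddiv.
exact: valuJ.
Qed.

Lemma conj_neq0 a b c d : q a b c d != 0 -> q a (- b) (- c) (- d) != 0.
Proof.
apply: contra_neq => /q_eq0[-> /eqP + /eqP + /eqP].
by rewrite !oppr_eq0 => /eqP -> /eqP -> /eqP ->; rewrite q0.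
Qed.

Lemma val_qnorm a b c d : q a b c d != 0 ->
  v (qnorm a b c d)%:A = 2%:R * v (q a b c d).
Proof.
move=> x0; rewrite -q_conjM (valuM vP) ?conj_neq0 // val_conj //.
by rewrite mulr_natl mulr2n.
Qed.

Lemma val_half_int x : x != 0 -> exists k : int, 2%:R * v x = k%:~R.
Proof.
have [a [b [c [d ->]]]] := qP x => x0.
rewrite -(val_qnorm x0).
apply: val_scalar_int.
  exact: vP.
exact: (qnorm_neq0 x0).
Qed.

Lemma q_i : i = q 0 1 0 0. Proof. exact: qmk_i. Qed.
Lemma q_j : j = q 0 0 1 0. Proof. exact: qmk_j. Qed.
Lemma q_const a : a%:A = q a 0 0 0. Proof. exact: qmk_const. Qed.

Lemma i_neq0 : i != 0.
Proof.
by apply/eqP; rewrite {1}q_i => /q_eq0[_ /eqP]; rewrite oner_eq0.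
Qed.

Lemma double_eq0 a : a + a = 0 -> a = 0.
Proof.
move/eqP; rewrite -mulr2n -mulr_natl mulf_eq0 (negPf Q2_two_neq0).
by move/eqP.
Qed.

Lemma eq_opp_eq0 a : a = - a -> a = 0.
Proof. by move=> E; apply: double_eq0; rewrite {2}E subrr. Qed.

Definition simpq :=
  (mul0r, mulr0, mulr1, mul1r, addr0, add0r, subr0, sub0r, oppr0,
   @mulrN Q2, @mulNr Q2, @opprK Q2).

Lemma commute_i a b c d : q a b c d * i = i * q a b c d -> c = 0 /\ d = 0.
Proof.
move=> E; have : q a b c d * q 0 1 0 0 = q 0 1 0 0 * q a b c d by rewrite -q_i.
rewrite !qM !simpq => /q_inj[_ _ d0 /esym c0].
by split; apply: eq_opp_eq0.
Qed.

Lemma commute_j a b c d : q a b c d * j = j * q a b c d -> b = 0 /\ d = 0.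
Proof.
move=> E; have : q a b c d * q 0 0 1 0 = q 0 0 1 0 * q a b c d by rewrite -q_j.
rewrite !qM !simpq => /q_inj[_ /esym d0 _ b0].
by split; apply: eq_opp_eq0.
Qed.

Lemma anticommute_i a b c d : q a b c d * i = - (i * q a b c d) ->
  a = 0 /\ b = 0.
Proof.
move=> E; have : q a b c d * q 0 1 0 0 = - (q 0 1 0 0 * q a b c d).
  by rewrite -q_i.
rewrite !qM !simpq qmkN !simpq => /q_inj[/esym b0 a0 _ _].
by split; apply: eq_opp_eq0.
Qed.

Lemma center_scalar x : x * i = i * x -> x * j = j * x -> exists a, x = a%:A.
Proof.
have [a [b [c [d ->]]]] := qP x => /commute_i[-> ->] /commute_j[-> _].
by exists a; rewrite q_const.
Qed.

(* Skolem-Noether for quadratic elements: [x w + w (y - t)] intertwines x and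
   y for every w, and w can be taken in {1, i, j}. *)
Lemma intertwine x y t n : (forall a, x <> a%:A) ->
    x * x = t *: x - n%:A -> y * y = t *: y - n%:A ->
  exists2 z, z != 0 & x * z = z * y.
Proof.
move=> xnc xx yy; pose z w := x * w + w * y - t *: w.
have zP w : x * z w = z w * y.
  rewrite /z mulrBr mulrDr mulrBl mulrDl !mulrA xx -(mulrA w y y) yy.
  rewrite mulrBl mulrBr -!scalerAl mul1r -!scalerAr mulr1.
  rewrite [LHS]addrAC [_ - _ - _]addrAC subrr add0r addrC.
  by rewrite -[RHS]addrA [t *: (w * y) - _ - _]addrAC subrr add0r.
have [z1|z1] := eqVneq (z 1) 0; last by exists (z 1).
have zE w : z w = x * w - w * x.
  rewrite [z w]/z; have -> : x = t%:A - y.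
    by apply/eqP; rewrite eq_sym -subr_eq0 -opprB oppr_eq0 -[in eqbRHS]z1
       /z mulr1 mul1r opprB addrA.
  rewrite mulrBl mulrBr -scalerAl -scalerAr mul1r mulr1.
  by rewrite opprB addrA.
have [zi|zi] := eqVneq (z i) 0; last by exists (z i).
have [zj|zj] := eqVneq (z j) 0; last by exists (z j).
case: (@center_scalar x) => [||a /xnc //]; apply/eqP; rewrite -subr_eq0 -zE.
  by rewrite zi.
by rewrite zj.
Qed.

End Frame.

(** * Elements of finite order in D^* *)

Section Torsion.

Variables (D : falgType Q2) (v : D -> rat) (i j : D).
Hypothesis frame : hamilton_frame v i j.

Let Ddiv : is_division_algebra D. Proof. by case: frame => -[]. Qed.
Let vP : extends_Q2_val v. Proof. by case: frame => -[]. Qed.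

Local Notation q := (qmk i j).
Implicit Types (x y z : D) (a b c d t : Q2).

(* z = 1 + x' x^-1 works unless x' = - x, in which case z = s - s' does. *)
Lemma conj_by_centralizer s s' x x' : s != s' -> s * s' = s' * s ->
    x * s = s' * x -> x * s' = s * x -> x' * s = s' * x' -> x' * s' = s * x' ->
    x != 0 -> x * x = x' * x' ->
  exists z, [/\ z != 0, z * s = s * z & z * x = x' * z].
Proof.
move=> ss' sC xs xs' x's x's' x0 xx.
have xU := Ddiv x0.
have Vs : x^-1 * s = s' * x^-1.
  by apply: (mulrI xU); rewrite mulVKr // mulrA xs' mulrK.
have [/eqP|z0] := eqVneq (1 + x' * x^-1) 0; last first.
  exists (1 + x' / x); split=> //.
    by rewrite mulrDl mulrDr mul1r mulr1 -mulrA Vs !mulrA x's'.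
  by rewrite mulrDl mulrDr mul1r mulr1 divrK // mulrA -xx mulrK // addrC.
rewrite addrC addr_eq0 => /eqP /(congr1 (fun w => w * x)).
rewrite divrK // mulN1r => x'E; exists (s - s'); split.
- by rewrite subr_eq0.
- by rewrite mulrBl mulrBr sC.
- by rewrite x'E mulNr mulrBl mulrBr xs xs' opprB.
Qed.

Lemma q_trace a b c d : q a b c d + q a (- b) (- c) (- d) = (2%:R * a)%:A.
Proof. by rewrite qmkD (q_const i j); congr qmk; ring. Qed.

Lemma q_sqr a b c d :
  q a b c d ^+ 2 = (2%:R * a) *: q a b c d - (qnorm a b c d)%:A.
Proof.
rewrite (qX2 frame) (q_const i j) qmkZ qmkN qmkD /qnorm; congr qmk; ring.
Qed.

(** The reduced norm is anisotropic; here it is evaluated at (a, b, 1, 0), and in the next lemma at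
    (a, 1, 1, 1). *)
Lemma sqr_neqN1 a b : a ^+ 2 + b ^+ 2 <> - 1.
Proof.
move=> E; have : qnorm a b 1 0 = 0 by rewrite /qnorm E; ring.
by case/(qnorm_eq0 frame) => _ _ /eqP; rewrite oner_eq0.
Qed.

Lemma sqr_neqN3 a : a ^+ 2 <> - 3%:R.
Proof.
move=> E; have : qnorm a 1 1 1 = 0 by rewrite /qnorm E; ring.
by case/(qnorm_eq0 frame) => _ /eqP; rewrite oner_eq0.
Qed.

Lemma sqr_eqN1_q a b c d : q a b c d ^+ 2 = - 1 -> a = 0 /\ qnorm a b c d = 1.
Proof.
rewrite (qX2 frame) -(scaleN1r 1) (q_const i j) => /(q_inj frame).
have [-> [E _ _ _]|a0 []] := eqVneq a 0.
  by split=> //; rewrite -[RHS]opprK -E /qnorm; ring.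
have tz e : 2%:R * a * e = 0 -> e = 0.
  move=> /eqP; rewrite mulf_eq0 [_ * a == 0]mulf_eq0.
  by rewrite (negPf Q2_two_neq0) (negPf a0) => /eqP.
move=> + /tz b0 /tz c0 /tz d0; rewrite b0 c0 d0 => E.
by case: (@sqr_neqN1 a 0); rewrite -E; ring.
Qed.

Lemma cubic_q a b c d : q a b c d ^+ 2 + q a b c d + 1 = 0 ->
  2%:R * a = - 1 /\ qnorm a b c d = 1.
Proof.
rewrite (qX2 frame) -[X in _ + X](q1 i j) !qmkD => /(q_eq0 frame).
have [a1|a1 []] := eqVneq (2%:R * a + 1) 0; last first.
  have tz e : 2%:R * a * e + e + 0 = 0 -> e = 0.
    rewrite addr0 -[X in _ + X]mul1r -mulrDl => /eqP; rewrite mulf_eq0 (negPf a1).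
    by move/eqP.
  move=> + /tz b0 /tz c0 /tz d0; rewrite b0 c0 d0 => E.
  case: (@sqr_neqN3 (2%:R * a + 1)).
  transitivity (4%:R * (a ^+ 2 - 0 ^+ 2 - 0 ^+ 2 - 0 ^+ 2 + a + 1) - 3%:R).
    by ring.
  by rewrite E; ring.
have aE : 2%:R * a = - 1 by apply/eqP; rewrite -addr_eq0 a1.
case=> E _ _ _; split=> //.
transitivity (a * (2%:R * a) + a + 1 -
  (a ^+ 2 - b ^+ 2 - c ^+ 2 - d ^+ 2 + a + 1)); first by rewrite /qnorm; ring.
by rewrite E aE; ring.
Qed.

(** A torsion x satisfies x^2 = t x - n with t in Z_2 and n an odd unit. Modulo 2 this gives x^2 = 1
    if t is even and x^2 = x + 1, hence x^3 = 1, if t is odd; [torsion_cong1] then applies to x^2 or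
    x^3. *)
Lemma torsion_pow x n : (0 < n)%N -> x ^+ n = 1 ->
  [\/ x ^+ 2 = 1, x ^+ 2 = - 1, x ^+ 3 = 1 | x ^+ 3 = - 1].
Proof.
move=> n0 xn; have [a [b [c [d xE]]]] := qP frame x.
have x0 : x != 0.
  by apply: contra_eq_neq xn => ->; rewrite expr0n gtn_eqF // eq_sym oner_neq0.
have vx : v x = 0 := val_torsion Ddiv vP n0 xn.
have vx' : val_ge v x 0 by rewrite /val_ge vx lexx orbT.
have vc : v (q a (- b) (- c) (- d)) = 0.
  by rewrite (val_conj frame) -xE.
have [w tE] : exists w : Z2, 2%:R * a = w%:F.
  apply/(val_ge_scalar vP); rewrite -(q_trace a b c d); apply: (val_geD vP).
    by rewrite -xE.
  by rewrite /val_ge vc lexx orbT.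
have nm0 : qnorm a b c d != 0 by apply: (qnorm_neq0 frame); rewrite -xE.
have [m mU mE] : exists2 m : Z2, m \is a GRing.unit & qnorm a b c d = m%:F.
  apply: (val_eq0_scalar vP nm0); rewrite (val_qnorm frame) -xE //.
  by rewrite vx mulr0.
have xx : x ^+ 2 = (w%:F) *: x - (m%:F)%:A by rewrite -tE -mE xE q_sqr.
have ve (e : Z2) : val_ge v ((2%:R * e)%:F *: x) 1.
  rewrite -[_ *: x]mulr_algl -[X in val_ge _ _ X]addr0.
  by apply: (val_geM vP) vx'; apply: val_ge_two.
have vs (e : Z2) : val_ge v ((2%:R * e)%:F)%:A 1 by apply: val_ge_two.
have tors k : (x ^+ k) ^+ n = 1 by rewrite -exprM mulnC exprM xn expr1n.
have [s mE'] := (Z2_unitE m).1 mU.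
have [e [wE|wE]] := Z2_odd_or_even w.
  have : val_ge v (x ^+ 2 - 1) 1.
    rewrite xx (_ : _ - 1 = (2%:R * e)%:F *: x - ((2%:R * (1 + s))%:F)%:A).
      exact: (val_geB Ddiv vP).
    rewrite wE mE' -addrA -opprD; congr (_ - _).
    by rewrite -[X in _ + X]scale1r -scalerDl -tofrac1 -tofracD; congr (_%:F *: _); ring.
  case/(torsion_cong1 Ddiv vP n0)/(_ (tors 2%N)) => x2.
    by constructor 1.
  by constructor 2.
have : val_ge v (x ^+ 3 - 1) 1.
  (* From x^3 = (t^2 - n) x - t n with t = 1 + 2e and n = 1 + 2s. *)
  have -> : x ^+ 3 - 1 = (2%:R * (2%:R * (e + e ^+ 2) - s))%:F *: x -
       ((2%:R * (1 + s + e + 2%:R * (e * s)))%:F)%:A.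
    rewrite exprS xx mulrBr -scalerAr -expr2 xx -scalerAr mulr1.
    rewrite scalerBr !scalerA -!tofracM [_ - _ - m%:F *: x]addrAC -scalerBl.
    rewrite -tofracB -[X in _ - X = _]scale1r -addrA -opprD -scalerDl -tofrac1 -tofracD.
    by rewrite wE mE'; congr (_%:F *: _ - _%:F *: _); ring.
  exact: (val_geB Ddiv vP).
case/(torsion_cong1 Ddiv vP n0)/(_ (tors 3%N)) => x2.
  by constructor 3.
by constructor 4.
Qed.

Lemma torsion_cases x n : (0 < n)%N -> x ^+ n = 1 ->
  [\/ x = 1 \/ x = - 1, x ^+ 2 = - 1, x ^+ 2 + x + 1 = 0
    | (- x) ^+ 2 + (- x) + 1 = 0].
Proof.
move=> n0 xn; have cube y : y ^+ 3 = 1 -> y = 1 \/ y ^+ 2 + y + 1 = 0.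
  move=> y3; have : (y - 1) * (y ^+ 2 + y + 1) = 0.
    rewrite -[RHS](subrr 1) -[X in _ = X - _]y3 subrX1.
    by rewrite !big_ord_recr big_ord0 /= add0r expr0 expr1 [1 + y + _]addrC [1 + y]addrC addrA.
  by case/(mulD_eq0 Ddiv) => [/subr0_eq|]; [left | right].
have [x2|x2|/cube[x1|x2]|x3] := torsion_pow n0 xn.
- have /(mulD_eq0 Ddiv) : (x - 1) * (x + 1) = 0 by rewrite -subr_sqr_1 x2 subrr.
  case=> [/subr0_eq xE|/eqP]; first by constructor 1; left.
  by rewrite addr_eq0 => /eqP xE; constructor 1; right.
- by constructor 2.
- by constructor 1; left.
- by constructor 3.
- have /cube[xE|] : (- x) ^+ 3 = 1 by rewrite exprNn x3 -signr_odd mulN1r opprK.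
    by constructor 1; right; rewrite -[x]opprK xE.
  by constructor 4.
Qed.

(** Applied to x and to its products with i, j and ij, this turns the doubled coordinates of x into
    integers, and the norm condition into a sum of four squares equal to 4. *)
Lemma torsion_q a b c d n : (0 < n)%N -> q a b c d ^+ n = 1 ->
  qnorm a b c d = 1 /\ exists2 m : int, 2%:R * a = m%:~R & (`|m| <= 2)%N.
Proof.
move=> n0 xn; have [x1|||] := torsion_cases n0 xn.
- case: x1; rewrite -(q1 i j) ?qmkN => /(q_inj frame)[-> -> -> ->].
    split; first by rewrite /qnorm; ring.
    by exists 2; rewrite ?mulr1.
  split; first by rewrite /qnorm; ring.
  by exists (- 2%:Z); rewrite // mulrN mulr1 rmorphN.
- move=> /sqr_eqN1_q[-> ->]; split=> //; exists 0 => //.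
  by rewrite mulr0.
- move=> /cubic_q[-> ->]; by split=> //; exists (- 1%:Z).
- rewrite qmkN => /cubic_q[aE nE]; split; first by rewrite -nE /qnorm; ring.
  by exists 1; rewrite // -[LHS]opprK -mulrN aE opprK.
Qed.

End Torsion.

Lemma Z2_unit_odd_nat k : (2%:R * k%:R + 1 : Z2) \is a GRing.unit.
Proof. by rewrite addrC; apply: Z2_unit_odd. Qed.

(* Units are norms from the unramified quadratic extension: 1, 3, 13 and 7 are
   values of e^2 - e f + f^2 and represent the square classes. *)
Lemma Z2_unit_norm (n : Z2) : n \is a GRing.unit ->
  exists e f, n = e ^+ 2 - e * f + f ^+ 2.
Proof.
have solve (c : Z2) z e f : (2%:R * e - 1) ^+ 2 - (2%:R * e - 1) * f + f ^+ 2 = c ->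
    c \is a GRing.unit -> n = c + 8%:R * z ->
    exists e f, n = e ^+ 2 - e * f + f ^+ 2.
  move=> cE cU /(Z2_square_class cU)[r ->].
  by exists ((2%:R * e - 1) * r), (f * r); rewrite -cE; ring.
case/Z2_unit_mod8=> z [] nE.
- by apply: (solve _ z 1 0 _ _ nE); [ring | apply: unitr1].
- apply: (solve _ z 1 2%:R _ _ nE); [ring |].
  by have := Z2_unit_odd_nat 1; congr (_ \is a _); ring.
- apply: (solve 13%:R (z - 1) 1 4%:R); [ring | | by rewrite nE; ring].
  by have := Z2_unit_odd_nat 6; congr (_ \is a _); ring.
- apply: (solve _ z 1 3%:R _ _ nE); [ring |].
  by have := Z2_unit_odd_nat 3; congr (_ \is a _); ring.
Qed.

(** * Hamilton presentation of the algebra of invariant 1/2 *)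

Section UnramifiedSubfield.

Variables (D : falgType Q2) (v : D -> rat) (W : {aspace D}).
Hypotheses (Ddiv : is_division_algebra D) (vP : extends_Q2_val v).
Hypotheses (Wunr : unramified_subfield v W) (dimW : \dim W = 2).

Let W1 : 1 \in W. Proof. by case: Wunr. Qed.
Let WC : {in W &, forall x y, x * y = y * x}. Proof. by case: Wunr. Qed.
Let Wint : {in W, forall x, x != 0 -> exists k : int, v x = k%:~R}.
Proof. by case: Wunr. Qed.

Let Wconst a : a%:A \in W. Proof. by rewrite memvZ. Qed.

Lemma unramified_gen w : w \in W -> (forall a, w <> a%:A) ->
  {in W, forall x, exists a b, x = a%:A + b *: w}.
Proof.
move=> wW wnc x xW; suff : x \in (<[1]> + <[w]>)%VS.
  by case/memv_addP=> _ /vlineP[a ->] [_ /vlineP[b ->] ->]; exists a, b.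
suff /eqP-> : (<[1]> + <[w]>)%VS == W :> {vspace D} by [].
rewrite eqEdim subv_add -!memvE W1 wW dimW /=.
have sub1 : (<[1]> <= <[1]> + <[w]>)%VS := addvSl _ _.
have := dimv_leqif_sup sub1; rewrite dim_vline oner_neq0 => /ltn_leqif ->.
apply/negP => /subvP/(_ w)/(_ (subvP (addvSr _ _) _ (memv_line w))).
by case/vlineP => a /wnc.
Qed.

Lemma val_ge_int x : x \in W -> val_ge v x 0 -> val_ge v x 1 \/ (x != 0 /\ v x = 0).
Proof.
move=> xW; rewrite /val_ge; have [|x0 /=] := eqVneq x 0; first by left.
have [k ->] := Wint xW x0; rewrite ler0z -[1]/(1%:~R) ler_int; case: k => [[|k]|k] //.
  by right.
by left.
Qed.

(** Completing a square in W and scaling by a power of 2 gives s with s^2 = m a unit. If m is 3 or 7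
    mod 8, then (s + 1)(s - 1) = m - 1 has valuation 1, but the factors differ by 2 and have
    integral valuations, so they are both units or both divisible by 2. If m is 1 mod 8, it is a
    square and s would be scalar. So m is 5 mod 8, that is -3 times a square. *)
Lemma unramified_sqrtN3 : exists2 s, s \in W & s * s = (- 3%:R)%:A /\ forall a, s <> a%:A.
Proof.
have [w wW wnc] : exists2 w, w \in W & forall a, w <> a%:A.
  have /subvPn[w wW wn1] : ~~ (W <= <[1 : D]>)%VS.
    by apply/negP => /dimvS; rewrite dimW dim_vline oner_neq0.
  by exists w => // a wa; case/vlineP: wn1; exists a.
have [a [b wwE]] := unramified_gen wW wnc (memvM wW wW).
have [d [s [sW snc ssE]]] : exists d s,
    [/\ s \in W, (forall a, s <> a%:A) & s * s = d%:A].
  pose e := b / 2%:R; have bE : b = e + e.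
    by rewrite /e -mulrDl -mulr2n -[b *+ 2]mulr_natr mulfK // Q2_two_neq0.
  exists (a + e * e), (w - e%:A); split; first by rewrite memvB.
    by move=> c /eqP; rewrite subr_eq -scalerDl => /eqP; apply: wnc.
  rewrite mulrBl !mulrBr wwE bE -!scalerAl -!scalerAr !mul1r !mulr1 scalerA.
  rewrite [(e + e) *: w]scalerDl !scalerDl.
  by rewrite opprB !addrA addrK [LHS]addrAC addrK.
have s0 : s != 0 by apply/eqP => sE; apply: (snc 0); rewrite sE scale0r.
have [k vs] := Wint sW s0.
have two0 (m : int) : 2%:R ^ m != 0 :> Q2 by rewrite expfz_neq0 // Q2_two_neq0.
have v2 (m : int) : v (2%:R ^ m)%:A = m%:~R.
  by apply: (val_scalar vP); exists 1; rewrite ?unitr1 // rmorph1 mulr1.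
pose s1 := 2%:R ^ (- k) *: s; pose d1 := 2%:R ^ (- k) * 2%:R ^ (- k) * d.
have s1W : s1 \in W by rewrite memvZ.
have s1nc c : s1 <> c%:A.
  move=> E; apply: (snc ((2%:R ^ (- k))^-1 * c)).
  by rewrite -scalerA -E scalerA mulVf ?two0 // scale1r.
have s10 : s1 != 0 by apply/eqP => sE; apply: (s1nc 0); rewrite sE scale0r.
have ss1 : s1 * s1 = d1%:A.
  by rewrite /s1 -scalerAl -scalerAr ssE !scalerA /d1 ?mulrA.
have vs1 : v s1 = 0.
  rewrite /s1 -mulr_algl (valuM vP) ?v2 ?vs ?rmorphN ?addNr //.
  by rewrite scalar_neq0 ?two0.
have d10 : d1 != 0.
  by apply: contraTneq (mulD_neq0 Ddiv s10 s10) => dE; rewrite ss1 dE scale0r eqxx.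
have vd1 : v d1%:A = 0 by rewrite -ss1 (valuM vP) // vs1 addr0.
clearbody s1 d1.
have [m mU dm] := val_eq0_scalar vP d10 vd1.
have sq (c r : Z2) : m = c * r ^+ 2 -> m = c * r ^+ 2 /\ r%:F != 0.
  move=> mE; split; first exact: mE.
  rewrite tofrac_eq0; apply: contraTneq mU => r0.
  by rewrite mE r0 expr0n mulr0 unitr0.
have prod : (s1 + 1) * (s1 - 1) = ((m - 1)%:F)%:A.
  rewrite mulrDl mul1r mulrBr mulr1 ss1 dm addrA subrK.
  by rewrite tofracB scalerBl tofrac1 scale1r.
have half (e : Z2) : e \is a GRing.unit -> m = 1 + 2%:R * e -> False.
  move=> eU mE.
  have P0 : (s1 + 1) * (s1 - 1) != 0.
    have e0 : e != 0 by apply: contraTneq eU => ->; rewrite unitr0.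
    rewrite prod mE addrC addKr; apply: scalar_neq0.
    by rewrite tofrac_eq0 mulf_neq0 ?Z2_two_neq0.
  have vP1 : v ((s1 + 1) * (s1 - 1)) = 1.
    rewrite prod mE addrC addKr (@val_scalar _ _ vP _ 1) //; exists e => //.
    by rewrite expr1z tofracM rmorph_nat.
  have sp0 : s1 + 1 != 0 by apply: contraNneq P0 => ->; rewrite mul0r.
  have sm0 : s1 - 1 != 0 by apply: contraNneq P0 => ->; rewrite mulr0.
  move: vP1; rewrite (valuM vP) // => vsum.
  have v1 : val_ge v 1 0 by rewrite /val_ge (valu1 vP) lexx orbT.
  have v2' : val_ge v 2%:R 1 by rewrite /val_ge val_two_nat // lexx orbT.
  have vs1' : val_ge v s1 0 by rewrite /val_ge vs1 lexx orbT.
  have ge1P x : x != 0 -> val_ge v x 1 = (1 <= v x).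
    by rewrite /val_ge => /negPf->.
  have E2 : s1 + 1 = (s1 - 1) + 2%:R by rewrite (natrD _ 1 1) addrA subrK.
  have E2' : s1 - 1 = (s1 + 1) - 2%:R by rewrite E2 addrK.
  have both : 1 <= v (s1 + 1) \/ 1 <= v (s1 - 1) ->
      1 <= v (s1 + 1) /\ 1 <= v (s1 - 1).
    rewrite -!ge1P // => -[h|h]; split=> //.
      by rewrite E2' (val_geB Ddiv vP).
    by rewrite E2 (val_geD vP).
  have [|[_ vp]] := val_ge_int (memvD s1W W1) (val_geD vP vs1' v1).
    by rewrite ge1P // => /or_introl/both[]; lra.
  have [|[_ vm]] := val_ge_int (memvB s1W W1) (val_geB Ddiv vP vs1' v1).
    by rewrite ge1P // => /or_intror/both[]; lra.
  by move: vsum; rewrite vp vm.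
have [z [mE|mE|mE|mE]] := Z2_unit_mod8 mU.
- have [r /sq[mr r0]] := Z2_square_class (unitr1 _) mE.
  have : (s1 - (r%:F)%:A) * (s1 + (r%:F)%:A) = 0.
    rewrite mulrBl !mulrDr ss1 dm mr mul1r !mulr_algl mulr_algr scalerA.
    by rewrite -tofracM -expr2 [X in _ - X]addrC subrr.
  case/(mulD_eq0 Ddiv) => [/subr0_eq/s1nc //|/eqP].
  by rewrite addr_eq0 -scaleNr => /eqP/s1nc.
- by case: (half (1 + 2%:R * (2%:R * z)) (Z2_unit_odd _)); rewrite mE; ring.
- have cU : (- 3%:R : Z2) \is a GRing.unit.
    by rewrite unitrN; have := Z2_unit_odd_nat 1; congr (_ \is a _); ring.
  have [|r /sq[mr r0]] := @Z2_square_class m (- 3%:R) (z + 1) cU.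
    by rewrite mE; ring.
  exists ((r%:F)^-1 *: s1); first by rewrite memvZ.
  split.
    rewrite -scalerAl -scalerAr ss1 dm mr !scalerA tofracM tofracXn.
    rewrite tofracN rmorph_nat; move: (r%:F) r0 => R R0; congr (_ *: _).
    rewrite -invfM mulrC expr2 mulfK; first by [].
    exact: mulf_neq0.
  move=> c E; apply: (s1nc (r%:F * c)).
  by rewrite -scalerA -E scalerA divff // scale1r.
- case: (half (1 + 2%:R * (1 + 2%:R * z)) (Z2_unit_odd _)); rewrite mE; ring.
Qed.

End UnramifiedSubfield.

(** Completes the square, e^2 - e f + f^2 = (e - f/2)^2 + 3 (f/2)^2, to pass from [Z2_unit_norm] to
    the norm form a^2 + 3 b^2 of Q_2(sqrt -3); t stands for a power of 2. *)
Lemma norm_rescale (F : fieldType) (t w e f : F) : 2%:R != 0 :> F ->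
    t != 0 -> w != 0 -> - w^-1 = e ^+ 2 - e * f + f ^+ 2 ->
  2%:R * t ^+ 2 * w *
    (((e - f / 2%:R) / t) ^+ 2 + 3%:R * (f / 2%:R / t) ^+ 2) = - 2%:R.
Proof.
move=> two0 t0 w0 nE.
transitivity (2%:R * w * (e ^+ 2 - e * f + f ^+ 2)).
  by field; rewrite two0 t0.
by rewrite -nE; field.
Qed.

Lemma expfz_double1 (F : fieldType) (x : F) (k : int) :
  x != 0 -> x ^ (2 * k + 1) = x * (x ^ k) ^+ 2.
Proof.
move=> x0; rewrite exprnP exprz_exp -{2}[x]expr1z -expfzDr //.
by congr (_ ^ _); lia.
Qed.

(* With Pi = a g + b s g one has Pi^2 = -2 and Pi s = - s Pi; then
   ij = (s - s Pi) / 3, i = (s - ij + Pi) / 2 and j = i - Pi. *)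
Lemma hamilton_of_symbol (F : fieldType) (D : algType F) (s g : D) (a b c : F) :
    2%:R != 0 :> F -> 3%:R != 0 :> F ->
    s * s = (- 3%:R)%:A -> g * g = c%:A -> g * s = - (s * g) ->
    c * (a ^+ 2 + 3%:R * b ^+ 2) = - 2%:R ->
  exists i j, [/\ i * i = (- 1)%:A, j * j = (- 1)%:A, j * i = - (i * j)
      & s = i + j + i * j] /\
    forall x, (exists x1 x2 x3 x4, x = qmk s g x1 x2 x3 x4) ->
              exists x1 x2 x3 x4, x = qmk i j x1 x2 x3 x4.
Proof.
move=> two0 three0 ss gg gs; set n := a ^+ 2 + _ => cn.
have n0 : n != 0.
  have : c * n != 0 by rewrite cn oppr_eq0.
  by rewrite mulf_eq0 negb_or => /andP[].
have cE : c = - 2%:R / n by rewrite -cn mulfK.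
have sgM := qmkM ss gg gs.
pose q := qmk s g.
pose i := q 0 (3%:R^-1) ((a - b) / 2%:R) ((b + a / 3%:R) / 2%:R).
pose j := q 0 (3%:R^-1) (- (a + b) / 2%:R) ((a / 3%:R - b) / 2%:R).
have ijE : i * j = q 0 (3%:R^-1) b (- a / 3%:R).
  rewrite /i /j /q sgM cE; congr qmk; rewrite /n; field;
    rewrite ?two0 ?three0 ?n0 //.
exists i, j; split; first split.
- rewrite /i /q sgM (qmk_const s g) cE; congr qmk; rewrite /n; field;
    rewrite ?two0 ?three0 ?n0 //.
- rewrite /j /q sgM (qmk_const s g) cE; congr qmk; rewrite /n; field;
    rewrite ?two0 ?three0 ?n0 //.
- rewrite ijE /i /j /q sgM (qmkN s g) cE; congr qmk; rewrite /n; field;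
    rewrite ?two0 ?three0 ?n0 //.
- by rewrite ijE {1}(qmk_i s g) /i /j /q !qmkD; congr qmk; field; rewrite ?two0 ?three0.
move=> _ [x1 [x2 [x3 [x4 ->]]]].
(* These are the coordinates of s, g and s g in the new basis: as Pi = (a + b s) g = i - j, one has
   g = (a - b s) Pi / n. *)
exists x1, (x2 + x3 / n * (a - b) + x4 / n * (3%:R * b + a)),
  (x2 + x3 / n * (- a - b) + x4 / n * (a - 3%:R * b)),
  (x2 + x3 / n * (2%:R * b) + x4 / n * (- 2%:R * a)).
rewrite {2}/qmk ijE /i /j /q (qmk1 s g) !qmkZ !qmkD.
congr qmk; rewrite /n; field;
    rewrite ?two0 ?three0 ?n0 //.
Qed.

Lemma half_not_int (k : int) : k%:~R <> 2%:R^-1 :> rat.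
Proof.
move=> kE; have : (2 * k)%:~R = 1%:~R :> rat by rewrite intrM kE; field.
by move/intr_inj; lia.
Qed.

Section HamiltonPresentation.

Variables (D : falgType Q2) (v : D -> rat) (W : {aspace D}) (g : D).
Hypotheses (Ddiv : is_division_algebra D) (vP : extends_Q2_val v).
Hypotheses (Wunr : unramified_subfield v W) (dimW : \dim W = 2).
Hypotheses (g0 : g != 0) (frob : conj_is_frobenius v W g).
Variable s : D.
Hypotheses (sW : s \in W) (ss : s * s = (- 3%:R)%:A) (snc : forall a, s <> a%:A).

Let WC : {in W &, forall x y, x * y = y * x}. Proof. by case: Wunr. Qed.
Let W1 : 1 \in W. Proof. by case: Wunr. Qed.
Let s0 : s != 0.
Proof. by apply/eqP => sE; apply: (snc (a := 0)); rewrite sE scale0r. Qed.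

Let unit3 : (- 3%:R : Z2) \is a GRing.unit.
Proof. by rewrite unitrN; have := Z2_unit_odd_nat 1; congr (_ \is a _); ring. Qed.

Let vs : v s = 0.
Proof.
have : v (s * s) = 0.
  by rewrite ss -(rmorph_nat (@tofrac Z2)) -rmorphN; apply: (val_unit vP).
by rewrite (valuM vP) //; lra.
Qed.

Let lin a b : D := a%:A + b *: s.

Let linD a b c d : lin a b + lin c d = lin (a + c) (b + d).
Proof. by rewrite /lin !scalerDl addrACA. Qed.

Let linN a b : - lin a b = lin (- a) (- b).
Proof. by rewrite /lin !scaleNr opprD. Qed.

Let linM a b c d : lin a b * lin c d = lin (a * c - 3%:R * (b * d)) (a * d + b * c).
Proof.
rewrite /lin mulrDl !mulrDr !mulr_algl -!scalerAl mulr_algr -!scalerAr ss.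
rewrite !scalerA [X in _ + X = _]addrC addrACA -!scalerDl.
by congr (_ *: _ + _); ring.
Qed.

Let lin1 : 1 = lin 1 0. Proof. by rewrite /lin scale0r addr0 scale1r. Qed.

(** The conjugate of s by g is a root of x^2 + 3 in W, hence s or -s. If it were s, conjugation
    would fix om = (s - 1)/2, and the Frobenius condition would give positive valuation to om - om^2
    = s, which is a unit. *)
Lemma frobenius_sqrtN3 : g * s = - (s * g).
Proof.
have gU := Ddiv g0.
pose om := (2%:R)^-1 *: (s - 1).
have omW : om \in W by rewrite memvZ // memvB.
have [gomW frob_om] := frob omW.
have sE : s = 2%:R *: om + 1.
  by rewrite /om scalerA divff ?Q2_two_neq0 // scale1r subrK.
pose s' := g * s * g^-1.
have s'E : s' = 2%:R *: (g * om * g^-1) + 1.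
  by rewrite /s' {1}sE mulrDr mulrDl mulr1 mulrV // -scalerAr -scalerAl.
have s'W : s' \in W by rewrite s'E memvD // memvZ.
have ss' : s' * s' = (- 3%:R)%:A.
  rewrite /s' !mulrA mulrVK // -(mulrA g s s) ss.
  by rewrite mulr_algr -scalerAl mulrV.
have : (s' - s) * (s' + s) = 0.
  by rewrite mulrBl !mulrDr ss' ss (WC s'W sW) [X in _ - X]addrC subrr.
case/(mulD_eq0 Ddiv) => /eqP; last first.
  rewrite addr_eq0 => /eqP /(congr1 (fun x => x * g)).
  by rewrite /s' mulrVK // mulNr.
rewrite subr_eq0 => /eqP s's.
have gom : g * om * g^-1 = om.
  by rewrite /om -scalerAr -scalerAl mulrBr mulrBl mulr1 mulrV // -/s' s's.
have om2 : om ^+ 2 = - 1 - om.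
  have omE : om = lin (- (2%:R)^-1) (2%:R)^-1.
    by rewrite /om /lin scalerBr addrC scaleNr.
  rewrite expr2 omE linM lin1 !linN linD.
  by congr lin; field; rewrite Q2_two_neq0.
have omm : om - om ^+ 2 = s.
  by rewrite om2 opprD !opprK addrCA addrC -mulr2n -scaler_nat -sE.
have om_ge0 : val_ge0 v om.
  move=> om0; suff -> : v om = 0 by [].
  apply: (@val_torsion _ _ Ddiv vP om 3) => //.
  by rewrite exprS om2 mulrDr mulrN1 mulrN -expr2 om2 opprD !opprK addrCA addNr addr0.
have := frob_om om_ge0; rewrite gom omm => /(_ s0).
by rewrite vs ltxx.
Qed.

Hypothesis dimD : \dim {:D} = 4.
Hypothesis vg : exists k : int, v g = 2%:R^-1 + k%:~R.

Let sP : forall x, x \in W -> exists a b, x = lin a b.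
Proof. by move=> x xW; have := unramified_gen Wunr dimW sW snc xW. Qed.

(** Nonzero elements of W have integral valuation and those of W g half-integral valuation, so the
    sum W + W g is direct and fills dimension 4. *)
Let WWg x : exists a b c d, x = lin a b + lin c d * g.
Proof.
have gU := Ddiv g0.
suff : x \in (W + amulr g @: W)%VS.
  case/memv_addP=> w /sP[a [b ->]] [_ /memv_imgP[w' /sP[c [d ->]] ->] ->].
  by exists a, b, c, d; rewrite lfunE.
suff /eqP-> : (W + amulr g @: W)%VS == fullv by apply: memvf.
rewrite eqEdim subvf /=.
rewrite dimv_disjoint_sum ?limg_dim_eq ?dimW ?dimD //.
  apply/eqP; rewrite -subv0; apply/subvP => y; rewrite memv_cap memv0 memv_ker.
  rewrite lfunE /= => /andP[_ /eqP/(mulD_eq0 Ddiv)[/eqP //|/eqP]].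
  by rewrite (negPf g0).
apply/eqP; rewrite -subv0; apply/subvP => y; rewrite memv_cap memv0.
case/andP=> yW /memv_imgP[w wW]; rewrite lfunE /= => yE; apply/negPn/negP => y0.
have w0 : w != 0 by apply: contraNneq y0 => w0; rewrite yE w0 mul0r.
have [_ _ Wint] := Wunr; have [k1 v1] := Wint _ yW y0.
have [k2 v2] := Wint _ wW w0; have [k3 v3] := vg.
apply: (@half_not_int (k1 - k2 - k3)); rewrite !rmorphB /= -v1 yE (valuM vP) //.
by rewrite v2 v3; lra.
Qed.

Let ggs : g * g * s = s * (g * g).
Proof.
have gs := frobenius_sqrtN3.
by rewrite -[LHS]mulrA gs mulrN [g * (s * g)]mulrA gs mulNr opprK mulrA.
Qed.

Hypothesis centerD : ('Z({:D}) = 1)%VS.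

Lemma sqr_uniformizer : exists2 c, c != 0 & g * g = c%:A.
Proof.
have : g * g \in 'Z({:D})%VS.
  rewrite memv_cap memvf /=; apply/centvP => x _.
  have [a [b [c [d ->]]]] := WWg x.
  have com e f : g * g * lin e f = lin e f * (g * g).
    by rewrite /lin mulrDr mulrDl -!scalerAr -!scalerAl mulr1 mul1r ggs.
  by rewrite mulrDr [RHS]mulrDl com; congr (_ + _); rewrite mulrA com -!mulrA.
rewrite centerD => /vlineP[c gg]; exists c => //.
by apply: contraTneq (mulD_neq0 Ddiv g0 g0) => c0; rewrite gg c0 scale0r eqxx.
Qed.

(** D is the symbol algebra of -3 and c = g^2, where c = 2^(2k+1) w has odd valuation because v(g)
    is in 1/2 + Z. The unit -1/w is a norm from Q_2(sqrt -3), so g can be changed to a uniformizer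
    of square -2, as in the Hamilton quaternions. *)
Lemma exists_hamilton_frame : exists i j, hamilton_frame v i j.
Proof.
have [c c0 gg] := sqr_uniformizer.
have gs : g * s = - (s * g) := frobenius_sqrtN3.
have [k vgE] := vg.
have [l [w wU cE]] := Q2_factor c0.
have lE : l = 2 * k + 1.
  have := val_scalar vP (ex_intro2 _ _ w wU cE).
  rewrite -gg (valuM vP) // vgE => E; apply: (@intr_inj rat).
  by rewrite -E rmorphD rmorphM /=; field.
have [e [f nE]] : exists e f, - w^-1 = e ^+ 2 - e * f + f ^+ 2.
  by apply: Z2_unit_norm; rewrite unitrN unitrV.
have two0 := Q2_two_neq0.
have three0 : 3%:R != 0 :> Q2.
  rewrite -(rmorph_nat (@tofrac Z2)) tofrac_eq0 -oppr_eq0.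
  by apply: contraTneq unit3 => ->; rewrite unitr0.
have w0 : w%:F != 0 :> Q2.
  by rewrite tofrac_eq0; apply: contraTneq wU => ->; rewrite unitr0.
have t0 : 2%:R ^ k != 0 :> Q2 by apply: expfz_neq0; exact: two0.
have [a [b abE]] : exists a b, c * (a ^+ 2 + 3%:R * b ^+ 2) = - 2%:R.
  exists ((e%:F - f%:F / 2%:R) / 2%:R ^ k), ((f%:F / 2%:R) / 2%:R ^ k).
  have {nE} nE : - (w%:F)^-1 = e%:F ^+ 2 - e%:F * f%:F + f%:F ^+ 2 :> Q2.
    by rewrite -rmorphV // -tofracN nE tofracD tofracB [(e * f)%:F]tofracM !tofracXn.
  have -> : c = 2%:R * (2%:R ^ k) ^+ 2 * w%:F.
    by rewrite cE lE (expfz_double1 _ two0).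
  exact: (norm_rescale two0 t0 w0 nE).
have [i [j [[ii jj ji ijs] ijP]]] := hamilton_of_symbol two0 three0 ss gg gs abE.
exists i, j; split=> //.
- by rewrite !scaleN1r in ii jj.
- move=> x; have [x1 [x2 [x3 [x4 ->]]]] := WWg x; apply: ijP.
  exists x1, x2, x3, x4.
  by rewrite /lin /qmk mulrDl -!scalerAl mul1r addrA.
move=> x y; rewrite /qmk -!addrA -!scalerDr !addrA -ijs => xy0.
have [_ _ Wint] := Wunr; apply: Wint xy0.
by rewrite memvD // memvZ.
Qed.

End HamiltonPresentation.

Lemma is_DD_hamilton (D : falgType Q2) : is_DD D 2 ->
  exists v i j, @hamilton_frame D v i j.
Proof.
move=> [Ddiv cD dimD [v [W [g [vP [Wunr dimW] [g0 frob] vg]]]]].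
have [s sW [ss snc]] := unramified_sqrtN3 Ddiv vP Wunr dimW.
exists v.
exact: (exists_hamilton_frame Ddiv vP Wunr dimW g0 frob sW ss snc dimD vg cD).
Qed.

Lemma Z2_natr_eq0 (n : nat) : (n%:R : Z2) = 0 -> n = 0%N.
Proof.
move=> n0; have : n%:R = 0 :> 'Z_(2 ^ n.+1).
  have lev m : Z2_seq m%:R n = m%:R.
    by elim: m => [//|m IH]; rewrite -!natr1 Z2_levelD IH.
  by rewrite -lev n0.
move/(congr1 (@nat_of_ord _)); rewrite val_Zp_nat ?modn_small //.
  by rewrite (ltn_trans (ltn_expl n (ltnSn 1))) // ltn_exp2l.
by rewrite -{1}(expn0 2) ltn_exp2l.
Qed.

Lemma Q2_intr_inj : injective (intr : int -> Q2).
Proof.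
have nat0 (n : nat) : (n%:R : Q2) = 0 -> n = 0%N.
  move=> /eqP; rewrite -(rmorph_nat (@tofrac Z2)) tofrac_eq0 => /eqP.
  exact: Z2_natr_eq0.
have int0 (m : int) : (m%:~R : Q2) = 0 -> m = 0.
  case: m => n; first by move/nat0 => ->.
  by rewrite NegzE rmorphN /= => /eqP; rewrite oppr_eq0 => /eqP /nat0.
by move=> m n mn; apply: subr0_eq; apply: int0; rewrite rmorphB /= mn subrr.
Qed.

Lemma four_squares (a b c d : int) :
    a ^+ 2 + b ^+ 2 + c ^+ 2 + d ^+ 2 = 4 ->
  [/\ a ^+ 2 = 1, b ^+ 2 = 1, c ^+ 2 = 1 & d ^+ 2 = 1] \/
  [\/ [/\ a ^+ 2 = 4, b = 0, c = 0 & d = 0], [/\ a = 0, b ^+ 2 = 4, c = 0 & d = 0],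
      [/\ a = 0, b = 0, c ^+ 2 = 4 & d = 0] | [/\ a = 0, b = 0, c = 0 & d ^+ 2 = 4]].
Proof.
have sq (x : int) : x ^+ 2 <= 4 ->
    [\/ x = 0 /\ x ^+ 2 = 0, x ^+ 2 = 1 | x ^+ 2 = 4].
  move=> x4; have : x = - 2 \/ x = - 1 \/ x = 0 \/ x = 1 \/ x = 2 by nia.
  by move=> [|[|[|[|]]]] ->; [constructor 3 | constructor 2 | constructor 1
    | constructor 2 | constructor 3].
have ge0 (x : int) : 0 <= x ^+ 2 by apply: sqr_ge0.
move=> E; have := (ge0 a, ge0 b, ge0 c, ge0 d) => -[[[a0 b0] c0] d0].
have [a4 b4 c4 d4] : [/\ a ^+ 2 <= 4, b ^+ 2 <= 4, c ^+ 2 <= 4 & d ^+ 2 <= 4].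
  by split; lia.
case: (sq a a4) => [[aE a2]|a2|a2]; case: (sq b b4) => [[bE b2]|b2|b2];
  case: (sq c c4) => [[cE c2]|c2|c2]; case: (sq d d4) => [[dE d2]|d2|d2];
  move: E; rewrite a2 b2 c2 d2 => // _.
all: by [left | right; constructor 1 | right; constructor 2
        | right; constructor 3 | right; constructor 4].
Qed.

(** * Hurwitz units *)

Section Hurwitz.

Variables (D : falgType Q2) (v : D -> rat) (i j : D).
Hypothesis frame : hamilton_frame v i j.

Let Ddiv : is_division_algebra D. Proof. by case: frame => -[]. Qed.
Let vP : extends_Q2_val v. Proof. by case: frame => -[]. Qed.

Local Notation q := (qmk i j).
Implicit Types (x y z : D) (a b c d m n : int).

(** The doubled coordinates are kept as integers, so that membership in [T24] is an equation over
    [int]. *)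
Definition hurw (a b c d : int) : D :=
  q (a%:~R / 2%:R) (b%:~R / 2%:R) (c%:~R / 2%:R) (d%:~R / 2%:R).

(* The 24 units of the Hurwitz order. *)
Definition T24 x := exists a b c d,
  a ^+ 2 + b ^+ 2 + c ^+ 2 + d ^+ 2 = 4 /\ x = hurw a b c d.

Lemma intr2_half (m : int) : (2 * m)%:~R / 2%:R = m%:~R :> Q2.
Proof. by rewrite intrM mulrC mulKf //; exact: Q2_two_neq0. Qed.

Lemma hurwM a b c d a' b' c' d' m1 m2 m3 m4 :
  a * a' - b * b' - c * c' - d * d' = 2 * m1 ->
  a * b' + b * a' + c * d' - d * c' = 2 * m2 ->
  a * c' + c * a' - b * d' + d * b' = 2 * m3 ->
  a * d' + d * a' + b * c' - c * b' = 2 * m4 ->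
  hurw a b c d * hurw a' b' c' d' = hurw m1 m2 m3 m4.
Proof.
move=> E1 E2 E3 E4; rewrite /hurw (qM frame).
have key k l : k = 2 * l -> k%:~R / 2%:R / 2%:R = l%:~R / 2%:R :> Q2.
  by move=> ->; rewrite intr2_half.
by congr qmk; rewrite -?(key _ _ E1) -?(key _ _ E2) -?(key _ _ E3) -?(key _ _ E4);
  move: (2%:R)^-1 => h; ring.
Qed.

Lemma T24M x y : T24 x -> T24 y -> T24 (x * y).
Proof.
(* The entries of a solution all have the same parity, which makes the coordinates of the product of
   two solutions even. *)
have par (a b c d : int) : a ^+ 2 + b ^+ 2 + c ^+ 2 + d ^+ 2 = 4 ->
    exists b' c' d', [/\ b = a + 2 * b', c = a + 2 * c' & d = a + 2 * d'].
  have sq1 (z : int) : z ^+ 2 = 1 -> z = 1 + 2 * ((z - 1) %/ 2)%Z by nia.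
  have sq4 (z : int) : z ^+ 2 = 4 -> z = 2 * (z %/ 2)%Z by nia.
  case/four_squares=> [[/sq1 A /sq1 B /sq1 C /sq1 E]|].
    by exists ((b - a) %/ 2)%Z, ((c - a) %/ 2)%Z, ((d - a) %/ 2)%Z; split; lia.
  move=> H; exists ((b - a) %/ 2)%Z, ((c - a) %/ 2)%Z, ((d - a) %/ 2)%Z.
  by case: H => -[] => [/sq4 A B C E|A /sq4 B C E|A B /sq4 C E|A B C /sq4 E];
    split; lia.
move=> [a [b [c [d [n ->]]]]] [a' [b' [c' [d' [n' ->]]]]].
have [b1 [c1 [d1 [bE cE dE]]]] := par _ _ _ _ n.
have [b1' [c1' [d1' [bE' cE' dE']]]] := par _ _ _ _ n'.
pose m1 := - (a * a' + a * b1' + b1 * a' + 2 * b1 * b1' + a * c1' + c1 * a' +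
              2 * c1 * c1' + a * d1' + d1 * a' + 2 * d1 * d1').
pose m2 := a * a' + a * b1' + b1 * a' + a * d1' + c1 * a' + 2 * c1 * d1'
           - a * c1' - d1 * a' - 2 * d1 * c1'.
pose m3 := a * a' + a * c1' + c1 * a' - a * d1' - b1 * a' - 2 * b1 * d1'
           + a * b1' + d1 * a' + 2 * d1 * b1'.
pose m4 := a * a' + a * d1' + d1 * a' + a * c1' + b1 * a' + 2 * b1 * c1'
           - a * b1' - c1 * a' - 2 * c1 * b1'.
have H1 : a * a' - b * b' - c * c' - d * d' = 2 * m1.
  by rewrite bE cE dE bE' cE' dE' /m1; ring.
have H2 : a * b' + b * a' + c * d' - d * c' = 2 * m2.
  by rewrite bE cE dE bE' cE' dE' /m2; ring.
have H3 : a * c' + c * a' - b * d' + d * b' = 2 * m3.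
  by rewrite bE cE dE bE' cE' dE' /m3; ring.
have H4 : a * d' + d * a' + b * c' - c * b' = 2 * m4.
  by rewrite bE cE dE bE' cE' dE' /m4; ring.
exists m1, m2, m3, m4; split; last exact: hurwM.
(* Euler's four-square identity, for the product with halved coordinates. *)
have : 4 * (m1 ^+ 2 + m2 ^+ 2 + m3 ^+ 2 + m4 ^+ 2) =
    (a ^+ 2 + b ^+ 2 + c ^+ 2 + d ^+ 2) * (a' ^+ 2 + b' ^+ 2 + c' ^+ 2 + d' ^+ 2).
  transitivity ((2 * m1) ^+ 2 + (2 * m2) ^+ 2 + (2 * m3) ^+ 2 + (2 * m4) ^+ 2).
    by ring.
  by rewrite -H1 -H2 -H3 -H4; ring.
by rewrite n n'; move: (m1 ^+ 2 + _ + _ + _) => S; clear; lia.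
Qed.

Lemma T24_q a b c d : a ^+ 2 + b ^+ 2 + c ^+ 2 + d ^+ 2 = 4 -> T24 (hurw a b c d).
Proof. by move=> n; exists a, b, c, d. Qed.

Lemma hurw2 (e1 e2 e3 e4 : int) :
  hurw (2 * e1) (2 * e2) (2 * e3) (2 * e4) = q e1%:~R e2%:~R e3%:~R e4%:~R.
Proof. by rewrite /hurw !intr2_half. Qed.

Lemma T24_1 : T24 1.
Proof. by exists 2, 0, 0, 0; rewrite (hurw2 1 0 0 0) (q1 i j). Qed.

Lemma T24_i : T24 i.
Proof. by exists 0, 2, 0, 0; rewrite (hurw2 0 1 0 0) -(q_i i j). Qed.

Lemma T24_j : T24 j.
Proof. by exists 0, 0, 2, 0; rewrite (hurw2 0 0 1 0) -(q_j i j). Qed.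

Lemma hurwN a b c d : - hurw a b c d = hurw (- a) (- b) (- c) (- d).
Proof. by rewrite /hurw qmkN !rmorphN /= !mulNr. Qed.

Lemma T24N x : T24 x -> T24 (- x).
Proof.
move=> [a [b [c [d [n ->]]]]]; exists (- a), (- b), (- c), (- d).
by rewrite !sqrrN hurwN.
Qed.

Lemma hurw_norm a b c d : a ^+ 2 + b ^+ 2 + c ^+ 2 + d ^+ 2 = 4 ->
  qnorm (a%:~R / 2%:R) (b%:~R / 2%:R) (c%:~R / 2%:R) (d%:~R / 2%:R) = 1.
Proof.
move=> n; transitivity ((2 * 2)%:~R / 2%:R / 2%:R : Q2).
  by rewrite -[2 * 2]n /qnorm; move: (2%:R)^-1 => h; ring.
by rewrite intr2_half divff //; exact: Q2_two_neq0.
Qed.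

Lemma hurw_neq0 a b c d : a ^+ 2 + b ^+ 2 + c ^+ 2 + d ^+ 2 = 4 ->
  hurw a b c d != 0.
Proof.
move=> /hurw_norm n; apply/eqP => /(q_eq0 frame)[a0 b0 c0 d0].
move: n; rewrite a0 b0 c0 d0 /qnorm expr0n !addr0 => /eqP.
by rewrite eq_sym oner_eq0.
Qed.

Lemma T24_neq0 x : T24 x -> x != 0.
Proof. by case=> [a [b [c [d [n ->]]]]]; apply: hurw_neq0. Qed.

Lemma T24_val x : T24 x -> v x = 0.
Proof.
case=> [a [b [c [d [n ->]]]]].
have := val_qnorm frame (hurw_neq0 n).
rewrite (hurw_norm n) scale1r (valu1 vP) -/(hurw a b c d) => /esym/eqP.
by rewrite mulf_eq0 pnatr_eq0 /= => /eqP.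
Qed.

Lemma hurwV a b c d : a ^+ 2 + b ^+ 2 + c ^+ 2 + d ^+ 2 = 4 ->
  (hurw a b c d)^-1 = hurw a (- b) (- c) (- d).
Proof.
move=> n; have xU := Ddiv (hurw_neq0 n).
apply: (mulrI xU); rewrite mulrV // /hurw !rmorphN /= !mulNr (q_conjM frame).
by rewrite hurw_norm // scale1r.
Qed.

Lemma T24V x : T24 x -> T24 x^-1.
Proof.
case=> [a [b [c [d [n ->]]]]]; rewrite (hurwV n).
by apply: T24_q; rewrite !sqrrN.
Qed.

End Hurwitz.

(** * Subgroups of D^* that are finite modulo 2u *)

Section Classification.

Variables (D : falgType Q2) (v : D -> rat) (i j : D) (U : Q2).
Hypothesis frame : hamilton_frame v i j.
(* [<> 0] rather than [!= 0]: comparing [U != 0] with other disequalities of Q_2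
   sends conversion into the construction of the fraction field. *)
Hypotheses (U0 : U <> 0) (vU : v U%:A = 1).

Let Ddiv : is_division_algebra D. Proof. by case: frame => -[]. Qed.
Let vP : extends_Q2_val v. Proof. by case: frame => -[]. Qed.

Local Notation q := (qmk i j).
Local Notation hurw := (hurw i j).
Local Notation T24 := (T24 i j).
Implicit Types (x y z r : D) (a b c d w : Q2) (m n : int) (P C : D -> Prop).

(* P is the preimage in D^* of a subgroup, containing -1 and consisting of
   torsion elements, of D^* / <U>. *)
Record saturated P := Saturated {
  sat_neq0 : forall x, P x -> x != 0;
  sat_1 : P 1;
  satM : forall x y, P x -> P y -> P (x * y);
  satV : forall x, P x -> P x^-1;
  satN : forall x, P x -> P (- x);
  satU : P U%:A;
  sat_torsion : forall x, P x -> v x = 0 -> exists2 n, (0 < n)%N & x ^+ n = 1 }.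

Definition span C x := exists m y, C y /\ x = (U ^ m) *: y.
(** When r normalizes C and r^2 lies in U C, this is, up to powers of U, the group generated by C
    and r. *)
Definition ext C r x := C x \/ exists y, C y /\ x = y * r.

Lemma span_sub C C' : (forall x, C x -> C' x) -> forall x, span C x -> span C' x.
Proof. by move=> CC' x [m [y [/CC' Cy ->]]]; exists m, y. Qed.

Lemma U_neq0 : U != 0. Proof. exact/eqP. Qed.

Lemma Uz_neq0 m : U ^ m != 0. Proof. exact: expfz_neq0 U_neq0. Qed.

Lemma val_Uz m : v (U ^ m)%:A = m%:~R.
Proof.
have nat (k : nat) : v (U ^ k)%:A = k%:R.
  elim: k => [|k IH]; first by rewrite expr0z scale1r (valu1 vP).
  rewrite exprSz -scalerA -[_%:A]mul1r scalerAl (valuM vP) ?scalar_neq0 ?Uz_neq0 ?U_neq0 //.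
  by rewrite vU IH -natr1 addrC.
case: m => k; first exact: nat.
have := valuM vP (scalar_neq0 D (Uz_neq0 k.+1)) (scalar_neq0 D (Uz_neq0 (Negz k))).
rewrite -scalerAl mul1r scalerA -expfzDr ?nat; last exact/eqP.
have -> : k.+1%:Z + Negz k = 0 by rewrite NegzE subrr.
rewrite expr0z scale1r (valu1 vP) NegzE rmorphN /= => E.
by apply/eqP; rewrite -addr_eq0 addrC -E.
Qed.

Lemma scale_neq0 a x : a != 0 -> x != 0 -> a *: x != 0.
Proof. by move=> a0 x0; rewrite scaler_eq0 negb_or a0. Qed.

Lemma val_UzM m x : x != 0 -> v (U ^ m *: x) = m%:~R + v x.
Proof.
move=> x0; rewrite -mulr_algl (valuM vP) ?scalar_neq0 ?Uz_neq0 //.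
by rewrite val_Uz.
Qed.

(** The reduced norm as a relation, since coordinates are only known to exist; [nrd_inj] makes it
    functional. *)
Definition nrd x a := exists b c d e, x = q b c d e /\ a = qnorm b c d e.

Lemma nrd_inj x a b : nrd x a -> nrd x b -> a = b.
Proof.
by case=> [? [? [? [? [-> ->]]]]] [? [? [? [? [/(q_inj frame)[-> -> -> ->] ->]]]]].
Qed.

Lemma nrdM x y a b : nrd x a -> nrd y b -> nrd (x * y) (a * b).
Proof.
case=> [a1 [a2 [a3 [a4 [-> ->]]]]] [b1 [b2 [b3 [b4 [-> ->]]]]].
rewrite (qM frame); do 4!eexists; split; first by [].
by rewrite /qnorm; ring.
Qed.

Lemma nrdZ c x a : nrd x a -> nrd (c *: x) (c ^+ 2 * a).
Proof.
case=> [a1 [a2 [a3 [a4 [-> ->]]]]].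
rewrite qmkZ; do 4!eexists; split; first by [].
by rewrite /qnorm; ring.
Qed.

Lemma nrd_T24 x : T24 x -> nrd x 1.
Proof.
case=> [a [b [c [d [n ->]]]]]; do 4!eexists; split; first by [].
by rewrite (hurw_norm n).
Qed.

(* [1 + i] normalizes T24, which has index 2 in its normalizer modulo scalars. *)
Definition i1 := 1 + i.

Lemma i1E : i1 = q 1 1 0 0.
Proof. by rewrite /i1 {1}(q_i i j) -(q1 i j) qmkD !addr0 !add0r. Qed.

Lemma hurw_axis (e : int) :
  [/\ hurw 0 (2 * e) 0 0 = q 0 e%:~R 0 0, hurw 0 0 (2 * e) 0 = q 0 0 e%:~R 0
    & hurw 0 0 0 (2 * e) = q 0 0 0 e%:~R].
Proof.
by split; [have := hurw2 i j 0 e 0 0 | have := hurw2 i j 0 0 e 0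
  | have := hurw2 i j 0 0 0 e]; rewrite mulr0.
Qed.

Lemma T24_sqrtN1 x : T24 x -> x ^+ 2 = - 1 ->
  [\/ x = i \/ x = - i, x = j \/ x = - j | x = i * j \/ x = - (i * j)].
Proof.
case=> [a [b [c [d [n xE]]]]]; rewrite {1}xE => /(sqr_eqN1_q frame)[a0 _].
have {a0} a0 : a = 0.
  apply: Q2_intr_inj; move/eqP: a0; rewrite mulf_eq0 invr_eq0.
  by rewrite (negPf Q2_two_neq0) orbF => /eqP.
have sq4 (z : int) : z ^+ 2 = 4 -> z = 2 * 1 \/ z = 2 * (- 1).
  move/eqP; rewrite (_ : 4 = 2 ^+ 2) // eqf_sqr.
  by case/orP=> /eqP ->; [left | right].
rewrite xE {}a0 in n *; case/four_squares: n => [[]//|].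
have iE := q_i i j; have jE := q_j i j; have kE := qmk_ij i j.
case=> -[] // => [_ /sq4 bE -> ->|_ -> /sq4 bE ->|_ -> -> /sq4 bE].
- constructor 1; case: bE => ->; [left | right].
    by have [-> _ _] := hurw_axis 1; rewrite [RHS]iE.
  by have [-> _ _] := hurw_axis (-1); rewrite [in RHS]iE qmkN oppr0.
- constructor 2; case: bE => ->; [left | right].
    by have [_ -> _] := hurw_axis 1; rewrite [RHS]jE.
  by have [_ -> _] := hurw_axis (-1); rewrite [in RHS]jE qmkN oppr0.
- constructor 3; case: bE => ->; [left | right].
    by have [_ _ ->] := hurw_axis 1; rewrite [RHS]kE.
  by have [_ _ ->] := hurw_axis (-1); rewrite [in RHS]kE qmkN oppr0.
Qed.

(** T24 permutes transitively its six square roots of -1. A conjugator to i is written down for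
    each: 1 for i, j for -i, and half-odd units for the other four. *)
Lemma T24_transport x : T24 x -> x ^+ 2 = - 1 ->
  exists2 t, T24 t & t * x = i * t.
Proof.
move=> Tx xx; have iE := q_i i j; have jE := q_j i j; have kE := qmk_ij i j.
have solve (a b c d : int) (y1 y2 y3 y4 : Q2) y : y = q y1 y2 y3 y4 ->
    a ^+ 2 + b ^+ 2 + c ^+ 2 + d ^+ 2 = 4 ->
    hurw a b c d * q y1 y2 y3 y4 = q 0 1 0 0 * hurw a b c d ->
    exists2 t, T24 t & t * y = i * t.
  move=> -> n E; exists (hurw a b c d); first exact: T24_q.
  by rewrite E -iE.
have neg y (y1 y2 y3 y4 : Q2) : y = q y1 y2 y3 y4 ->
    - y = q (- y1) (- y2) (- y3) (- y4) by move=> ->; rewrite qmkN.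
case: (T24_sqrtN1 Tx xx) => -[] ->.
- by apply: (solve 2 0 0 0 _ _ _ _ _ iE) => //; rewrite /hurw !(qM frame); congr qmk; ring.
- by apply: (solve 0 0 2 0 _ _ _ _ _ (neg _ _ _ _ _ iE)) => //;
    rewrite /hurw !(qM frame); congr qmk; ring.
- by apply: (solve 1 1 1 (-1) _ _ _ _ _ jE) => //; rewrite /hurw !(qM frame); congr qmk; ring.
- by apply: (solve 1 1 (-1) 1 _ _ _ _ _ (neg _ _ _ _ _ jE)) => //;
    rewrite /hurw !(qM frame); congr qmk; ring.
- by apply: (solve 1 1 1 1 _ _ _ _ _ kE) => //; rewrite /hurw !(qM frame); congr qmk; ring.
- by apply: (solve 1 1 (-1) (-1) _ _ _ _ _ (neg _ _ _ _ _ kE)) => //;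
    rewrite /hurw !(qM frame); congr qmk; ring.
Qed.

Lemma i2 : i ^+ 2 = - 1.
Proof. by rewrite expr2; case: frame => _ []. Qed.

Lemma j2 : j ^+ 2 = - 1.
Proof. by rewrite expr2; case: frame => _ []. Qed.

Lemma ji_anti : j * i = - (i * j).
Proof. by case: frame => _ []. Qed.

Lemma val_sqrtN1 x : x ^+ 2 = - 1 -> v x = 0.
Proof.
move=> xx; apply: (val_torsion Ddiv vP (n := 4)) => //.
by rewrite (exprM x 2 2) xx sqrrN expr1n.
Qed.

Definition om := hurw (-1) 1 1 1.

Lemma T24_om : T24 om. Proof. exact: T24_q. Qed.

Let om0 : om != 0. Proof. exact: (T24_neq0 frame T24_om). Qed.

Lemma om2E : om ^+ 2 = hurw (-1) (-1) (-1) (-1).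
Proof. by rewrite expr2 (hurwM frame (m1 := -1) (m2 := -1) (m3 := -1) (m4 := -1)). Qed.

Lemma om3 : om ^+ 3 = 1.
Proof.
rewrite exprS om2E (hurwM frame (m1 := 2) (m2 := 0) (m3 := 0) (m4 := 0)) //.
by have := hurw2 i j 1 0 0 0; rewrite !mulr0 mulr1 (q1 i j).
Qed.

Lemma om_cubic : om ^+ 2 + om + 1 = 0.
Proof.
have hD (a b c d a' b' c' d' : int) :
    hurw a b c d + hurw a' b' c' d' = hurw (a + a') (b + b') (c + c') (d + d').
  by rewrite /hurw qmkD -!mulrDl -!rmorphD.
have h1 : 1 = hurw 2 0 0 0.
  by have := hurw2 i j 1 0 0 0; rewrite !mulr0 mulr1 (q1 i j).
by rewrite om2E /om h1 !hD /hurw !mul0r (q0 i j).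
Qed.

Lemma om_neq_om2 : om <> om ^+ 2.
Proof.
move=> E; have : om = 1.
  by apply: (mulIr (Ddiv om0)); rewrite mul1r -expr2 -E.
rewrite /om -(q1 i j) => /(q_inj frame)[_ /eqP].
by rewrite mul1r invr_eq0 (negPf Q2_two_neq0).
Qed.

(** The centralizer of om is Q_2(om), which is unramified by the last clause of [hamilton_frame]. *)
Lemma commute_om_val x : x != 0 -> x * om = om * x ->
  exists k : int, v x = k%:~R.
Proof.
have [a [b [c [d xE]]]] := qP frame x; rewrite xE => x0.
rewrite /om /hurw !(qM frame) => /(q_inj frame)[_ E1 E2 E3].
have dif (e f A B : Q2) : A = B -> A - B = 2%:R * 2%:R^-1 * (e - f) -> e = f.
  move=> ->; rewrite subrr divff ?mul1r; last exact: Q2_two_neq0.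
  by move/esym/subr0_eq.
have cd : c = d by apply: (dif _ _ _ _ E1); ring.
have db : d = b by apply: (dif _ _ _ _ E2); ring.
by move: x0; rewrite cd db; case: frame => _ _ _; apply.
Qed.

Lemma semicommute_om2 x : x * om = om ^+ 2 * x -> x * om ^+ 2 = om * x.
Proof.
move=> xom; rewrite expr2 mulrA xom -mulrA xom mulrA -exprD.
by rewrite (exprD om 3 1) om3 mul1r.
Qed.

(** p = i - j also exchanges om and om^2 and has square -2, hence valuation 1/2; x p^-1 commutes
    with om and has integral valuation. *)
Lemma semicommute_om_val x : x != 0 -> x * om = om ^+ 2 * x ->
  exists k : int, v x = 2%:R^-1 + k%:~R.
Proof.
pose p := q 0 1 (-1) 0.
have pom : p * om = om ^+ 2 * p.
  by rewrite om2E /om /hurw !(qM frame); congr qmk; ring.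
have pp : p * p = - 2%:R.
  rewrite -(scaler_nat 2 (1 : D)) (q_const i j) qmkN (qM frame).
  by congr qmk; ring.
have p0 : p != 0.
  by apply/eqP => /(q_eq0 frame)[_ /eqP]; rewrite oner_eq0.
have vp : v p = 2%:R^-1.
  have : v (p * p) = 1 by rewrite pp (valuN Ddiv vP) (val_two_nat vP).
  by rewrite (valuM vP) //; lra.
move=> x0 xom; have pU := Ddiv p0.
have y0 : x * p^-1 != 0 by rewrite mulD_neq0 ?invD_neq0.
have pVom : p^-1 * om = om ^+ 2 * p^-1.
  apply: (mulrI pU); rewrite mulVKr // mulrA (semicommute_om2 pom).
  by rewrite mulrK.
have [|k vk] := commute_om_val y0.
  by rewrite -mulrA pVom mulrA (semicommute_om2 xom) mulrA.
exists k; rewrite -vk (valuM vP) ?invD_neq0 // (valuV Ddiv vP) // vp; lra.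
Qed.

Definition C6 x := exists y, [\/ y = 1, y = om | y = om ^+ 2] /\ (x = y \/ x = - y).

Lemma C6_T24 x : C6 x -> T24 x.
Proof.
have T1 := T24_1 i j; have To := T24_om.
have To2 : T24 (om ^+ 2) by rewrite expr2; apply: (T24M frame).
by case=> y [yE xE]; have Ty : T24 y;
  [case: yE => -> | case: xE => ->; [|apply: T24N]].
Qed.

(** * Elements of valuation 0 and 1/2 in a saturated group *)

Section Saturated.

Variables (P : D -> Prop) (satP : saturated P).

Let P0 x : P x -> x != 0. Proof. exact: (sat_neq0 satP). Qed.
Let PM x y : P x -> P y -> P (x * y). Proof. exact: (satM satP). Qed.
Let PV x : P x -> P x^-1. Proof. exact: (satV satP). Qed.

Lemma satX x (n : nat) : P x -> P (x ^+ n).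
Proof.
move=> Px; elim: n => [|n IH]; first exact: (sat_1 satP).
by rewrite exprS; apply: PM.
Qed.

Lemma sat_scale m x : P x -> P (U ^ m *: x).
Proof.
move=> Px; rewrite -mulr_algl; apply: PM => //.
have nat (k : nat) : P (U ^ k)%:A.
  elim: k => [|k IH]; first by rewrite expr0z scale1r; apply: (sat_1 satP).
  by rewrite exprSz -scalerA -[_%:A]mul1r scalerAl; apply: PM => //; apply: (satU satP).
case: m => k; first exact: nat.
rewrite -[_%:A]/(in_alg D (U ^+ k.+1)^-1) fmorphV; apply: PV.
exact: nat.
Qed.

Lemma satJ x z : P x -> P z -> P (z * x * z^-1).
Proof. by move=> Px Pz; apply: PM; [apply: PM | apply: PV]. Qed.

Lemma sat_val_scale x m : P x -> 2%:R * v x = (2 * m)%:~R ->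
  P (U ^ (- m) *: x) /\ v (U ^ (- m) *: x) = 0.
Proof.
move=> Px vx; split; first exact: sat_scale.
by rewrite val_UzM ?P0 // rmorphN; move: vx; rewrite rmorphM /=; lra.
Qed.

Lemma Uz_scaleK m x : U ^ m *: (U ^ (- m) *: x) = x.
Proof. by rewrite scalerA -expfzDr ?subrr ?expr0z ?scale1r //; apply/eqP. Qed.

Lemma parity m : exists n, m = 2 * n \/ m = 2 * n + 1.
Proof. by exists (m %/ 2)%Z; lia. Qed.

(** Valuations are in Z/2 and U has valuation 1, so up to powers of U every element has valuation 0
    or 1/2. This lemma treats groups without the second kind, the next one those with an element r
    of that kind. *)
Lemma sat_span C : (forall x, P x -> v x = 0 -> C x) ->
  (forall x, P x -> v x <> 2%:R^-1) -> forall x, P x -> span C x.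
Proof.
move=> PC Podd x Px; have [m vx] := val_half_int frame (P0 Px).
have [n [mE|mE]] := parity m; rewrite mE in vx.
  have [Py vy] := sat_val_scale Px vx.
  by exists n, (U ^ (- n) *: x); split; [apply: PC | rewrite Uz_scaleK].
case: (Podd _ (sat_scale (- n) Px)); rewrite val_UzM ?P0 // rmorphN.
by move: vx; rewrite rmorphD rmorphM /=; lra.
Qed.

Lemma sat_span_ext C r : (forall x, P x -> v x = 0 -> C x) ->
  P r -> v r = 2%:R^-1 -> forall x, P x -> span (ext C r) x.
Proof.
move=> PC Pr vr x Px; have [m vx] := val_half_int frame (P0 Px).
have rU := Ddiv (P0 Pr).
have [n [mE|mE]] := parity m; rewrite mE in vx.
  have [Py vy] := sat_val_scale Px vx; exists n, (U ^ (- n) *: x).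
  by split; [left; apply: PC | rewrite Uz_scaleK].
exists n, (U ^ (- n) *: x); split; last by rewrite Uz_scaleK.
right; exists (U ^ (- n) *: x * r^-1); split; last by rewrite mulrVK.
have Py := sat_scale (- n) Px.
apply: PC; first by apply: PM => //; apply: PV.
rewrite (valuM vP) ?invD_neq0 ?P0 // (valuV Ddiv vP) ?P0 // vr val_UzM ?P0 //.
by rewrite rmorphN; move: vx; rewrite rmorphD rmorphM /=; lra.
Qed.

(** Up to sign the doubled coordinates of x are the traces of x, x i, x j and x i j. These products
    are torsion elements of P, so the traces are integers. *)
Lemma sat_v0_T24 x : P i -> P j -> P x -> v x = 0 -> T24 x.
Proof.
move=> Pi Pj Px vx.
have vi := val_sqrtN1 i2; have vj := val_sqrtN1 j2.
have tors y : P y -> v y = 0 -> forall a b c d, x * y = q a b c d ->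
    exists2 m, 2%:R * a = m%:~R & (`|m| <= 2)%N.
  move=> Py vy a b c d E.
  have vxy : v (x * y) = 0 by rewrite (valuM vP) ?P0 // vx vy addr0.
  have [n n0] := sat_torsion satP (PM Px Py) vxy.
  by rewrite E => /(torsion_q frame n0)[].
have [a [b [c [d xE]]]] := qP frame x.
have iE := q_i i j; have jE := q_j i j; have kE := qmk_ij i j.
have [n n0] := sat_torsion satP Px vx; rewrite xE => /(torsion_q frame n0)[xn [m1 m1E _]].
have [m2 m2E _] : exists2 m, 2%:R * (- b) = m%:~R & (`|m| <= 2)%N.
  apply: (tors i Pi vi _ a d (- c)).
  by rewrite xE {2}iE (qM frame); congr qmk; ring.
have [m3 m3E _] : exists2 m, 2%:R * (- c) = m%:~R & (`|m| <= 2)%N.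
  apply: (tors j Pj vj _ (- d) a b).
  by rewrite xE {2}jE (qM frame); congr qmk; ring.
have [m4 m4E _] : exists2 m, 2%:R * (- d) = m%:~R & (`|m| <= 2)%N.
  apply: (tors (i * j) (PM Pi Pj) _ _ c (- b) a).
    by rewrite (valuM vP) ?P0 // vi vj addr0.
  by rewrite xE kE (qM frame); congr qmk; ring.
exists m1, (- m2), (- m3), (- m4); split.
  apply: Q2_intr_inj; rewrite !sqrrN !rmorphD !rmorphXn /= -m1E -m2E -m3E -m4E.
  transitivity (4%:R * qnorm a b c d); first by rewrite /qnorm; ring.
  by rewrite xn mulr1.
have half (e : Q2) m : 2%:R * e = m%:~R -> m%:~R / 2%:R = e.
  by move=> <-; rewrite mulrC mulKf //; exact: Q2_two_neq0.
rewrite /hurw !rmorphN /= !mulNr.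
by rewrite (half _ _ m1E) (half _ _ m2E) (half _ _ m3E) (half _ _ m4E) !opprK.
Qed.

Lemma val_scalar_odd a : a != 0 -> v a%:A <> 2%:R^-1.
Proof.
by move=> a0; have [m ->] := val_scalar_int vP a0; apply: half_not_int.
Qed.

(* Conjugation by an element of half-integral valuation acts on Q_8 as an
   outer automorphism, hence as [1 + i] up to T24. *)
Lemma sat_Q8_odd r : P i -> P j -> P r -> v r = 2%:R^-1 ->
  exists s w, [/\ T24 s, r = s * (w *: i1) & U = 2%:R * w ^+ 2 \/ U = - (2%:R * w ^+ 2)].
Proof.
move=> Pi Pj Pr vr; have r0 := P0 Pr; have rU := Ddiv r0.
have conjT y : P y -> y ^+ 2 = - 1 ->
    T24 (r * y * r^-1) /\ (r * y * r^-1) ^+ 2 = - 1.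
  move=> Py yy; split; last first.
    by rewrite expr2 !mulrA mulrVK // -(mulrA r y y) -expr2 yy mulrN1 mulNr mulrV.
  by apply: sat_v0_T24 => //; [apply: satJ | rewrite (valuJ Ddiv vP) ?P0 // val_sqrtN1].
(* Moving r i r^-1 back to i by t in T24 replaces r by x = t r, which commutes with i. *)
have [Te ee] := conjT i Pi i2; have [t Tt te] := T24_transport Te ee.
have [x xE] : exists x, x = t * r by exists (t * r).
have x0 : x != 0 by rewrite xE; apply: (mulD_neq0 Ddiv (T24_neq0 frame Tt) r0).
have xU := Ddiv x0; have tU := Ddiv (T24_neq0 frame Tt).
have vx : v x = 2%:R^-1.
  by rewrite xE (valuM vP) // ?(T24_neq0 frame Tt) // (T24_val frame Tt) add0r vr.
have xi : x * i = i * x.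
  by rewrite xE [RHS]mulrA -te -!mulrA mulVr // mulr1.
have [Te' ee'] := conjT j Pj j2.
have [f [Tf ff fx]] : exists f, [/\ T24 f, f ^+ 2 = - 1 & f * x = x * j].
  exists (t * (r * j * r^-1) * t^-1); split.
  - exact: (T24M frame (T24M frame Tt Te') (T24V frame Tt)).
  - move: (r * j * r^-1) ee' => y yy.
    by rewrite expr2 !mulrA mulrVK // -(mulrA t y y) -expr2 yy mulrN1 mulNr mulrV.
  - by rewrite xE !mulrA mulrVK // mulrVK.
have fi : f * i = - (i * f).
  apply: (mulIr xU); rewrite mulNr -[i * f * x]mulrA fx [i * _]mulrA -xi.
  by rewrite -[LHS]mulrA -xi [LHS]mulrA fx -!mulrA ji_anti mulrN.
have notscalar s y : T24 s -> y = s * x -> y * i = i * y -> y * j = j * y -> False.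
  move=> Ts yE yi yj; have [a aE] := center_scalar frame yi yj.
  have s0 := T24_neq0 frame Ts.
  have y0 : y != 0 by rewrite yE; apply: (mulD_neq0 Ddiv s0 x0).
  have vy : v y = 2%:R^-1 by rewrite yE (valuM vP) // (T24_val frame Ts) add0r.
  apply: (@val_scalar_odd a); last by rewrite -aE.
  by apply: contra_neq y0 => a0; rewrite aE a0 scale0r.
have Ti := T24_i i j.
(* f = x j x^-1 anticommutes with i, so it is j or ij up to sign. If it were j or -j, then x or i x
   would be central, but scalars have integral valuation; for -ij the sign is absorbed by i. *)
have [s Ts [sxi sxj]] : exists2 s, T24 s & s * x * i = i * (s * x) /\
    s * x * j = i * j * (s * x).
  have ffi (e : Q2) : f = q 0 e 0 0 -> e = 0.
    by move=> fE; move: fi; rewrite fE => /(anticommute_i frame)[].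
  have iE := q_i i j.
  have [[fE|fE]|[fE|fE]|[fE|fE]] := T24_sqrtN1 Tf ff.
  - by have /eqP := ffi 1 (etrans fE iE); rewrite oner_eq0.
  - have /eqP : - 1 = 0 :> Q2 by apply: ffi; rewrite fE [in LHS]iE qmkN oppr0.
    by rewrite oppr_eq0 oner_eq0.
  - by case: (notscalar 1 x (T24_1 i j)); rewrite ?mul1r // -fx fE.
  - case: (notscalar i (i * x) Ti) => //; first by rewrite -mulrA xi.
    by rewrite -mulrA -fx fE mulNr mulrN !mulrA ji_anti mulNr.
  - by exists 1; [apply: T24_1 | rewrite mul1r -fx fE].
  - exists i => //; split; first by rewrite -mulrA xi.
    by rewrite -mulrA -fx fE !mulrA -(mulrA i j i) ji_anti.
(* s x and 1 + i both fix i and send j to ij under conjugation, so y is central. *)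
pose y := (1 - i) * (s * x).
have yi : y * i = i * y.
  by rewrite /y -mulrA sxi !mulrA mulrBl mulrBr mul1r mulr1.
have yj : y * j = j * y.
  rewrite /y -mulrA sxj !mulrA; congr (_ * _ * _).
  rewrite mulrBl mul1r -expr2 i2 opprK mulrBr mulr1 mulrDl mul1r ji_anti.
  by rewrite opprK addrC.
have [c cE] := center_scalar frame yi yj.
have i11 : i1 * (1 - i) = (2%:R)%:A.
  rewrite /i1 mulrDl mul1r mulrBr mulr1 -expr2 i2 opprK addrA subrK.
  by rewrite scaler_nat mulr2n.
have sxE : s * x = (c / 2%:R) *: i1.
  have : i1 * y = c *: i1 by rewrite cE mulr_algr.
  rewrite /y mulrA i11 mulr_algl => E; rewrite mulrC -scalerA -E scalerA mulVf ?scale1r //.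
  exact: Q2_two_neq0.
have sU := Ddiv (T24_neq0 frame Ts).
exists ((s * t)^-1), (c / 2%:R).
have rE : r = (s * t)^-1 * ((c / 2%:R) *: i1).
  by rewrite -sxE xE (mulrA s) mulKr // unitrMl.
have Tst : T24 ((s * t)^-1) := T24V frame (T24M frame Ts Tt).
split=> //.
(* r^2 is U times an element of T24, so comparing reduced norms gives (2 w^2)^2 = U^2 with w = c /
   2. *)
have [|Pf vf] := @sat_val_scale (r * r) 1 (PM Pr Pr).
  by rewrite (valuM vP) // vr; lra.
have Tf' := sat_v0_T24 Pi Pj Pf vf.
have n1 : nrd i1 2%:R by exists 1, 1, 0, 0; split; [exact: i1E | rewrite /qnorm; ring].
have nr := nrdM (nrd_T24 Tst) (nrdZ (c / 2%:R) n1).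
rewrite -rE in nr.
have nrr := nrdZ U (nrd_T24 Tf').
have rrE : r * r = U *: (U ^ (- 1) *: (r * r)).
  by rewrite -[in X in X *: _](expr1z U) Uz_scaleK.
rewrite -rrE in nrr; have E := nrd_inj (nrdM nr nr) nrr.
have /eqP : (2%:R * (c / 2%:R) ^+ 2) ^+ 2 = U ^+ 2.
  by rewrite -[RHS]mulr1 -E; ring.
rewrite eqf_sqr => /orP[] /eqP ->; first by left.
by right; rewrite opprK.
Qed.

Lemma val_q_axis a : a != 0 ->
  v (q a 0 0 0) <> 2%:R^-1 /\ v (q 0 a 0 0) <> 2%:R^-1.
Proof.
move=> a0; rewrite -(q_const i j); split; first exact: val_scalar_odd.
have -> : q 0 a 0 0 = a%:A * i by rewrite {2}(q_i i j) mulr_algl qmkZ !mulr0 mulr1.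
rewrite (valuM vP) ?scalar_neq0 ?(i_neq0 frame) // (val_sqrtN1 i2) addr0.
exact: val_scalar_odd.
Qed.

Definition C4 x := [\/ x = 1, x = - 1, x = i | x = - i].

Lemma C4_T24 x : C4 x -> T24 x.
Proof.
have T1 := T24_1 i j; have Ti := T24_i i j.
by case=> ->; [exact: T1 | exact: T24N | exact: Ti | exact: T24N].
Qed.

Lemma sat_v0_C4 x : P i -> x * i = i * x -> P x -> v x = 0 -> C4 x.
Proof.
move=> Pi xi Px vx; have [a [b [c [d xE]]]] := qP frame x.
have iE := q_i i j.
have [c0 d0] : c = 0 /\ d = 0 by move: xi; rewrite xE => /(commute_i frame).
rewrite c0 d0 in xE.
have [n n0] := sat_torsion satP Px vx; rewrite xE => /(torsion_q frame n0)[xn [m1 m1E _]].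
have vxi : v (x * i) = 0 by rewrite (valuM vP) ?P0 // vx (val_sqrtN1 i2) addr0.
have [n' n'0] := sat_torsion satP (PM Px Pi) vxi.
rewrite xE [X in _ * X]iE (qM frame) => /(torsion_q frame n'0)[_ [m2]].
rewrite !simpq => m2E _.
have n4 : m1 ^+ 2 + m2 ^+ 2 + 0 ^+ 2 + 0 ^+ 2 = 4.
  apply: Q2_intr_inj; rewrite !rmorphD !rmorphXn /= -m1E -m2E.
  transitivity (4%:R * qnorm a b 0 0); first by rewrite /qnorm; ring.
  by rewrite xn mulr1.
have half (e : Q2) m : 2%:R * e = (2 * m)%:~R -> e = m%:~R.
  by rewrite intrM; apply: mulfI; exact: Q2_two_neq0.
have sq4 (z : int) : z ^+ 2 = 4 -> z = 2 * 1 \/ z = 2 * (- 1).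
  move/eqP; rewrite (_ : 4 = 2 ^+ 2) // eqf_sqr.
  by case/orP=> /eqP ->; [left | right].
have m0 (e : Q2) m : m = 0 -> 2%:R * e = m%:~R -> e = 0.
  by move=> -> E; apply: (half e 0); rewrite mulr0.
have m2E' : 2%:R * (- b) = m2%:~R by rewrite mulrN.
case/four_squares: n4 => [[] //|[] [] //].
  move=> /sq4[] mE /m0/(_ m2E')/eqP b0 _ _; rewrite mE in m1E;
    move: b0; rewrite oppr_eq0 (half _ _ m1E) => /eqP ->.
    by constructor 1; rewrite -(q1 i j).
  by constructor 2; rewrite -(q1 i j) qmkN oppr0.
move=> /m0/(_ m1E) -> /sq4[] mE _ _; rewrite mE in m2E';
  rewrite -[b]opprK (half _ _ m2E').
  by constructor 4; rewrite [in RHS]iE qmkN oppr0.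
by constructor 3; rewrite [RHS]iE rmorphN opprK.
Qed.

Lemma ext_absorb s r r' x : T24 s -> r = s * r' -> ext T24 r x -> ext T24 r' x.
Proof.
move=> Ts ->; case=> [|[y [Ty ->]]]; first by left.
by right; exists (y * s); split; [apply: (T24M frame) | rewrite mulrA].
Qed.

Lemma sat_sqr r : P r -> v r = 2%:R^-1 ->
  exists f, [/\ P f, v f = 0 & r * r = U *: f].
Proof.
move=> Pr vr; have [|Pf vf] := @sat_val_scale (r * r) 1 (PM Pr Pr).
  by rewrite (valuM vP) ?P0 // vr; lra.
exists (U ^ (- 1) *: (r * r)); split=> //.
by rewrite -[in X in X *: _](expr1z U) Uz_scaleK.
Qed.

(** For U = 2u this means that w^2 is u or -u. *)
Definition half_unit_square w := U = 2%:R * w ^+ 2 \/ U = - (2%:R * w ^+ 2).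

Lemma sat_Q8_cases : P i -> P j ->
  (forall x, P x -> span T24 x) \/
  (exists2 w, half_unit_square w & forall x, P x -> span (ext T24 (w *: i1)) x).
Proof.
move=> Pi Pj; have v0 := sat_v0_T24 Pi Pj.
have [[r Pr vr]|none] := pselect (exists2 r, P r & v r = 2%:R^-1); last first.
  by left; apply: sat_span => // x Px vx; apply: none; exists x.
have [s [w [Ts rE UE]]] := sat_Q8_odd Pi Pj Pr vr.
right; exists w => // x /(sat_span_ext v0 Pr vr).
by apply: span_sub => y; apply: ext_absorb Ts rE.
Qed.

Lemma one_neqN1 : 1 <> - 1 :> D.
Proof.
rewrite -(q1 i j) qmkN => /(q_inj frame)[/eqP].
by rewrite -addr_eq0 -mulr2n (negPf Q2_two_neq0).
Qed.

(** Conjugation by r, of valuation 1/2, sends i to i or -i. In the first case r = a + b i and r^2 is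
    U times a fourth root of 1: 1 and -1 would give a b = 0 and integral valuation, so r^2 = U i or
    -U i, a = b or a = -b, and r is b (1 + i) up to T24. In the second case r is pure, so that r^2
    is scalar and equals U or -U. *)
Lemma sat_C4_cases : P i -> (forall x, P x -> v x = 0 -> x * i = i * x) ->
  [\/ forall x, P x -> span T24 x,
      exists2 w, half_unit_square w & forall x, P x -> span (ext T24 (w *: i1)) x
    | exists2 r, r * i = - (i * r) /\ (r * r = U%:A \/ r * r = - U%:A) &
        forall x, P x -> span (ext C4 r) x].
Proof.
move=> Pi comm; have v0 x : P x -> v x = 0 -> C4 x.
  by move=> Px vx; apply: sat_v0_C4 => //; apply: comm.
have [[r Pr vr]|none] := pselect (exists2 r, P r & v r = 2%:R^-1); last first.
  constructor 1; apply: sat_span => [x Px /v0|x Px vx].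
    by move=> /(_ Px); apply: C4_T24.
  by apply: none; exists x.
have rU := Ddiv (P0 Pr); have iE := q_i i j.
have ee : (r * i * r^-1) ^+ 2 = - 1.
  by rewrite expr2 !mulrA mulrVK // -(mulrA r i i) -expr2 i2 mulrN1 mulNr mulrV.
have [f [Pf vf rrE]] := sat_sqr Pr vr.
have Cf := v0 _ Pf vf.
have : C4 (r * i * r^-1).
  by apply: v0; [apply: satJ | apply: val_sqrtN1].
case=> eE.
- by move: ee; rewrite eE expr1n => /one_neqN1.
- by move: ee; rewrite eE sqrrN expr1n => /one_neqN1.
- have ri : r * i = i * r by rewrite -[in RHS]eE mulrVK.
  have [a [b [c [d rE]]]] := qP frame r.
  have [c0 d0] : c = 0 /\ d = 0 by move: ri; rewrite rE => /(commute_i frame).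
  rewrite c0 d0 in rE.
  have rr : r * r = q (a ^+ 2 - b ^+ 2) (2%:R * a * b) 0 0.
    by rewrite rE (qM frame); congr qmk; ring.
  have axis : 2%:R * a * b = 0 -> False.
    move/eqP; rewrite mulf_eq0 mulf_eq0 (negPf Q2_two_neq0) => /orP[]/eqP z0.
      case: (@val_q_axis b) => [|_]; last by apply; rewrite -vr rE z0.
      by apply: contra_neq (P0 Pr) => b0; rewrite rE z0 b0 (q0 i j).
    case: (@val_q_axis a) => [|+ _]; last by apply; rewrite -vr rE z0.
    by apply: contra_neq (P0 Pr) => a0; rewrite rE z0 a0 (q0 i j).
  have ab e : r * r = q 0 e 0 0 -> U = e \/ U = - e ->
      exists2 w, half_unit_square w & forall x, P x -> span (ext T24 (w *: i1)) x.
    rewrite rr => /(q_inj frame)[/eqP + eE' _ _] UE.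
    rewrite subr_eq0 eqf_sqr; have T24v0 x : P x -> v x = 0 -> T24 x.
      by move=> Px vx; apply/C4_T24/v0.
    case/orP=> /eqP abE; exists b.
    - by rewrite /half_unit_square expr2 mulrA -{1 3}abE eE'.
    - move=> x /(sat_span_ext T24v0 Pr vr).
      apply: span_sub => y; apply: (ext_absorb (T24_1 i j)).
      by rewrite mul1r rE abE i1E qmkZ; congr qmk; ring.
    - have eE2 : e = - (2%:R * b ^+ 2) by rewrite -eE' abE; ring.
      by rewrite /half_unit_square; case: UE => ->; rewrite eE2 ?opprK; [right | left].
    - move=> x /(sat_span_ext T24v0 Pr vr).
      apply: span_sub => y; apply: (ext_absorb (T24_i i j)).
      transitivity (q 0 1 0 0 * q b b 0 0); last by rewrite -iE i1E qmkZ !mulr1 !mulr0.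
      by rewrite rE abE (qM frame); congr qmk; ring.
  constructor 2; case: Cf => fE; rewrite fE in rrE.
  + case: axis; move: rrE; rewrite rr (q_const i j) => /(q_inj frame)[_ -> //].
  + case: axis; move: rrE.
    by rewrite rr scalerN (q_const i j) qmkN oppr0 => /(q_inj frame)[_ -> //].
  + by apply: (ab U); [rewrite rrE [X in _ *: X]iE qmkZ !mulr0 mulr1 | left].
  + apply: (ab (- U)); last by right; rewrite opprK.
    by rewrite rrE scalerN [X in _ *: X]iE qmkZ qmkN !mulr0 oppr0 mulr1.
- have ri : r * i = - (i * r) by rewrite -mulNr -eE mulrVK.
  constructor 3; exists r; last exact: sat_span_ext v0 Pr vr.
  split=> //; have [a [b [c [d rE]]]] := qP frame r.
  have [a0 b0] : a = 0 /\ b = 0 by move: ri; rewrite rE => /(anticommute_i frame).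
  have rr : r * r = q (- (c ^+ 2 + d ^+ 2)) 0 0 0.
    by rewrite rE a0 b0 (qM frame); congr qmk; ring.
  case: Cf => fE; rewrite fE in rrE.
  + by left.
  + by right; rewrite rrE scalerN.
  + move: rrE; rewrite rr [X in _ *: X]iE qmkZ !mulr0 mulr1.
    by case/(q_inj frame) => _ /esym/U0.
  + move: rrE; rewrite rr scalerN [X in _ *: X]iE qmkZ qmkN !mulr0 oppr0 mulr1.
    by case/(q_inj frame) => _ /esym/eqP; rewrite oppr_eq0 (negPf U_neq0).
Qed.

Lemma sat_trace x : P x -> v x = 0 -> exists m a b c d,
  [/\ x = q a b c d, 2%:R * a = m%:~R /\ (`|m| <= 2)%N,
      m = 0 -> x ^+ 2 = - 1 & m = 2 -> x = 1].
Proof.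
move=> Px vx; have [a [b [c [d xE]]]] := qP frame x.
have [n n0] := sat_torsion satP Px vx.
rewrite xE => /(torsion_q frame n0)[xn [m mE m2]].
exists m, a, b, c, d; split=> // m0; rewrite m0 in mE.
  by rewrite (q_sqr frame) mE xn scale0r scale1r sub0r.
have a1 : a = 1.
  by apply: (mulfI Q2_two_neq0); rewrite mulr1.
move: xn; rewrite a1 /qnorm expr1n => E.
have : qnorm 0 b c d = 0.
  by rewrite -[RHS](subrr 1) -[X in X - _]E /qnorm; ring.
by case/(qnorm_eq0 frame) => _ -> -> ->; rewrite (q1 i j).
Qed.

(** Multiplying om^2 + om + 1 = 0 by x shows that the traces of om x and om^2 x have sum 1. They are
    at most 2 in absolute value, and nonzero because trace 0 would give a square root of -1; so one
    of them is 2, and an element of norm 1 and trace 2 is 1. *)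
Lemma sat_cubic x : P om -> (forall x, P x -> x ^+ 2 <> - 1) -> P x ->
  v x = 0 -> x ^+ 2 + x + 1 = 0 -> x = om \/ x = om ^+ 2.
Proof.
move=> Po noi Px vx xx.
have vo : v om = 0 := T24_val frame T24_om.
have Po2 : P (om ^+ 2) := satX 2 Po.
have vo2 : v (om ^+ 2) = 0 by rewrite expr2 (valuM vP) // vo addr0.
have [m1 [a1 [b1 [c1 [d1 [E1 [t1 l1] z1 u1]]]]]] : exists m a b c d,
  [/\ om * x = q a b c d, 2%:R * a = m%:~R /\ (`|m| <= 2)%N,
      m = 0 -> (om * x) ^+ 2 = - 1 & m = 2 -> om * x = 1].
  by apply: sat_trace; [apply: PM | rewrite (valuM vP) ?P0 // vo vx addr0].
have [m2 [a2 [b2 [c2 [d2 [E2 [t2 l2] z2 u2]]]]]] : exists m a b c d,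
  [/\ om ^+ 2 * x = q a b c d, 2%:R * a = m%:~R /\ (`|m| <= 2)%N,
      m = 0 -> (om ^+ 2 * x) ^+ 2 = - 1 & m = 2 -> om ^+ 2 * x = 1].
  by apply: sat_trace; [apply: PM | rewrite (valuM vP) ?P0 // vo2 vx addr0].
have [a [b [c [d xE]]]] := qP frame x.
have sum0 : om ^+ 2 * x + om * x + x = 0.
  by rewrite -[x in X in _ + X]mul1r -!mulrDl om_cubic mul0r.
have [aE _] := cubic_q frame (etrans (congr1 (fun y => y ^+ 2 + y + 1) (esym xE)) xx).
have m12 : m1 + m2 = 1.
  move: sum0; rewrite E1 E2 xE !qmkD => /(q_eq0 frame)[S _ _ _].
  apply: Q2_intr_inj; rewrite rmorphD /= -t1 -t2.
  transitivity (2%:R * (a2 + a1 + a) - 2%:R * a); first by ring.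
  by rewrite S aE; ring.
have [m1E|m2E] : m1 = 2 \/ m2 = 2.
  have n1 : m1 <> 0 by move/z1; apply: noi; apply: PM.
  have n2 : m2 <> 0 by move/z2; apply: noi; apply: PM.
  lia.
- right; have oU := Ddiv om0; apply: (mulrI oU).
  by rewrite u1 // -exprS om3.
- left; have oU := Ddiv (P0 Po2); apply: (mulrI oU).
  by rewrite u2 // -exprSr om3.
Qed.

Lemma sat_v0_C6 x : P om -> (forall x, P x -> x ^+ 2 <> - 1) -> P x ->
  v x = 0 -> C6 x.
Proof.
move=> Po noi Px vx; have [n n0 xn] := sat_torsion satP Px vx.
have [[xE|xE]|/(noi _ Px)//|xx|xx] := torsion_cases frame n0 xn.
- by exists 1; split; [constructor 1 | left].
- by exists 1; split; [constructor 1 | right].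
- have [->|->] := sat_cubic Po noi Px vx xx.
    by exists om; split; [constructor 2 | left].
  by exists (om ^+ 2); split; [constructor 3 | left].
have vNx : v (- x) = 0 by rewrite (valuN Ddiv vP).
have [xE|xE] := sat_cubic Po noi (satN satP Px) vNx xx; rewrite -[x]opprK xE.
  by exists om; split; [constructor 2 | right].
by exists (om ^+ 2); split; [constructor 3 | right].
Qed.

(** An r of valuation 1/2 cannot commute with om, so it exchanges om and om^2. In r^2 = U f the
    factor f is in C6 and commutes with r, which leaves f = 1 and f = -1. *)
Lemma sat_C6_cases : P om -> (forall x, P x -> x ^+ 2 <> - 1) ->
  (forall x, P x -> span T24 x) \/
  exists2 r, r * om = om ^+ 2 * r /\ (r * r = U%:A \/ r * r = - U%:A) &
    forall x, P x -> span (ext C6 r) x.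
Proof.
move=> Po noi; have v0 x : P x -> v x = 0 -> C6 x by apply: sat_v0_C6.
have [[r Pr vr]|none] := pselect (exists2 r, P r & v r = 2%:R^-1); last first.
  left; apply: sat_span => [x Px /v0|x Px vx].
    by move=> /(_ Px); apply: C6_T24.
  by apply: none; exists x.
have r0 := P0 Pr; have rU := Ddiv r0.
have ncom : r * om <> om * r.
  by move=> /(commute_om_val r0)[k]; rewrite vr => /esym/half_not_int.
have rom : r * om = om ^+ 2 * r.
  have Pe : P (r * om * r^-1) by apply: satJ.
  have ve : v (r * om * r^-1) = 0 by rewrite (valuJ Ddiv vP) // (T24_val frame T24_om).
  have ee : (r * om * r^-1) ^+ 2 + r * om * r^-1 + 1 = 0.
    rewrite expr2 !mulrA mulrVK // -(mulrA r om om) -expr2 -mulrDl -mulrDr.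
    rewrite -[X in _ + X](mulrV rU) -mulrDl -[X in _ + X]mulr1 -mulrDr.
    by rewrite om_cubic mulr0 mul0r.
  have [eE|eE] := sat_cubic Po noi Pe ve ee; last by rewrite -eE mulrVK.
  by case: ncom; rewrite -[in RHS]eE mulrVK.
right; exists r; last exact: sat_span_ext v0 Pr vr.
split=> //; have [f [Pf vf rrE]] := sat_sqr Pr vr.
have fr : f * r = r * f.
  have : U *: (f * r) = U *: (r * f) by rewrite scalerAl -rrE scalerAr -rrE mulrA.
  by apply: scalerI; exact: U_neq0.
have [y [yE fE]] := v0 _ Pf vf.
have yr : y * r = r * y.
  by case: fE fr => ->; rewrite // mulNr mulrN => /oppr_inj.
case: yE fE yr => -> fE yr.
- by move: rrE; case: fE => ->; [left | right; rewrite -scalerN].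
- by case: ncom.
- by case: ncom; rewrite -(semicommute_om2 rom) -yr rom.
Qed.

Lemma sat_C2_cases : (forall x, P x -> v x = 0 -> x = 1 \/ x = - 1) ->
  (forall x, P x -> span T24 x) \/
  exists2 r, v r = 2%:R^-1 /\ (r * r = U%:A \/ r * r = - U%:A) &
    forall x, P x -> span (ext (fun y => y = 1 \/ y = - 1) r) x.
Proof.
move=> v0.
have [[r Pr vr]|none] := pselect (exists2 r, P r & v r = 2%:R^-1); last first.
  left; apply: sat_span => [x Px vx|x Px vx]; last by apply: none; exists x.
  by have [->|->] := v0 x Px vx; [apply: T24_1 | apply/T24N/T24_1].
right; exists r; last exact: sat_span_ext v0 Pr vr.
split=> //; have [f [Pf vf rrE]] := sat_sqr Pr vr.
by move: rrE; case: (v0 f Pf vf) => ->; [left | right; rewrite -scalerN].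
Qed.

End Saturated.
Definition conj_into P C :=
  exists2 z, z != 0 & forall x, P (z * x * z^-1) -> C x.

Lemma saturated_conj P z : z != 0 -> saturated P ->
  saturated (fun x => P (z * x * z^-1)).
Proof.
move=> z0 satP; have zU := Ddiv z0.
have JM x y : z * (x * y) * z^-1 = (z * x * z^-1) * (z * y * z^-1).
  by rewrite !mulrA mulrVK.
split=> [x /(sat_neq0 satP)|||x|x||x].
- by apply: contra_neq => ->; rewrite mulr0 mul0r.
- by rewrite mulr1 mulrV //; apply: (sat_1 satP).
- by move=> x y Px Py; rewrite JM; apply: (satM satP).
- move=> Px; have x0 : x != 0.
    by apply: contra_neq (sat_neq0 satP Px) => ->; rewrite mulr0 mul0r.
  have xU := Ddiv x0; have := satV satP Px.
  by rewrite !invrM ?unitrV ?unitrMl ?xU ?zU // invrK mulrA.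
- by move=> /(satN satP); rewrite mulrN mulNr.
- by rewrite mulr_algr -scalerAl mulrV //; apply: (satU satP).
move=> Px vx; have x0 : x != 0.
  by apply: contra_neq (sat_neq0 satP Px) => ->; rewrite mulr0 mul0r.
have [|n n0] := sat_torsion satP Px; first by rewrite (valuJ Ddiv vP).
have -> : (z * x * z^-1) ^+ n = z * x ^+ n * z^-1.
  elim: n {n0} => [|n IH]; first by rewrite !expr0 mulr1 mulrV.
  by rewrite !exprS IH JM.
move=> E; exists n => //; apply: (mulrI zU); apply: (mulIr (_ : z^-1 \is a GRing.unit)).
  by rewrite unitrV.
by rewrite E mulr1 mulrV.
Qed.

Lemma conj_into_conj P z C : z != 0 ->
  conj_into (fun x => P (z * x * z^-1)) C -> conj_into P C.
Proof.
move=> z0 [z' z'0 H]; exists (z * z'); first exact: mulD_neq0.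
move=> x Px; apply: H; move: Px; rewrite invrM ?Ddiv //.
by rewrite !mulrA.
Qed.

Lemma conj_into_refl P C : (forall x, P x -> C x) -> conj_into P C.
Proof.
by move=> H; exists 1; rewrite ?oner_neq0 // => x; rewrite mul1r invr1 mulr1 => /H.
Qed.

Variant standard_form P : Prop :=
| StandardT24 of conj_into P (span T24)
| StandardN w of half_unit_square w & conj_into P (span (ext T24 (w *: i1)))
| StandardC4 r of r * i = - (i * r) & r * r = U%:A \/ r * r = - U%:A
    & conj_into P (span (ext C4 r))
| StandardC6 r of r * om = om ^+ 2 * r & r * r = U%:A \/ r * r = - U%:A
    & conj_into P (span (ext C6 r))
| StandardC2 r of v r = 2%:R^-1 & r * r = U%:A \/ r * r = - U%:A
    & conj_into P (span (ext (fun y => y = 1 \/ y = - 1) r)).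

Lemma standard_form_conj P z : z != 0 ->
  standard_form (fun x => P (z * x * z^-1)) -> standard_form P.
Proof.
move=> z0 [|w wU|r ri rr|r ro rr|r vr rr] /(conj_into_conj z0) H.
- exact: StandardT24.
- exact: StandardN wU H.
- exact: StandardC4 ri rr H.
- exact: StandardC6 ro rr H.
- exact: StandardC2 vr rr H.
Qed.

Lemma not_scalar_sqrtN1 x : x ^+ 2 = - 1 -> forall a, x <> a%:A.
Proof.
move=> xx a xE; apply: (sqr_neqN1 frame (a := a) (b := 0)).
move: xx; rewrite xE expr2 mulr_algl scalerA (q_const i j) -(q1 i j) qmkN.
by move=> /(q_inj frame)[aa _ _ _]; rewrite expr0n addr0 expr2.
Qed.

Lemma cubic_sqr x : x ^+ 2 + x + 1 = 0 -> x ^+ 2 = - x - 1.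
Proof.
by move=> xx; apply/eqP; rewrite -subr_eq0 opprB opprK addrA addrAC xx.
Qed.

Lemma cubic_pow3 x : x ^+ 2 + x + 1 = 0 -> x ^+ 3 = 1.
Proof.
move=> /cubic_sqr x2.
by rewrite exprS x2 mulrBr mulrN mulr1 -expr2 x2 opprB opprK addrK.
Qed.

Lemma not_scalar_cubic x : x ^+ 2 + x + 1 = 0 -> forall a, x <> a%:A.
Proof.
move=> + a xE; rewrite xE expr2 mulr_algl scalerA -{3}(scale1r 1) -!scalerDl.
move/eqP; rewrite scaler_eq0 oner_eq0 orbF => /eqP aa.
apply: (sqr_neqN3 frame (a := 2%:R * a + 1)).
transitivity (4%:R * (a * a + a + 1) - 3%:R); first by ring.
by rewrite aa mulr0 add0r.
Qed.

(* A dicyclic group <y, i> with y of order 3 does not embed in D^*: i would have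
   half-integral valuation. *)
Lemma no_inverted_cubic y : y ^+ 2 + y + 1 = 0 -> y * i * y <> i.
Proof.
move=> yy yiy; have y3 := cubic_pow3 yy.
have yU : y \is a GRing.unit.
  by apply/unitrP; exists (y ^+ 2); rewrite -exprS -exprSr.
have yV : y^-1 = y ^+ 2 by apply: (mulrI yU); rewrite mulrV // -exprS.
have sqE (x : D) : x ^+ 2 + x + 1 = 0 -> x * x = (-1) *: x - 1%:A.
  by move=> /cubic_sqr; rewrite scaleN1r scale1r -expr2.
have [w w0 yw] := intertwine frame (not_scalar_cubic yy) (sqE y yy) (sqE om om_cubic).
have wU := Ddiv w0; have i0 := i_neq0 frame; have iU := Ddiv i0.
have iy : i * y = y ^+ 2 * i.
  by rewrite -yV; apply: (mulrI yU); rewrite mulVKr // mulrA.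
have [||k] := @semicommute_om_val (w^-1 * i * w).
- by rewrite !mulD_neq0 ?invD_neq0.
- rewrite -[LHS]mulrA -yw mulrA -(mulrA w^-1 i y) iy.
  have wy : w^-1 * y = om * w^-1.
    by apply: (mulrI wU); rewrite mulVKr // mulrA -yw mulrK.
  by rewrite expr2 !mulrA wy -(mulrA om) wy !mulrA expr2.
rewrite !(valuM vP) ?mulD_neq0 ?invD_neq0 // (valuV Ddiv vP) // (val_sqrtN1 i2).
by move=> vk; apply: (@half_not_int (- k)); rewrite rmorphN; lra.
Qed.

Lemma saturated_standard_i P : saturated P -> P i -> standard_form P.
Proof.
move=> satP Pi.
have [comm|ncomm] := pselect (forall x, P x -> v x = 0 -> x * i = i * x).
  have [H|[w wU H]|[r [ri rr] H]] := sat_C4_cases satP Pi comm.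
  - exact/StandardT24/conj_into_refl.
  - exact: StandardN wU (conj_into_refl H).
  - exact: StandardC4 ri rr (conj_into_refl H).
have [x [Px vx xi]] : exists x, [/\ P x, v x = 0 & x * i <> i * x].
  move/existsNP: ncomm => [x /not_implyP[Px /not_implyP[vx xi]]].
  by exists x.
have x0 := sat_neq0 satP Px; have xU := Ddiv x0.
have i0 := i_neq0 frame; have iU := Ddiv i0.
(* With e = x i x^-1, the element y = i e satisfies y i y = i and has integral trace m. If m = 0, e
   anticommutes with i; if m = 2, e = -i and x itself serves; m = -2 means that x commutes with i;
   for m = 1 or -1, -y or y is a cube root of 1 excluded by [no_inverted_cubic]. *)
have [j' [Pj' jj' ji']] : exists j', [/\ P j', j' ^+ 2 = - 1 & j' * i = - (i * j')].
  pose e := x * i * x^-1.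
  have Pe : P e by apply: satJ.
  have ee : e ^+ 2 = - 1.
    by rewrite /e expr2 !mulrA mulrVK // -(mulrA x i i) -expr2 i2 mulrN1 mulNr mulrV.
  have ex : e * x = x * i by rewrite /e mulrVK.
  move: (e) Pe ee ex => {}e Pe ee ex.
  have e0 := sat_neq0 satP Pe; have eU := Ddiv e0.
  have vie : v (i * e) = 0.
    by rewrite (valuM vP) // !val_sqrtN1 ?addr0 // i2.
  have Pie : P (i * e) by apply: (satM satP).
  have iie : i * (i * e) = - e by rewrite mulrA -expr2 i2 mulN1r.
  have yiy : i * e * i * (i * e) = i.
    by rewrite -mulrA iie mulrN -mulrA -expr2 ee mulrN1 opprK.
  have [m [a [b [c [d [yE [aE am] m0 m2]]]]]] := sat_trace satP Pie vie.
  have [] : m = 0 \/ m = 2 \/ m = -2 \/ m = 1 \/ m = -1 by lia.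
    move/m0 => y2; exists e; split=> //.
    apply: (mulrI iU); apply: (mulIr eU).
    rewrite [RHS](_ : _ = - 1); last by rewrite mulrN iie opprK -expr2 ee.
    by move: y2; rewrite expr2 !mulrA.
  have Nc (y : D) (f g h k : Q2) (n : nat) : y = q f g h k -> (0 < n)%N -> y ^+ n = 1 ->
      2%:R * f = - 1 -> y ^+ 2 + y + 1 = 0.
    move=> -> n0 /(torsion_q frame n0)[nE _] fE.
    by rewrite (q_sqr frame) fE nE scale1r scaleN1r addrAC addrNK addNr.
  have [n n0 yn] := sat_torsion satP Pie vie.
  case=> [/m2 ie|[mE|[mE|mE]]].
  - have eE : e = - i by rewrite -[e]opprK -iie ie mulr1.
    have ax : x * i = - (i * x) by rewrite -ex eE mulNr.
    exists x; split=> //; have [a' [b' [c' [d' xE]]]] := qP frame x.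
    have [a0 _] : a' = 0 /\ b' = 0 by move: ax; rewrite xE => /(anticommute_i frame).
    have [n' n'0] := sat_torsion satP Px vx.
    rewrite xE => /(torsion_q frame n'0)[nE _].
    by rewrite (q_sqr frame) nE a0 mulr0 scale0r scale1r sub0r.
  - have [m1 [a1 [b1 [c1 [d1 [yE1 [aE1 _] _ m21]]]]]] :=
      sat_trace satP (satN satP Pie) (etrans (valuN Ddiv vP _) vie).
    have /m21 Nie : m1 = 2.
      apply: Q2_intr_inj; rewrite -aE1; move: yE1; rewrite yE qmkN.
      by case/(q_inj frame) => <- _ _ _; rewrite mulrN aE mE rmorphN opprK.
    case: xi; rewrite -ex; congr (_ * x).
    by rewrite -[e]opprK -iie -[i * (i * e)]opprK -mulrN Nie mulr1 opprK.
  - case: (@no_inverted_cubic (- (i * e))); last first.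
      by rewrite mulNr mulrN mulNr opprK.
    have [n' n'0 yn'] := sat_torsion satP (satN satP Pie) (etrans (valuN Ddiv vP _) vie).
    apply: (Nc _ (- a) (- b) (- c) (- d) n' _ n'0 yn'); first by rewrite yE qmkN.
    by rewrite mulrN aE mE.
  - case: (@no_inverted_cubic (i * e)) => //.
    by apply: (Nc _ a b c d n yE n0 yn); rewrite aE mE rmorphN.
have j'0 := sat_neq0 satP Pj'.
have ji := ji_anti; have j0 : j != 0.
  by apply/eqP; rewrite {1}(q_j i j) => /(q_eq0 frame)[_ _ /eqP]; rewrite oner_eq0.
(* j' and j both exchange i and -i and have the same square, so j' is moved to j by the centralizer
   of i. *)
have [||||||||z [z0 zi zj]] := @conj_by_centralizer _ _ _ _ frame i (- i) j' j.
- by rewrite -addr_eq0 -mulr2n -scaler_nat scaler_eq0 (negPf Q2_two_neq0).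
- by rewrite mulrN mulNr.
- by rewrite ji' mulNr.
- by rewrite mulrN ji' opprK.
- by rewrite ji mulNr.
- by rewrite mulrN ji opprK.
- exact: j'0.
- by rewrite -!expr2 jj' j2.
have zV0 := invD_neq0 z0.
apply: (standard_form_conj zV0); rewrite invrK.
have satQ := saturated_conj zV0 satP; rewrite invrK in satQ.
have zU := Ddiv z0.
have Qi : P (z^-1 * i * z) by rewrite -mulrA -zi mulKr.
have Qj : P (z^-1 * j * z) by rewrite -mulrA -zj mulKr.
have [H|[w wU H]] := sat_Q8_cases satQ Qi Qj.
  exact/StandardT24/conj_into_refl.
exact: StandardN wU (conj_into_refl H).
Qed.

Lemma saturated_standard P : saturated P -> standard_form P.
Proof.
move=> satP.
have [[x Px xx]|noi] := pselect (exists2 x, P x & x ^+ 2 = - 1).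
  have [z z0 xz] : exists2 z, z != 0 & x * z = z * i.
    apply: (intertwine frame (t := 0) (n := 1)); first exact: not_scalar_sqrtN1.
      by rewrite -expr2 xx scale0r scale1r sub0r.
    by rewrite -expr2 i2 scale0r scale1r sub0r.
  apply: (standard_form_conj z0); apply: saturated_standard_i.
    exact: saturated_conj.
  by rewrite -xz mulrK // Ddiv.
have noi' z x : z != 0 -> P (z * x * z^-1) -> x ^+ 2 <> - 1.
  move=> z0 Pz xx; apply: noi; exists (z * x * z^-1) => //.
  rewrite expr2 !mulrA mulrVK ?Ddiv // -(mulrA z x x) -expr2 xx mulrN1 mulNr.
  by rewrite mulrV // Ddiv.
have [[x Px xx]|nocub] := pselect (exists2 x, P x & x ^+ 2 + x + 1 = 0).
  have [z z0 xz] : exists2 z, z != 0 & x * z = z * om.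
    apply: (intertwine frame (t := - 1) (n := 1)); first exact: not_scalar_cubic.
      by rewrite scaleN1r scale1r -expr2; apply: cubic_sqr.
    by rewrite scaleN1r scale1r -expr2; apply: cubic_sqr om_cubic.
  apply: (standard_form_conj z0); have satQ := saturated_conj z0 satP.
  have Qom : P (z * om * z^-1) by rewrite -xz mulrK // Ddiv.
  have [H|[r [ro rr] H]] := sat_C6_cases satQ Qom (fun y => @noi' z y z0).
    exact/StandardT24/conj_into_refl.
  exact: StandardC6 ro rr (conj_into_refl H).
have v0 x : P x -> v x = 0 -> x = 1 \/ x = - 1.
  move=> Px vx; have [n n0 xn] := sat_torsion satP Px vx.
  have [//|xx|xx|xx] := torsion_cases frame n0 xn.
  - by case: noi; exists x.
  - by case: nocub; exists x.
  - by case: nocub; exists (- x) => //; apply: (satN satP).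
have [H|[r [vr rr] H]] := sat_C2_cases satP v0.
  exact/StandardT24/conj_into_refl.
exact: StandardC2 vr rr (conj_into_refl H).
Qed.

End Classification.

(** * Finite subgroups of an abstract group *)

Section AbstractGroups.

Local Open Scope classical_set_scope.
Local Open Scope group_scope.
Variable G : groupType.
Implicit Types (F E S : set G) (x y g : G).

Lemma finite_set_repeat (T : choiceType) (A : set T) (f : nat -> T) :
  finite_set A -> (forall k, A (f k)) -> exists k l, (k < l)%N /\ f k = f l.
Proof.
move=> finA fA; apply: contrapT => nrep; apply: infinite_nat.
have <- : f @^-1` A = [set: nat] by apply/seteqP; split=> k //= _; apply: fA.
apply: finite_preimage finA => k l _ _ fkl.
case: (ltngtP k l) => // lt; case: nrep; first by exists k, l.
by exists l, k.
Qed.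

Lemma conjgX_nat x g k l : x ^ (g ^+ (k + l)) = (x ^ (g ^+ k)) ^ (g ^+ l).
Proof. by rewrite expgnDr conjgM. Qed.

Lemma finite_subgroup_torsion F x : finite_subgroup F -> F x ->
  exists2 n, (0 < n)%N & x ^+ n = 1.
Proof.
move=> [F1 FM finF] Fx.
have FV y : F y -> F y^-1 by move=> Fy; rewrite -[y^-1]mul1g; apply: FM.
have FX k : F (x ^+ k).
  elim: k => [|k IH]; first by rewrite expg0.
  by rewrite expgS -[_ ^+ k]invgK; apply: FM => //; apply: FV.
have [k [l [kl E]]] := finite_set_repeat finF FX.
exists (l - k)%N; first by rewrite subn_gt0.
by apply: (mulgI (x ^+ k)); rewrite -expgnDr subnKC 1?ltnW // mulg1.
Qed.

Lemma finite_subgroup_conj F g : finite_subgroup F ->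
  finite_subgroup ((fun x => x ^ g) @` F).
Proof.
move=> [F1 FM finF]; split.
- by exists 1; rewrite // conj1g.
- move=> _ _ [x Fx <-] [y Fy <-]; exists (x * y^-1); first exact: FM.
  by rewrite conjMg conjVg.
- exact: finite_image.
Qed.

Lemma in_class_conj F g C : in_class F C ->
  in_class ((fun x => x ^ g) @` F) C.
Proof.
move=> [gT [f [finj fF CgT]]].
pose h (a : gT) := f a ^ g.
have hM : {morph h : a b / a * b >-> a * b}.
  by move=> a b; rewrite /h gmulfM conjMg.
pose hm := Multiplicative.Pack (Multiplicative.Class (isMultiplicative.Build gT G h hM)).
exists gT, hm; split=> //.
- by move=> a b /conjg_inj/finj.
- rewrite -fF; apply/seteqP; split=> [_ [a _ <-]|_ [_ [a _ <-] <-]].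
    by exists (f a) => //; exists a.
  by exists a.
Qed.

(** The conjugates of y in E by positive powers of g all lie in the finite set S, so they repeat,
    and a repetition brings the orbit back to y. *)
Lemma sub_conj_eq S E g : finite_subgroup S -> S `<=` E ->
  (forall x, E x -> S (x ^ g)) -> E = S.
Proof.
move=> [S1 SM finS] SE ES; apply/seteqP; split=> // y Ey.
have Sf k : S (y ^ (g ^+ k.+1)).
  elim: k => [|k IH]; first by rewrite expg1; apply: ES.
  by rewrite -addn1 conjgX_nat expg1; apply/ES/SE.
have [k [l [kl yE]]] := finite_set_repeat finS Sf.
have := Sf (l - k).-1; rewrite prednK ?subn_gt0 //.
suff -> : y ^ (g ^+ (l - k)) = y by [].
have lE : l.+1 = (l - k + k.+1)%N by lia.
by apply: (@conjg_inj _ (g ^+ k.+1)); rewrite yE lE conjgX_nat.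
Qed.

(** An overgroup E of a member p is conjugate into a member q; then p is conjugate into q, so p = q,
    and [sub_conj_eq] gives E = p. The last hypothesis identifies a maximal subgroup of a given
    class with the member of that class. *)
Lemma maximal_classes_of_representatives (L : seq (group_class * set G)) :
    (forall p, List.In p L -> finite_subgroup p.2 /\ in_class p.2 p.1) ->
    (forall F, finite_subgroup F ->
       exists2 p, List.In p L & exists g, forall x, F x -> p.2 (x ^ g)) ->
    (forall p q, List.In p L -> List.In q L ->
       (exists g, forall x, p.2 x -> q.2 (x ^ g)) -> p = q) ->
    (forall p q E, List.In p L -> List.In q L ->
       in_class E p.1 -> in_class E q.1 -> p = q) ->
  maximal_finite_classes G [seq p.1 | p <- L].
Proof.
move=> LP Lall Lnsub Ldis.
have LmapP C : List.In C [seq p.1 | p <- L] <-> exists2 p, List.In p L & p.1 = C.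
  elim: (L) => [|p l IH] /=; first by split=> // -[].
  split=> [[<-|/IH[q lq <-]]|[q [<-|lq] qC]].
  - by exists p; [left |].
  - by exists q; [right |].
  - by left.
  - by right; apply/IH; exists q.
have Lmax p : List.In p L -> maximal_finite_subgroup p.2.
  move=> Lp; have [finp _] := LP p Lp; split=> // E finE pE.
  have [q Lq [g Eg]] := Lall E finE.
  have pq : p = q by apply: Lnsub => //; exists g => x /pE/Eg.
  by apply: (@sub_conj_eq _ _ g) => // x; rewrite pq; apply: Eg.
have Lconj F : maximal_finite_subgroup F ->
    exists2 p, List.In p L & conjugate_sets p.2 F.
  move=> [finF maxF]; have [p Lp [g Fg]] := Lall F finF; exists p => //.
  have [finp _] := LP p Lp; exists g^-1; apply/esym/maxF.
    exact: finite_subgroup_conj.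
  by move=> x Fx; exists (x ^ g); [apply: Fg | rewrite conjgK].
split=> [F /Lconj[p Lp [g ->]]|C /LmapP[p Lp <-]].
  exists p.1; first by apply/LmapP; exists p.
  by apply: in_class_conj; have [] := LP p Lp.
exists p.2; split; [exact: Lmax | by have [] := LP p Lp |].
move=> E /Lconj[q Lq [g EE]] Ep.
suff -> : p = q by exists g.
apply: (Ldis p q E) => //; rewrite EE; apply: in_class_conj.
by have [] := LP q Lq.
Qed.

End AbstractGroups.

Section FiniteSubgroupType.

Local Open Scope classical_set_scope.
Local Open Scope group_scope.
Variables (G : groupType) (F : set G).

(** An enumeration chosen from the finiteness proof, from which [F] becomes a [finGroupType] as
    [in_class] demands. *)
Definition elements (finF : finite_subgroup F) : seq G :=
  let: And3 _ _ fin := finF in sval (cid ((finite_seqP F).1 fin)).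

Hypothesis finF : finite_subgroup F.

Lemma mem_elements x : x \in elements finF <-> F x.
Proof.
rewrite /elements; case: finF => _ _ fin; case: cid => /= s sE.
by rewrite [in X in _ <-> X]sE.
Qed.

Definition subgroup_type := seq_sub (elements finF).
HB.instance Definition _ := Finite.on subgroup_type.

Fact sub_one_proof : 1 \in elements finF.
Proof. by apply/mem_elements; case: finF. Qed.
Fact sub_inv_proof (x : subgroup_type) : (ssval x)^-1 \in elements finF.
Proof.
apply/mem_elements; have [F1 FM _] := finF; rewrite -[_^-1]mul1g.
by apply: FM => //; apply/mem_elements/ssvalP.
Qed.
Fact sub_mul_proof (x y : subgroup_type) : ssval x * ssval y \in elements finF.
Proof.
apply/mem_elements; have [F1 FM _] := finF; rewrite -[ssval y]invgK.
apply: FM; first by apply/mem_elements/ssvalP.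
exact/mem_elements/sub_inv_proof.
Qed.

Definition sub_one : subgroup_type := SeqSub sub_one_proof.
Definition sub_inv x : subgroup_type := SeqSub (sub_inv_proof x).
Definition sub_mul x y : subgroup_type := SeqSub (sub_mul_proof x y).

Fact sub_mulA : associative sub_mul.
Proof. by move=> x y z; apply: val_inj; rewrite /= mulgA. Qed.
Fact sub_mul1 : left_id sub_one sub_mul.
Proof. by move=> x; apply: val_inj; rewrite /= mul1g. Qed.
Fact sub_mulV : left_inverse sub_one sub_inv sub_mul.
Proof. by move=> x; apply: val_inj; rewrite /= mulVg. Qed.

HB.instance Definition _ :=
  Finite_isGroup.Build subgroup_type sub_mulA sub_mul1 sub_mulV.

Definition sub_val (x : subgroup_type) : G := ssval x.

Fact sub_valM : {morph sub_val : x y / x * y >-> x * y}.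
Proof. by []. Qed.

HB.instance Definition _ :=
  isMultiplicative.Build subgroup_type G sub_val sub_valM.

Lemma sub_val_inj : injective sub_val. Proof. exact: val_inj. Qed.

Lemma sub_val1 : sub_val 1 = 1. Proof. by []. Qed.

Lemma sub_valP x : F (sub_val x).
Proof. exact/mem_elements/ssvalP. Qed.

Lemma sub_val_surj x : F x -> exists a, sub_val a = x.
Proof. by move=> /mem_elements Fx; exists (SeqSub Fx). Qed.

Lemma sub_valX a n : sub_val (a ^+ n) = sub_val a ^+ n.
Proof. by elim: n => [//|n IH]; rewrite !expgS sub_valM IH. Qed.

Lemma sub_valV a : sub_val a^-1 = (sub_val a)^-1. Proof. by []. Qed.

Lemma in_class_sub (C : group_class) :
  C subgroup_type [set: subgroup_type]%SET -> in_class F C.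
Proof.
move=> CF; exists (subgroup_type : finGroupType), sub_val; split=> //.
  exact: sub_val_inj.
apply/seteqP; split=> [_ [x _ <-]|x /sub_val_surj[a <-]]; first exact: sub_valP.
by exists a.
Qed.

End FiniteSubgroupType.

(** * The quotient by 2u *)

Section Projection.

Variables (D : falgType Q2) (u : unit_group Z2).
Hypothesis Ddiv : is_division_algebra D.

Definition twou : Q2 := (2%:R * unit_group_val u)%:F.

Lemma twou_neq0 : twou <> 0.
Proof.
apply/eqP; rewrite tofrac_eq0 mulf_neq0 ?Z2_two_neq0 //.
by apply: contraTneq (unit_groupP u) => ->; rewrite unitr0.
Qed.

(** Total on D, with 0 sent to the class of 1, so that lemmas carry [x != 0] instead of elements of
    [unit_group]. *)
Definition proj (x : D) : GG D u :=
  @to_quotient _ (central_cyclic (@two_u_central D u)) (insubd (1%g : unit_group D) x).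

Let val_ins (x : D) : x != 0 -> unit_group_val (insubd (1%g : unit_group D) x) = x.
Proof. by move=> x0; rewrite -[LHS]/(val _) val_insubd Ddiv. Qed.

Lemma projM (x y : D) : x != 0 -> y != 0 -> proj (x * y) = (proj x * proj y)%g.
Proof.
move=> x0 y0; rewrite /proj.
rewrite -[RHS]/(qg_mul _ _) -to_quotientM; congr to_quotient.
by apply: val_inj; rewrite /= !val_ins // mulD_neq0.
Qed.

Lemma proj1 : proj 1 = 1%g.
Proof.
rewrite /proj -[RHS]/(qg_one _); congr to_quotient.
by apply: val_inj; rewrite /= val_ins // oner_neq0.
Qed.

Lemma projV (x : D) : x != 0 -> proj x^-1 = (proj x)^-1%g.
Proof.
move=> x0; rewrite /proj -[RHS]/(qg_inv _) -to_quotientV; congr to_quotient.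
by apply: val_inj; rewrite /= !val_ins // invD_neq0.
Qed.

Lemma projX (x : D) n : x != 0 -> proj (x ^+ n) = (proj x ^+ n)%g.
Proof.
move=> x0; elim: n => [|n IH]; first by rewrite expr0 proj1 expg0.
by rewrite exprS expgS projM ?IH // expD_neq0.
Qed.

Lemma projJ (x y : D) : x != 0 -> y != 0 -> proj (y^-1 * x * y) = (proj x ^ proj y)%g.
Proof.
by move=> x0 y0; rewrite conjgE !projM ?mulD_neq0 ?invD_neq0 // projV // mulgA.
Qed.

Lemma proj_surj (g : GG D u) : exists2 x : D, x != 0 & g = proj x.
Proof.
have [x ->] := to_quotientP g; exists (unit_group_val x).
  by apply: contraTneq (unit_groupP x) => ->; rewrite unitr0.
rewrite /proj; congr to_quotient; apply: val_inj; rewrite /= val_ins //.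
by apply: contraTneq (unit_groupP x) => ->; rewrite unitr0.
Qed.

Let two_uX n : unit_group_val (two_u D u ^+ n)%g = (twou ^+ n)%:A.
Proof.
elim: n => [|n IH]; first by rewrite expg0 expr0 scale1r.
by rewrite expgS /= IH exprS mulr_algl scalerA.
Qed.

Lemma proj_eq (x y : D) : x != 0 -> y != 0 ->
  proj x = proj y <-> exists m : int, x = twou ^ m *: y.
Proof.
move=> x0 y0; have U0 := twou_neq0; have yU := Ddiv y0.
rewrite /proj to_quotient_eq; split.
  move=> /asboolP[m [n /(congr1 (@unit_group_val _))]].
  rewrite /= !val_ins // !two_uX => E; exists (m%:Z - n%:Z).
  rewrite -[x](mulrVK yU) E -[(twou ^+ n)%:A]/(in_alg D _) -fmorphV /=.
  rewrite mulr_algl -scalerAl mulr_algl scalerA; congr (_ *: _).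
  by rewrite expfzDr -?exprnN //; apply/eqP.
move=> [m xE]; apply/asboolP.
have [k [l mE]] : exists k l : nat, m = k%:Z - l%:Z.
  by case: m {xE} => n; [exists n, 0%N; rewrite subr0 | exists 0%N, n.+1; rewrite NegzE sub0r].
exists k, l; apply: val_inj; rewrite /= !val_ins // !two_uX xE mE.
rewrite -[(twou ^+ l)%:A]/(in_alg D _) -fmorphV /= mulr_algl scalerA -scalerAl mulrV //.
by rewrite expfzDr -?exprnN //; apply/eqP.
Qed.

End Projection.

Definition finite_mult_group (D : unitRingType) (C : D -> Prop) :=
  [/\ forall x, C x -> x != 0, C 1, forall x y, C x -> C y -> C (x * y),
      forall x, C x -> C x^-1 & exists s : seq D, forall x, C x -> x \in s].

(** * Passing between finite subgroups and saturated groups *)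

Section Representatives.

Variables (D : falgType Q2) (u : unit_group Z2) (v : D -> rat) (i j : D).
Hypothesis frame : hamilton_frame v i j.

Let Ddiv : is_division_algebra D. Proof. by case: frame => -[]. Qed.
Let vP : extends_Q2_val v. Proof. by case: frame => -[]. Qed.

Local Notation U := (twou u).
Local Notation span := (span U).
Local Notation saturated := (saturated v U).
Local Notation proj := (proj u).
Implicit Types (x y z r : D) (a b c d w : Q2) (m n : int) (P C : D -> Prop).

Let U0 : U <> 0. Proof. exact: twou_neq0. Qed.

Lemma val_twou : v U%:A = 1.
Proof.
rewrite (@val_scalar _ _ vP _ 1) //; exists (unit_group_val u).
  exact: unit_groupP.
by rewrite /twou tofracM rmorph_nat expr1z.
Qed.

Let vU := val_twou.

Local Open Scope classical_set_scope.

Definition img C : set (GG D u) := [set proj y | y in C].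

Let Uz0 m : U ^ m != 0. Proof. exact: (Uz_neq0 U0). Qed.

Lemma proj_scale m x : x != 0 -> proj (U ^ m *: x) = proj x.
Proof.
move=> x0; apply/(proj_eq _ Ddiv _ x0); last by exists m.
exact: (scale_neq0 (Uz0 m) x0).
Qed.

(** Two lifts differ by a power of U, which the valuation determines since v(U) = 1. *)
Lemma proj_val_eq x y : x != 0 -> y != 0 -> v x = v y -> proj x = proj y -> x = y.
Proof.
move=> x0 y0 vxy /(proj_eq u Ddiv x0 y0)[m xE].
have := val_UzM frame U0 vU m y0; rewrite -xE vxy => E.
have /eqP : (m%:~R : rat) = 0 by lra.
by rewrite intr_eq0 => /eqP m0; rewrite xE m0 expr0z scale1r.
Qed.

Lemma proj_torsion x (n : nat) : x != 0 -> v x = 0 -> (proj x ^+ n)%g = 1%g -> x ^+ n = 1.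
Proof.
move=> x0 vx; rewrite -(projX u Ddiv n x0) -(proj1 u Ddiv) => E.
apply: proj_val_eq E; rewrite ?oner_neq0 ?(expD_neq0 Ddiv) //.
by rewrite (valuX Ddiv vP) // vx mulr0 (valu1 vP).
Qed.

(** The preimage of the group generated by F and -1: as -1 is central, each of its elements is in
    the preimage of F up to sign. *)
Definition preimage_pm (F : set (GG D u)) x := x != 0 /\ (F (proj x) \/ F (proj (- x))).

Lemma saturated_preimage F : finite_subgroup F -> saturated (preimage_pm F).
Proof.
move=> finF; have [F1 FM _] := finF.
have FV g : F g -> F g^-1%g by move=> Fg; rewrite -[g^-1%g]mul1g; apply: FM.
have FMM g h : F g -> F h -> F (g * h)%g.
  by move=> Fg Fh; rewrite -[h]invgK; apply: FM => //; apply: FV.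
have N0 x : x != 0 -> - x != 0 by rewrite oppr_eq0.
split.
- by move=> x [].
- by split; [rewrite oner_neq0 | left; rewrite proj1].
- move=> x y [x0 Fx] [y0 Fy]; split; first exact: mulD_neq0.
  have xN := N0 _ x0; have yN := N0 _ y0.
  case: Fx => Fx; case: Fy => Fy.
  + by left; rewrite projM //; apply: FMM.
  + by right; rewrite -mulrN projM //; apply: FMM.
  + by right; rewrite -mulNr projM //; apply: FMM.
  + by left; rewrite -mulrNN projM //; apply: FMM.
- move=> x [x0 Fx]; split; first by rewrite invr_eq0.
  case: Fx => Fx; first by left; rewrite projV //; apply: FV.
  by right; rewrite -invrN projV ?N0 //; apply: FV.
- move=> x [x0 Fx]; split; first exact: N0.
  by rewrite opprK; case: Fx; [right | left].
- have UA : U%:A = U ^ 1 *: 1 :> D by rewrite expr1z.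
  split; first by rewrite UA; apply: (scale_neq0 (Uz0 1)); apply: oner_neq0.
  by left; rewrite UA proj_scale ?oner_neq0 // proj1.
move=> x [x0 Fx] vx; case: Fx => /(finite_subgroup_torsion finF)[n n0 E].
  by exists n => //; apply: proj_torsion.
exists (2 * n)%N; first by rewrite muln_gt0.
have xn : (- x) ^+ n = 1 by apply: proj_torsion; rewrite ?N0 // (valuN Ddiv vP).
by rewrite exprM -sqrrN -exprM mulnC exprM xn expr1n.
Qed.

Lemma span_img C x : (forall y, C y -> y != 0) -> span C x -> img C (proj x).
Proof. by move=> C0 [m [y [Cy ->]]]; exists y; rewrite // proj_scale // C0. Qed.

Lemma conj_into_img F C : (forall y, C y -> y != 0) ->
    conj_into (preimage_pm F) (span C) ->
  exists g, forall f, F f -> img C (f ^ g)%g.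
Proof.
move=> C0 [z z0 H]; exists (proj z) => f Ff; have [x x0 fE] := proj_surj Ddiv f.
have zU := Ddiv z0.
have zxz0 : z^-1 * x * z != 0 by rewrite !mulD_neq0 ?invD_neq0.
rewrite fE -(projJ u Ddiv) //; apply: span_img => //; apply: H.
rewrite !mulrA mulrV // mul1r mulrK //.
by split=> //; left; rewrite -fE.
Qed.

Definition mod_group C :=
  [/\ forall x, C x -> x != 0, C 1,
      forall x y, C x -> C y -> exists m z, C z /\ x * y^-1 = U ^ m *: z
    & exists s : seq D, forall x, C x -> x \in s].

Lemma mod_group_finite C : mod_group C -> finite_subgroup (img C).
Proof.
move=> [C0 C1 CM [s Cs]]; split.
- by exists 1; rewrite ?proj1.
- move=> _ _ [x Cx <-] [y Cy <-]; have x0 := C0 _ Cx; have y0 := C0 _ Cy.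
  have [m [c [Cc E]]] := CM x y Cx Cy.
  by exists c; rewrite // -projV // -projM ?invD_neq0 // E proj_scale // C0.
apply: (@sub_finite_set _ _ [set` [seq proj x | x <- s]]); last exact: finite_seq.
by move=> _ [x /Cs xs <-] /=; apply/mapP; exists x.
Qed.

Lemma mod_group_id C : finite_mult_group C -> mod_group C.
Proof.
move=> [C0 C1 CM CV Cs]; split=> // x y Cx Cy; exists 0, (x * y^-1).
by rewrite expr0z scale1r; split=> //; apply/CM/CV.
Qed.

(** Since r^2 = U z, the inverse of r lies in U^-1 C r, and C with C r is closed under division
    modulo powers of U. *)
Lemma mod_group_ext C r z : finite_mult_group C ->
    r != 0 -> (forall x, C x -> C (r * x * r^-1)) -> C z -> r * r = U *: z ->
  mod_group (ext C r).
Proof.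
move=> [C0 C1 CM CV [s Cs]] r0 Cr Cz rr; have rU := Ddiv r0.
have rx x : r * x = (r * x * r^-1) * r by rewrite mulrVK.
have rV : r^-1 = U ^ (- 1) *: (z^-1 * r).
  have zU := Ddiv (C0 _ Cz).
  apply: (mulIr rU); rewrite mulVr // -scalerAl -mulrA rr -scalerAr mulVr //.
  by rewrite scalerA -exprnN expr1 mulVf ?scale1r //; apply/eqP.
split.
- move=> x [/C0 //|[y [/C0 y0 ->]]]; exact: mulD_neq0.
- by left.
- move=> x1 y1 [Cx|[x [Cx ->]]] [Cy|[y [Cy ->]]];
    [move: x1 y1 Cx Cy => x y Cx Cy | move: x1 Cx => x Cx | move: y1 Cy => y Cy |].
  + by exists 0, (x * y^-1); split; [left; apply/CM/CV | rewrite expr0z scale1r].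
  + have yU := Ddiv (C0 _ Cy).
    exists (- 1), (x * (z^-1 * (r * y^-1 * r^-1)) * r); split.
      by right; eexists; split; last by []; apply/CM/CM/Cr/CV => //; apply: CV.
    by rewrite invrM // -!mulrA mulVr // mulr1 rV -!scalerAl -!scalerAr -mulrA.
  + exists 0, (x * (r * y^-1 * r^-1) * r); rewrite expr0z scale1r; split.
      by right; eexists; split; last by []; apply/CM/Cr/CV.
    by rewrite -!mulrA mulVr // mulr1.
  + have yU := Ddiv (C0 _ Cy).
    exists 0, (x * y^-1); rewrite expr0z scale1r; split; first by left; apply/CM/CV.
    by rewrite invrM // !mulrA mulrK.
exists (s ++ [seq x * r | x <- s]) => x [Cx|[y [Cy ->]]]; rewrite mem_cat.
  by rewrite Cs.
by apply/orP; right; apply/mapP; exists y; rewrite ?Cs.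
Qed.

End Representatives.

Section Orders.

Local Open Scope group_scope.
Variable gT : finGroupType.
Implicit Type a : gT.

Lemma order_eq4 a : a ^+ 4 = 1 -> a ^+ 2 <> 1 -> #[a] = 4%N.
Proof.
move=> a4 a2; have : #[a] \in divisors 4 by rewrite -dvdn_divisors // order_dvdn a4.
rewrite !inE => /or3P[/eqP o|/eqP o|/eqP //]; case: a2.
  by move/eqP: o; rewrite order_eq1 => /eqP->; apply: expg1n.
by have := expg_order a; rewrite o.
Qed.

Lemma order_eq6 a : a ^+ 6 = 1 -> a ^+ 2 <> 1 -> a ^+ 3 <> 1 -> #[a] = 6%N.
Proof.
move=> a6 a2 a3; have : #[a] \in divisors 6 by rewrite -dvdn_divisors // order_dvdn a6.
rewrite !inE => /or4P[/eqP o|/eqP o|/eqP o|/eqP //]; case: a2.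
- by move/eqP: o; rewrite order_eq1 => /eqP->; apply: expg1n.
- by have := expg_order a; rewrite o.
- by case: a3; have := expg_order a; rewrite o.
Qed.

End Orders.

(** * The maximal finite subgroups *)

Section FiniteMultGroups.

Variables (D : falgType Q2) (v : D -> rat) (i j : D).
Hypothesis frame : hamilton_frame v i j.

Let Ddiv : is_division_algebra D. Proof. by case: frame => -[]. Qed.

Local Notation hurw := (hurw i j).
Local Notation T24 := (T24 i j).
Local Notation om := (om i j).
Local Notation C6 := (C6 i j).
Local Notation C4 := (C4 i).
Implicit Types (x y z r : D) (a b c d w : Q2) (m n : int) (P C : D -> Prop).

Lemma T24_group : finite_mult_group T24.
Proof.
split.
- by move=> x Tx; apply: (T24_neq0 frame Tx).
- exact: T24_1.
- by move=> x y Tx Ty; apply: (T24M frame).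
- by move=> x Tx; apply: (T24V frame).
pose s : seq int := [:: -2; -1; 0; 1; 2].
have sP (e f : int) : 0 <= f -> e ^+ 2 + f = 4 -> e \in s.
  move=> f0 ef; have : -2 <= e <= 2 by nia.
  by rewrite !inE; lia.
exists [seq hurw p.1.1 p.1.2 p.2.1 p.2.2 |
   p <- [seq (p1, p2) | p1 <- [seq (e1, e2) | e1 <- s, e2 <- s],
                        p2 <- [seq (e1, e2) | e1 <- s, e2 <- s]]].
move=> x [a [b [c [d [n ->]]]]]; apply/mapP; exists (a, b, (c, d)) => //.
have {n} [sa sb sc sd] : [/\ a \in s, b \in s, c \in s & d \in s].
  by split; [apply: (sP _ (b ^+ 2 + c ^+ 2 + d ^+ 2)) |
    apply: (sP _ (a ^+ 2 + c ^+ 2 + d ^+ 2)) |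
    apply: (sP _ (a ^+ 2 + b ^+ 2 + d ^+ 2)) |
    apply: (sP _ (a ^+ 2 + b ^+ 2 + c ^+ 2))]; rewrite ?addr_ge0 ?sqr_ge0 // -n; ring.
by apply: allpairs_f; apply: allpairs_f.
Qed.

Lemma powers_group C x (n : nat) : (0 < n)%N -> x ^+ n = 1 ->
  (forall y, C y <-> exists k : nat, y = x ^+ k) -> finite_mult_group C.
Proof.
move=> n0 xn CP.
have x0 : x != 0.
  by apply: contra_eq_neq xn => ->; rewrite expr0n gtn_eqF // eq_sym oner_neq0.
have modn_pow (k : nat) : x ^+ k = x ^+ (k %% n)%N.
  by rewrite {1}(divn_eq k n) exprD mulnC exprM xn expr1n mul1r.
split.
- by move=> y /CP[k ->]; apply: expD_neq0.
- by apply/CP; exists 0%N.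
- by move=> y z /CP[k ->] /CP[l ->]; apply/CP; exists (k + l)%N; rewrite exprD.
- move=> y /CP[k ->]; apply/CP; exists (n - k %% n)%N; rewrite modn_pow.
  apply: (mulrI (Ddiv (expD_neq0 Ddiv (k %% n)%N x0))).
  by rewrite mulrV ?Ddiv ?expD_neq0 // -exprD subnKC // ltnW // ltn_mod.
exists [seq x ^+ k | k <- iota 0 n] => y /CP[k ->]; rewrite modn_pow; apply/mapP.
by exists (k %% n)%N; rewrite // mem_iota ltn_mod.
Qed.

Lemma C4_powers y : C4 y <-> exists k : nat, y = i ^+ k.
Proof.
have i2 := i2 frame; have i4 : i ^+ 4 = 1 by rewrite (exprM i 2 2) i2 sqrrN expr1n.
split=> [[] ->|[k ->]].
- by exists 0%N.
- by exists 2%N; rewrite i2.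
- by exists 1%N.
- by exists 3%N; rewrite exprSr i2 mulN1r.
elim: k => [|k IH]; first by rewrite expr0; constructor 1.
rewrite exprS; case: IH => ->.
- by rewrite mulr1; constructor 3.
- by rewrite mulrN1; constructor 4.
- by rewrite -expr2 i2; constructor 2.
- by rewrite mulrN -expr2 i2 opprK; constructor 1.
Qed.

Lemma om6 : (- om) ^+ 6 = 1.
Proof. by rewrite (exprM _ 3 2) exprNn (om3 frame) mulr1 sqrr_sign. Qed.

Lemma C6_powers y : C6 y <-> exists k : nat, y = (- om) ^+ k.
Proof.
have om3 := om3 frame.
have N3 : (- om) ^+ 3 = - 1 by rewrite exprNn om3 mulr1 -signr_odd expr1.
have N2 : (- om) ^+ 2 = om ^+ 2 by rewrite sqrrN.
have N4 : (- om) ^+ 4 = om by rewrite (exprD _ 3 1) N3 expr1 mulrNN mul1r.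
split=> [[z [zE yE]]|[k ->]].
  case: zE yE => -> [] ->.
  - by exists 0%N.
  - by exists 3%N; rewrite N3.
  - by exists 4%N; rewrite N4.
  - by exists 1%N.
  - by exists 2%N; rewrite N2.
  by exists 5%N; rewrite (exprD _ 3 2) N3 N2 mulN1r.
elim: k => [|k [z [zE yE]]]; first by rewrite expr0; exists 1; split; [constructor | left].
rewrite exprS.
have [z' [z'E omz]] : exists z', [\/ z' = 1, z' = om | z' = om ^+ 2] /\ om * z = z'.
  case: zE => ->; first by exists om; split; [constructor 2 | rewrite mulr1].
    by exists (om ^+ 2); split; first constructor 3.
  by exists 1; split; [constructor 1 | rewrite -exprS].
exists z'; split=> //; rewrite -omz.
by case: yE => ->; rewrite ?mulrNN ?mulNr; [right | left].
Qed.

Lemma C4_group : finite_mult_group C4.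
Proof.
apply: (@powers_group _ i 4) => //; last exact: C4_powers.
by rewrite (exprM i 2 2) (i2 frame) sqrrN expr1n.
Qed.

Lemma C6_group : finite_mult_group C6.
Proof. by apply: (@powers_group _ (- om) 6) => //; [exact: om6 | exact: C6_powers]. Qed.

Lemma C6_invert r y : r != 0 -> r * om = om ^+ 2 * r -> C6 y -> C6 (r * y * r^-1).
Proof.
move=> r0 rom; have rU := Ddiv r0; have rom2 := semicommute_om2 frame rom.
case=> z [zE yE].
have [z' [z'E rz]] : exists z', [\/ z' = 1, z' = om | z' = om ^+ 2] /\ r * z = z' * r.
  case: zE => ->; first by exists 1; rewrite mulr1 mul1r; split; first constructor.
    by exists (om ^+ 2); split; first constructor 3.
  by exists om; split; first constructor 2.
exists z'; split=> //.
by case: yE => ->; rewrite ?mulrN ?mulNr rz mulrK //; [left | right].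
Qed.

Lemma C4_invert r y : r != 0 -> r * i = - (i * r) -> C4 y -> C4 (r * y * r^-1).
Proof.
move=> r0 ri; have rU := Ddiv r0.
case=> ->; rewrite ?mulrN ?mulNr ?mulr1 ?ri ?mulNr ?opprK ?mulrK ?mulrV //.
- by constructor 1.
- by constructor 2.
- by constructor 4.
- by constructor 3.
Qed.

End FiniteMultGroups.

(** * Computing in the finite groups through lifts to D *)

Section Lifts.

Variables (D : falgType Q2) (u : unit_group Z2) (v : D -> rat) (i j : D).
Hypothesis frame : hamilton_frame v i j.

Let Ddiv : is_division_algebra D. Proof. by case: frame => -[]. Qed.

Local Notation U := (twou u).
Local Notation proj := (proj u).

Let U0 : U <> 0. Proof. exact: twou_neq0. Qed.
Let vU : v U%:A = 1. Proof. exact: (val_twou u frame). Qed.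

Section Group.

Variable C : D -> Prop.
Hypothesis modC : mod_group u C.

Definition mod_type := subgroup_type (mod_group_finite frame modC).
HB.instance Definition _ := FinGroup.on mod_type.

(** Relations in the finite group are checked on quaternions, up to powers of U; inequalities come
    from valuations. *)
Definition lift (a : mod_type) (x : D) := x != 0 /\ sub_val a = proj x.

Implicit Types (a b : mod_type) (x y : D).

Lemma lift_exists x : C x -> exists a, lift a x.
Proof.
move=> Cx; have [C0 _ _ _] := modC.
have [|a aE] := @sub_val_surj _ _ (mod_group_finite frame modC) (proj x).
  by exists x.
by exists a; split; first exact: C0.
Qed.

Lemma lift_surj a : exists2 x, C x & lift a x.
Proof.
have [C0 _ _ _] := modC; have [x Cx xE] := sub_valP a.
by exists x => //; split; first exact: C0.
Qed.

Lemma lift1 : lift 1%g 1.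
Proof. by split; rewrite ?oner_neq0 // sub_val1 proj1. Qed.

Lemma liftM a b x y : lift a x -> lift b y -> lift (a * b)%g (x * y).
Proof.
move=> [x0 ax] [y0 yb]; split; first exact: mulD_neq0.
by rewrite sub_valM ax yb projM.
Qed.

Lemma liftV a x : lift a x -> lift a^-1%g x^-1.
Proof.
by move=> [x0 ax]; split; [exact: invD_neq0 | rewrite sub_valV ax projV].
Qed.

Lemma liftX a x n : lift a x -> lift (a ^+ n)%g (x ^+ n).
Proof.
by move=> [x0 ax]; split; [exact: expD_neq0 | rewrite sub_valX ax projX].
Qed.

Lemma liftJ a b x y : lift a x -> lift b y -> lift (a ^ b)%g (y^-1 * x * y).
Proof.
move=> ax yb; rewrite conjgE -mulrA.
by apply: liftM; [apply: liftV | apply: liftM].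
Qed.

Lemma lift_eq a b x m : lift a x -> lift b (U ^ m *: x) -> a = b.
Proof.
move=> [x0 ax] [_ bx]; apply: sub_val_inj; rewrite ax bx.
by rewrite (proj_scale u frame).
Qed.

Lemma lift_inj a b x y : lift a x -> lift b y -> a = b -> exists m, x = U ^ m *: y.
Proof.
move=> [x0 ax] [y0 bx] ab.
by apply/(proj_eq u Ddiv x0 y0); rewrite -ax -bx ab.
Qed.

Lemma lift_val_inj a b x y : lift a x -> lift b y -> v x = v y -> a = b -> x = y.
Proof.
move=> [x0 ax] [y0 bx] vxy ab; apply: (proj_val_eq (u := u) frame x0 y0 vxy).
by rewrite -ax -bx ab.
Qed.

Lemma lift_val_neq a b x y (m : int) : lift a x -> lift b y ->
  v x = 2%:R^-1 + m%:~R -> v y = 0 -> a <> b.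
Proof.
move=> ax bx vx vy /(lift_inj ax bx)[n xE].
have [y0 _] := bx.
have := val_UzM frame U0 vU n y0; rewrite -xE vx vy addr0 => E.
apply: (@half_not_int (n - m)); rewrite rmorphB /= -E; ring.
Qed.

Lemma lift_uniq a b x : lift a x -> lift b x -> a = b.
Proof. by move=> ax bx; apply: (@lift_eq a b x 0); rewrite ?expr0z ?scale1r. Qed.

End Group.

End Lifts.

(** * The groups generated by a root of unity and r *)

Section Classes.

Variables (D : falgType Q2) (u : unit_group Z2) (v : D -> rat) (i j : D).
Hypothesis frame : hamilton_frame v i j.

Let Ddiv : is_division_algebra D. Proof. by case: frame => -[]. Qed.
Let vP : extends_Q2_val v. Proof. by case: frame => -[]. Qed.

Local Notation U := (twou u).
Local Notation om := (om i j).
Local Notation C6 := (C6 i j).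
Local Notation C4 := (C4 i).
Local Notation img := (@img D u).

Implicit Types (x y z r : D).

Let U0 : U <> 0. Proof. exact: twou_neq0. Qed.
Let vU : v U%:A = 1. Proof. exact: (val_twou u frame). Qed.

Let C6_val x : C6 x -> v x = 0.
Proof. by move=> Cx; apply: (T24_val frame); apply: (C6_T24 frame). Qed.

Let C4_val x : C4 x -> v x = 0.
Proof. by move=> Cx; apply: (T24_val frame); apply: C4_T24. Qed.

Let om0 : om != 0. Proof. exact: (T24_neq0 frame (T24_om i j)). Qed.
Let i0 : i != 0. Proof. exact: (T24_neq0 frame (T24_i i j)). Qed.

Let C6_om : C6 om. Proof. by exists om; split; [constructor 2 | left]. Qed.
Let C6_Nom : C6 (- om). Proof. by exists om; split; [constructor 2 | right]. Qed.
Let C6_1 : C6 1. Proof. by exists 1; split; [constructor 1 | left]. Qed.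
Let C6_N1 : C6 (- 1). Proof. by exists 1; split; [constructor 1 | right]. Qed.
Let C4_i : C4 i. Proof. by constructor 3. Qed.
Let C4_1 : C4 1. Proof. by constructor 1. Qed.
Let C4_N1 : C4 (- 1). Proof. by constructor 2. Qed.

Lemma sqr_eq_neq0 r : (r * r = U%:A \/ r * r = - U%:A) -> r != 0.
Proof.
move=> rr; apply/eqP => r0; move: rr; rewrite r0 mul0r => -[] /esym/eqP.
  by apply/negP/scalar_neq0/eqP.
by rewrite oppr_eq0; apply/negP/scalar_neq0/eqP.
Qed.

Let scaleU_N1 : - U%:A = U *: (- 1) :> D. Proof. by rewrite scalerN. Qed.

Lemma mod_group_C6 r : r * om = om ^+ 2 * r -> (r * r = U%:A \/ r * r = - U%:A) ->
  mod_group u (ext C6 r).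
Proof.
move=> rom rr; have r0 := sqr_eq_neq0 rr.
have Cr x : C6 x -> C6 (r * x * r^-1) by apply: (C6_invert frame).
case: rr => rr.
  exact: (mod_group_ext frame (C6_group frame) r0 Cr C6_1).
by apply: (mod_group_ext frame (C6_group frame) r0 Cr C6_N1); rewrite rr scaleU_N1.
Qed.

Lemma mod_group_C4 r : r * i = - (i * r) -> (r * r = U%:A \/ r * r = - U%:A) ->
  mod_group u (ext C4 r).
Proof.
move=> ri rr; have r0 := sqr_eq_neq0 rr.
have Cr x : C4 x -> C4 (r * x * r^-1) by apply: (C4_invert frame).
case: rr => rr.
  exact: (mod_group_ext frame (C4_group frame) r0 Cr C4_1).
by apply: (mod_group_ext frame (C4_group frame) r0 Cr C4_N1); rewrite rr scaleU_N1.
Qed.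

Lemma val_sqr r : (r * r = U%:A \/ r * r = - U%:A) -> v r = 2%:R^-1.
Proof.
move=> rr; have r0 := sqr_eq_neq0 rr.
have : v (r * r) = 1 by case: rr => ->; rewrite ?(valuN Ddiv vP).
by rewrite (valuM vP) //; lra.
Qed.

Let conj_om r : r != 0 -> r * om = om ^+ 2 * r -> r^-1 * om * r = om^-1.
Proof.
move=> r0 rom; have rU := Ddiv r0.
have -> : om^-1 = om ^+ 2.
  by apply: (mulrI (Ddiv om0)); rewrite mulrV ?Ddiv // -exprS (om3 frame).
by rewrite -mulrA -(semicommute_om2 frame rom) mulKr.
Qed.

Let not_power C (modC : mod_group u C) (a x : mod_type frame modC) y r :
  lift a y -> v y = 0 -> lift x r -> v r = 2%:R^-1 -> x \notin <[a]>%g.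
Proof.
move=> ay vy xr vr; apply/negP => /cycleP[k xE].
have [y0 _] := ay.
apply: (lift_val_neq (m := 0) xr (liftX k ay)) xE; first by rewrite addr0.
by rewrite (valuX Ddiv vP) // vy mulr0.
Qed.

(** r^2 = 2u makes the class of r an involution, which inverts the class of -om, of order 6. *)
Lemma in_class_C6_C2 r : r * om = om ^+ 2 * r -> r * r = U%:A ->
  in_class (img (ext C6 r)) is_C6_C2.
Proof.
move=> rom rr; have modC := mod_group_C6 rom (or_introl rr).
have vr := val_sqr (or_introl rr); have r0 := sqr_eq_neq0 (or_introl rr).
apply: (in_class_sub (finF := mod_group_finite frame modC)).
have [a ax] := lift_exists frame modC (or_introl C6_Nom).
have [x xr] : exists x : mod_type frame modC, lift x r.
  by apply: lift_exists; right; exists 1; rewrite mul1r.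
have l1 := lift1 frame modC.
have vo : v (- om) = 0 by apply: C6_val.
have No0 : - om != 0 by rewrite oppr_eq0.
have X0 k : v ((- om) ^+ k) = 0 by rewrite (valuX Ddiv vP) // vo mulr0.
apply: (@C6_C2_of_generators _ a x).
- apply: order_eq6.
  + by apply: lift_uniq (liftX 6 ax) _; rewrite (om6 frame).
  + move=> /(lift_val_inj (liftX 2 ax) l1); rewrite X0 (valu1 vP) => /(_ erefl).
    rewrite sqrrN => E; apply: (om_neq_om2 frame).
    by have := om3 frame; rewrite exprS E mulr1.
  + move=> /(lift_val_inj (liftX 3 ax) l1); rewrite X0 (valu1 vP) => /(_ erefl).
    by rewrite exprNn (om3 frame) mulr1 -signr_odd expr1 => /esym/(one_neqN1 frame).
- apply: esym; apply: (lift_eq (m := 1) l1); rewrite expr1z -rr -expr2.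
  exact: liftX.
- exact: not_power ax vo xr vr.
- apply: lift_uniq (liftJ ax xr) _; rewrite mulrN mulNr conj_om // -invrN.
  exact: liftV.
move=> z; have [w Cw zw] := lift_surj z.
case: Cw zw => [/(C6_powers frame)[k ->] zw|[y [/(C6_powers frame)[k ->] ->] zw]].
  by exists k, 0%N; rewrite expg0 mulg1; apply: lift_uniq zw (liftX k ax).
exists k, 1%N; apply: lift_uniq zw _; rewrite expg1.
by apply: liftM xr; apply: liftX.
Qed.

(** Now r^2 is the class of -1, so r has order 4 and its cyclic group contains -1; the normal factor
    is generated by om instead of -om. *)
Lemma in_class_C3_C4 r : r * om = om ^+ 2 * r -> r * r = - U%:A ->
  in_class (img (ext C6 r)) is_C3_C4.
Proof.
move=> rom rr; have modC := mod_group_C6 rom (or_intror rr).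
have vr := val_sqr (or_intror rr); have r0 := sqr_eq_neq0 (or_intror rr).
apply: (in_class_sub (finF := mod_group_finite frame modC)).
have [a ax] := lift_exists frame modC (or_introl C6_om).
have [x xr] : exists x : mod_type frame modC, lift x r.
  by apply: lift_exists; right; exists 1; rewrite mul1r.
have [m m1] := lift_exists frame modC (or_introl C6_N1).
have l1 := lift1 frame modC.
have x2 : (x ^+ 2)%g = m.
  apply/esym; apply: (lift_eq (m := 1) m1); rewrite expr1z -scaleU_N1 -rr -expr2.
  exact: liftX.
have m2 : (m ^+ 2)%g = 1%g.
  by apply: lift_uniq (liftX 2 m1) _; rewrite sqrrN expr1n.
apply: (@C3_C4_of_generators _ a x).
- apply: nt_prime_order => //.
    by apply: lift_uniq (liftX 3 ax) _; rewrite (om3 frame).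
  apply/eqP => /(lift_val_inj ax l1); rewrite C6_val // (valu1 vP) => /(_ erefl) E.
  by apply: (om_neq_om2 frame); rewrite E expr1n.
- apply: order_eq4; first by rewrite (expgM x 2 2) x2.
  rewrite x2 => /(lift_val_inj m1 l1); rewrite C6_val // (valu1 vP) => /(_ erefl).
  by move/esym/(one_neqN1 frame).
- apply: lift_uniq (liftJ ax xr) _; rewrite conj_om //.
  exact: liftV.
have C6E w : C6 w -> exists k e : nat, w = om ^+ k * (- 1) ^+ e.
  case=> y [yE wE].
  have [k yk] : exists k : nat, y = om ^+ k.
    by case: yE => ->; [exists 0%N | exists 1%N | exists 2%N].
  by case: wE => ->; exists k; [exists 0%N | exists 1%N]; rewrite ?mulr1 ?mulrN1 yk.
move=> z; have [w Cw zw] := lift_surj z.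
case: Cw zw => [/C6E[k [e ->]]|[y [/C6E[k [e ->]] ->]]] zw.
  exists k, (2 * e)%N; rewrite expgM x2.
  by apply: lift_uniq zw _; apply: liftM; apply: liftX.
exists k, (2 * e + 1)%N; rewrite expgnDr expgM x2 mulgA expg1.
by apply: lift_uniq zw _; apply: liftM xr; apply: liftM; apply: liftX.
Qed.

Let conj_i y : y != 0 -> y * i = - (i * y) -> y^-1 * i * y = i^-1.
Proof.
move=> y0 yi; have yU := Ddiv y0.
have -> : i^-1 = - i.
  by apply: (mulrI (Ddiv i0)); rewrite mulrV ?Ddiv // mulrN -expr2 (i2 frame) opprK.
by rewrite -mulrA; apply: (mulrI yU); rewrite mulVKr // mulrN yi opprK.
Qed.

Section Order8.

Variable y : D.
Hypothesis yi : y * i = - (i * y).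
Hypothesis yy : y * y = U%:A \/ y * y = - U%:A.

Let modC : mod_group u (ext C4 y) := mod_group_C4 yi yy.

Let generators : exists a x : mod_type frame modC,
  [/\ lift a i /\ lift x y, #[a]%g = 4%N, x \notin <[a]>%g, a ^ x = a^-1
    & forall z : mod_type frame modC, exists m n, z = a ^+ m * x ^+ n]%g.
Proof.
have vy := val_sqr yy; have y0 := sqr_eq_neq0 yy.
have [a ai] := lift_exists frame modC (or_introl C4_i).
have [x xy] : exists x : mod_type frame modC, lift x y.
  by apply: lift_exists; right; exists 1; rewrite mul1r.
have l1 := lift1 frame modC.
exists a, x; split=> //.
- apply: order_eq4.
    by apply: lift_uniq (liftX 4 ai) _; rewrite (exprM i 2 2) (i2 frame) sqrrN expr1n.
  move=> /(lift_val_inj (liftX 2 ai) l1).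
  rewrite (i2 frame) (valuN Ddiv vP) ?oner_neq0 // => /(_ erefl) E.
  exact: (one_neqN1 frame (esym E)).
- exact: not_power ai (C4_val C4_i) xy vy.
- by apply: lift_uniq (liftJ ai xy) _; rewrite conj_i //; apply: liftV.
move=> z; have [w Cw zw] := lift_surj z.
case: Cw zw => [/(C4_powers frame)[k ->]|[s [/(C4_powers frame)[k ->] ->]]] zw.
  by exists k, 0%N; rewrite expg0 mulg1; apply: lift_uniq zw (liftX k ai).
exists k, 1%N; apply: lift_uniq zw _; rewrite expg1.
by apply: liftM xy; apply: liftX.
Qed.

Lemma in_class_D8 : y * y = U%:A -> in_class (img (ext C4 y)) is_D8.
Proof.
move=> y2; have [a [x [[ai xy] oa xa ax gen]]] := generators.
apply: (in_class_sub (finF := mod_group_finite frame modC)).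
apply: (@D8_of_generators _ a x) => //.
apply/esym/(lift_eq (m := 1) (lift1 frame modC)); rewrite expr1z -y2 -expr2.
exact: liftX.
Qed.

Lemma in_class_Q8 : y * y = - U%:A -> in_class (img (ext C4 y)) is_Q8.
Proof.
move=> y2; have [a [x [[ai xy] oa xa ax gen]]] := generators.
apply: (in_class_sub (finF := mod_group_finite frame modC)).
apply: (@Q8_of_generators _ [set: _]%G a x) => //; last exact: gen2_setT.
apply/esym/(lift_eq (m := 1) (liftX 2 ai)).
rewrite expr1z (i2 frame) -scaleU_N1 -y2 -expr2.
exact: liftX.
Qed.

End Order8.

End Classes.

(** * Generators of the Hurwitz units, and conjugation by 1 + i *)

Section Tetrahedral.

Variables (D : falgType Q2) (v : D -> rat) (i j : D).
Hypothesis frame : hamilton_frame v i j.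

Let Ddiv : is_division_algebra D. Proof. by case: frame => -[]. Qed.

Local Notation hurw := (hurw i j).
Local Notation T24 := (T24 i j).
Local Notation om := (om i j).
Local Notation i1 := (i1 i).

Let neg_half (a : int) : (- a)%:~R / 2%:R = - (a%:~R / 2%:R) :> Q2.
Proof. by rewrite rmorphN mulNr. Qed.

Let mul_i a b c d : i * hurw a b c d = hurw (- b) a (- d) c.
Proof.
rewrite /hurw !neg_half; have := qM frame 0 1 0 0; rewrite -(q_i i j) => ->.
by congr qmk; ring.
Qed.

Let mul_j a b c d : j * hurw a b c d = hurw (- c) d a (- b).
Proof.
rewrite /hurw !neg_half; have := qM frame 0 0 1 0; rewrite -(q_j i j) => ->.
by congr qmk; ring.
Qed.

Let mul_k a b c d : i * j * hurw a b c d = hurw (- d) (- c) b a.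
Proof. by rewrite -mulrA mul_j mul_i opprK. Qed.

Let h1 : hurw 2 0 0 0 = 1.
Proof. by have := hurw2 i j 1 0 0 0; rewrite (q1 i j). Qed.
Let hi : hurw 0 2 0 0 = i.
Proof. by have := hurw2 i j 0 1 0 0; rewrite -(q_i i j). Qed.
Let hj : hurw 0 0 2 0 = j.
Proof. by have := hurw2 i j 0 0 1 0; rewrite -(q_j i j). Qed.
Let hk : hurw 0 0 0 2 = i * j.
Proof. by have := hurw2 i j 0 0 0 1; rewrite -(qmk_ij i j). Qed.

(** i, j and om generate T24 under multiplication: -1 = i^2, and up to sign every half-odd unit is
    an element of Q_8 times om or om^2. *)
Lemma T24_ind (P : D -> Prop) : P i -> P j -> P om ->
    (forall x y, P x -> P y -> P (x * y)) -> forall x, T24 x -> P x.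
Proof.
move=> Pi Pj Po PM.
have PN x : P x -> P (- x).
  by move=> Px; rewrite -mulN1r -(i2 frame) expr2; apply/PM/Px/PM.
have P1 : P 1 by rewrite -[1]opprK -(i2 frame) expr2; apply/PN/PM.
have Pk : P (i * j) by apply: PM.
have Po2 : P (om ^+ 2) by rewrite expr2; apply: PM.
have sqr1 (e : int) : e ^+ 2 = 1 -> e = 1 \/ e = - 1.
  by move/eqP; rewrite sqrf_eq1 => /orP[]/eqP; [left | right].
have sqr4 (e : int) : e ^+ 2 = 4 -> e = 2 \/ e = - 2.
  have -> : (4 : int) = 2 ^+ 2 by [].
  by move/eqP; rewrite eqf_sqr => /orP[]/eqP; [left | right].
have PN' a b c d : P (hurw (- a) (- b) (- c) (- d)) -> P (hurw a b c d).
  by move=> /PN; rewrite hurwN !opprK.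
have om2 := om2E frame.
have odd b c d : b ^+ 2 = 1 -> c ^+ 2 = 1 -> d ^+ 2 = 1 -> P (hurw (- 1) b c d).
  move=> /sqr1[] -> /sqr1[] -> /sqr1[] ->.
  - exact: Po.
  - suff -> : hurw (- 1) 1 1 (- 1) = - (j * om ^+ 2) by apply/PN/PM.
    by rewrite om2 mul_j hurwN.
  - suff -> : hurw (- 1) 1 (- 1) 1 = - (i * om ^+ 2) by apply/PN/PM.
    by rewrite om2 mul_i hurwN.
  - suff -> : hurw (- 1) 1 (- 1) (- 1) = j * om by apply/PM.
    by rewrite mul_j.
  - suff -> : hurw (- 1) (- 1) 1 1 = - (i * j * om ^+ 2) by apply/PN/PM.
    by rewrite om2 mul_k hurwN.
  - suff -> : hurw (- 1) (- 1) 1 (- 1) = i * j * om by apply/PM.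
    by rewrite mul_k.
  - suff -> : hurw (- 1) (- 1) (- 1) 1 = i * om by apply/PM.
    by rewrite mul_i.
  - by rewrite -om2.
move=> x [a [b [c [d [n ->]]]]].
have [[/sqr1[] -> b1 c1 d1]|[]] := four_squares n.
- by apply: PN'; apply: odd; rewrite ?sqrrN.
- exact: odd.
- case=> /sqr4[] -> -> -> ->; first by rewrite h1.
  by apply: PN'; rewrite opprK oppr0 h1.
- case=> -> /sqr4[] -> -> ->; first by rewrite hi.
  by apply: PN'; rewrite opprK oppr0 hi.
- case=> -> -> /sqr4[] -> ->; first by rewrite hj.
  by apply: PN'; rewrite opprK oppr0 hj.
case=> -> -> -> /sqr4[] ->; first by rewrite hk.
by apply: PN'; rewrite opprK oppr0 hk.
Qed.

Lemma i_om : i * om = om * j.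
Proof.
rewrite mul_i; have : om * hurw 0 0 2 0 = hurw (-1) (-1) (-1) 1.
  exact: (hurwM frame).
by rewrite hj.
Qed.

Lemma j_om : j * om = om * (i * j).
Proof.
rewrite mul_j; have : om * hurw 0 0 0 2 = hurw (-1) 1 (-1) (-1).
  exact: (hurwM frame).
by rewrite hk.
Qed.

Lemma i1_neq0 : i1 != 0.
Proof.
rewrite (i1E i j); apply/eqP => /(q_eq0 frame)[/eqP]; by rewrite oner_eq0.
Qed.

Lemma T24_conj_i1 x : T24 x -> T24 (i1 * x * i1^-1).
Proof.
have i1U := Ddiv i1_neq0; move: x; apply: T24_ind.
- have -> : i1 * i = i * i1 by rewrite /i1 mulrDl mulrDr mul1r mulr1.
  by rewrite mulrK //; apply: T24_i.
- have -> : i1 * j = (i * j) * i1.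
    rewrite /i1 mulrDl mulrDr mul1r mulr1 addrC -mulrA (ji_anti frame) mulrN mulrA.
    by rewrite -expr2 (i2 frame) mulN1r opprK.
  by rewrite mulrK //; apply: (T24M frame); [apply: T24_i | apply: T24_j].
- have -> : i1 * om = hurw (- 1) 1 (- 1) 1 * i1.
    rewrite (i1E i j) /hurw !(qM frame).
    by congr qmk; ring.
  by rewrite mulrK //; apply: T24_q.
move=> x y Tx Ty; have -> : i1 * (x * y) * i1^-1 = (i1 * x * i1^-1) * (i1 * y * i1^-1).
  by rewrite !mulrA mulrVK.
exact: (T24M frame).
Qed.

Lemma i1_sqr : i1 * i1 = 2%:R *: i.
Proof.
by rewrite (i1E i j) (qM frame) {2}(q_i i j) qmkZ; congr qmk; ring.
Qed.

End Tetrahedral.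

(** * Identification of T24, O48 and the split extension of T24 *)

Section TetrahedralClasses.

Variables (D : falgType Q2) (u : unit_group Z2) (v : D -> rat) (i j : D).
Hypothesis frame : hamilton_frame v i j.

Let Ddiv : is_division_algebra D. Proof. by case: frame => -[]. Qed.
Let vP : extends_Q2_val v. Proof. by case: frame => -[]. Qed.

Local Notation U := (twou u).
Local Notation q := (qmk i j).
Local Notation hurw := (hurw i j).
Local Notation T24 := (T24 i j).
Local Notation om := (om i j).
Local Notation i1 := (i1 i).
Local Notation img := (@img D u).

Implicit Types (x y z r : D).

Let U0 : U <> 0. Proof. exact: twou_neq0. Qed.
Let vU : v U%:A = 1. Proof. exact: (val_twou u frame). Qed.

Section TetrahedralSubgroup.

Variable C : D -> Prop.
Hypothesis modC : mod_group u C.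

Let gT := mod_type frame modC.

(** Set up for a general [C], so as to give the whole group when [C] is T24 and the subgroup of
    index 2 in the octahedral case. *)
Definition T24_part : {set gT} :=
  [set a : gT | `[< exists2 x, T24 x & lift a x >]]%SET.

Fact T24_part_group : group_set T24_part.
Proof.
apply/group_setP; split.
  by rewrite !inE; exists 1; [exact: T24_1 | exact: lift1].
move=> a b; rewrite !inE => -[x Tx ax] [y Ty bx].
exists (x * y).
by apply: (T24M frame).
by apply: liftM.
Qed.

Canonical T24_partG := Group T24_part_group.

Lemma T24_partP a : reflect (exists2 x, T24 x & lift a x) (a \in T24_partG).
Proof. by apply: (iffP idP); rewrite !inE. Qed.

Lemma T24_part_order (a : gT) x : lift a x -> T24 x -> x ^+ 2 = - 1 -> #[a]%g = 4%N.
Proof.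
move=> ax Tx x2; have l1 := lift1 frame modC.
apply: order_eq4.
  by apply: lift_uniq (liftX 4 ax) _; rewrite (exprM x 2 2) x2 sqrrN expr1n.
move=> /(lift_val_inj (liftX 2 ax) l1).
rewrite x2 (valuN Ddiv vP) ?oner_neq0 // => /(_ erefl) E.
exact: (one_neqN1 frame (esym E)).
Qed.

Variables (a b w : gT).
Hypotheses (ai : lift a i) (bj : lift b j) (wo : lift w om).

Let Ti : T24 i. Proof. exact: T24_i. Qed.
Let Tj : T24 j. Proof. exact: T24_j. Qed.
Let To : T24 om. Proof. exact: T24_om. Qed.
Let To0 : om != 0. Proof. exact: (T24_neq0 frame To). Qed.

Lemma T24_part_ind (H : {group gT}) : a \in H -> b \in H -> w \in H ->
  T24_partG \subset H.
Proof.
move=> Ha Hb Hw; apply/fintype.subsetP => c /T24_partP[x Tx cx].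
suff [c' Hc' c'x] : exists2 c', c' \in H & lift c' x.
  by rewrite (lift_uniq cx c'x).
move: x Tx {c cx}; apply: (T24_ind frame); [by exists a | by exists b | by exists w |].
move=> x y [c Hc cx] [c' Hc' c'y].
by exists (c * c')%g; [apply: groupM | apply: liftM].
Qed.

Lemma conj_a_w : (a ^ w = b)%g.
Proof.
apply: lift_uniq (liftJ ai wo) _.
by rewrite -mulrA (i_om frame) mulKr ?Ddiv.
Qed.

Lemma conj_b_w : (b ^ w = a * b)%g.
Proof.
apply: lift_uniq (liftJ bj wo) _.
by rewrite -mulrA (j_om frame) mulKr ?Ddiv //; apply: liftM.
Qed.

Let ab : (a ^ b = a^-1)%g.
Proof.
apply: lift_uniq (liftJ ai bj) _; have jU := Ddiv (T24_neq0 frame Tj).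
have -> : j^-1 * i * j = i^-1; last exact: liftV.
have -> : i^-1 = - i.
  apply: (mulrI (Ddiv (T24_neq0 frame Ti))).
  by rewrite mulrV ?Ddiv ?(T24_neq0 frame Ti) // mulrN -expr2 (i2 frame) opprK.
by rewrite -mulrA; apply: (mulrI jU); rewrite mulVKr // mulrN (ji_anti frame) opprK.
Qed.

Lemma is_T24_part : is_T24 T24_partG.
Proof.
have l1 := lift1 frame modC.
have w3 : (w ^+ 3 = 1)%g by apply: lift_uniq (liftX 3 wo) _; rewrite (om3 frame).
have w1 : w != 1%g.
  apply/eqP => /(lift_val_inj wo l1); rewrite (T24_val frame To) (valu1 vP) => /(_ erefl) E.
  by apply: (om_neq_om2 frame); rewrite E expr1n.
have iN k : i ^+ k <> j.
  move=> E; have : q 0 0 1 0 * i = i * q 0 0 1 0 by rewrite -(q_j i j) -E -exprS -exprSr.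
  by move=> /(commute_i frame)[/eqP]; rewrite oner_eq0.
pose Q := (<[a]> <*> <[b]>)%G.
have wN : w \in 'N(Q)%g.
  rewrite inE /= conjYg -!cycleJ conj_a_w conj_b_w join_subG !cycle_subG.
  have Qa : a \in Q by rewrite mem_gen // inE cycle_id.
  have Qb : b \in Q by rewrite mem_gen // inE cycle_id orbT.
  by rewrite Qb groupM.
apply: (@T24_of_generators _ _ Q a w) => //.
- apply: (@Q8_of_generators _ _ a b) => //.
  + exact: T24_part_order ai Ti (i2 frame).
  + apply: lift_uniq (liftX 2 bj) _; rewrite (j2 frame) -(i2 frame).
    exact: liftX.
  + apply/negP => /cycleP[k bE]; apply: (iN k).
    apply: (lift_val_inj (liftX k ai) bj) (esym bE).
    rewrite (T24_val frame Tj) (valuX Ddiv vP) ?(T24_neq0 frame Ti) //.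
    by rewrite (T24_val frame Ti) mulr0.
- by rewrite mem_gen // inE cycle_id.
- exact: nt_prime_order.
- rewrite conj_a_w; apply/eqP => /(lift_val_inj bj ai).
  rewrite (T24_val frame Ti) (T24_val frame Tj) => /(_ erefl) E.
  by apply: (iN 1%N); rewrite E.
rewrite -norm_joinEr ?cycle_subG //; apply/eqP; rewrite finset.eqEsubset; apply/andP; split.
  apply: (T24_part_ind (H := (Q <*> <[w]>)%G)).
  - by rewrite mem_gen // inE mem_gen // inE cycle_id.
  - by rewrite mem_gen // inE mem_gen // inE cycle_id orbT.
  - by rewrite mem_gen // inE cycle_id orbT.
rewrite !join_subG !cycle_subG.
by apply/andP; split; [apply/andP; split |]; apply/T24_partP;
  [exists i | exists j | exists om].
Qed.

End TetrahedralSubgroup.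

Lemma mod_group_T24 : mod_group u T24.
Proof. exact: mod_group_id (T24_group frame). Qed.

Lemma in_class_T24 : in_class (img T24) is_T24.
Proof.
have modC := mod_group_T24.
apply: (in_class_sub (finF := mod_group_finite frame modC)).
have [a ai] := lift_exists frame modC (T24_i i j).
have [b bj] := lift_exists frame modC (T24_j i j).
have [w wo] := lift_exists frame modC (T24_om i j).
suff -> : [set: mod_type frame modC]%SET = T24_partG modC by apply: is_T24_part ai bj wo.
apply/setP => c; rewrite finset.in_setT; apply/esym/T24_partP.
by have [x Tx cx] := lift_surj c; exists x.
Qed.

Section Octahedral.

Variable w : Q2.
Hypothesis wU : half_unit_square U w.

Let e := w *: i1.

Let w0 : w <> 0.
Proof.
by move=> w0; case: wU; rewrite w0 expr0n mulr0 ?oppr0.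
Qed.

Let i1_0 : i1 != 0. Proof. exact: (i1_neq0 frame). Qed.

Lemma oct_neq0 : e != 0.
Proof. by apply: scale_neq0 i1_0; apply/eqP. Qed.

Let e_sqr : exists2 z, e * e = U *: z & z = i \/ z = - i.
Proof.
have ee : e * e = (2%:R * w ^+ 2) *: i.
  by rewrite -scalerAl -scalerAr scalerA (i1_sqr frame) scalerA -expr2 mulrC.
rewrite ee; case: wU => ->; first by exists i; [|left].
by exists (- i); [rewrite scalerN scaleNr opprK | right].
Qed.

Let T24_conj x : T24 x -> T24 (e * x * e^-1).
Proof.
move=> Tx; suff -> : e * x * e^-1 = i1 * x * i1^-1 by apply: (T24_conj_i1 frame).
have eU := Ddiv oct_neq0; have i1U := Ddiv i1_0.
apply: (mulIr eU); rewrite mulrVK // /e -scalerAl -scalerAr.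
by rewrite mulrVK.
Qed.

Lemma mod_group_oct : mod_group u (ext T24 e).
Proof.
have [z ee zE] := e_sqr; have Tz : T24 z.
  by case: zE => ->; [apply: T24_i | apply/T24N/T24_i].
exact: (mod_group_ext frame (T24_group frame) oct_neq0 T24_conj Tz ee).
Qed.

Let modE := mod_group_oct.

Lemma val_oct : v e = 2%:R^-1.
Proof.
have [z ee zE] := e_sqr; have e0 := oct_neq0.
have vz : v z = 0.
  by apply: (T24_val frame); case: zE => ->; [apply: T24_i | apply/T24N/T24_i].
have z0 : z != 0 by apply: contra_eq_neq ee => ->; rewrite scaler0 mulD_neq0.
have : v (e * e) = 1 by rewrite ee -[U]expr1z (val_UzM frame U0 vU) // vz addr0.
by rewrite (valuM vP) //; lra.
Qed.

Let gT := mod_type frame modE.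

Let T24E x : T24 x -> ext T24 e x. Proof. by left. Qed.

Let val_TE x : T24 x -> v (x * e) = 2%:R^-1.
Proof.
move=> Tx; rewrite (valuM vP) ?oct_neq0 ?(T24_neq0 frame) //.
by rewrite (T24_val frame Tx) val_oct add0r.
Qed.

Let notin_part (a : gT) x : T24 x -> lift a (x * e) -> a \notin T24_partG modE.
Proof.
move=> Tx ax; apply/negP => /T24_partP[y Ty ay].
apply: (lift_val_neq (m := 0) ax ay) => //; last exact: (T24_val frame).
by rewrite val_TE // addr0.
Qed.

Lemma card_oct : (48 <= #|[set: gT]|)%N.
Proof.
have [a ai] := lift_exists frame modE (T24E (T24_i i j)).
have [b bj] := lift_exists frame modE (T24E (T24_j i j)).
have [o oo] := lift_exists frame modE (T24E (T24_om i j)).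
have [c ce] : exists c : gT, lift c e.
  by apply: lift_exists; right; exists 1; rewrite mul1r; split; first exact: T24_1.
have cK : c \notin T24_partG modE.
  by apply: (notin_part (T24_1 i j)); rewrite mul1r.
have := @card_gt_of_notin _ (T24_partG modE) [set: gT]%G c.
rewrite (card_T24 (is_T24_part ai bj oo)) /= finset.subsetT finset.in_setT cK.
by move=> /(_ erefl erefl erefl).
Qed.

(** The generators are c = w (1 + i), h = -om^2 = (1 + i + j + ij)/2 and h c, which is w (i + j).
    Modulo 2u = 2 w^2, the elements c^4, h^3 and (h c)^2 are all the class of -1; i = c^2, om = h^2
    and j = om^-1 i om are then generated. *)
Lemma is_O48_oct : U = 2%:R * w ^+ 2 -> is_O48 [set: gT].
Proof.
move=> UE.
have [a ai] := lift_exists frame modE (T24E (T24_i i j)).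
have [b bj] := lift_exists frame modE (T24E (T24_j i j)).
have [o oo] := lift_exists frame modE (T24E (T24_om i j)).
have l1 := lift1 frame modE.
have TN1 : T24 (- 1) by apply/T24N/T24_1.
have [m m1] := lift_exists frame modE (T24E TN1).
have [c ce] : exists c : gT, lift c e.
  by apply: lift_exists; right; exists 1; rewrite mul1r; split; first exact: T24_1.
have Th : T24 (- om ^+ 2) by apply: T24N; rewrite expr2; apply: (T24M frame); apply: T24_om.
have [h hh] := lift_exists frame modE (T24E Th).
have ee : e * e = U *: i.
  by rewrite -scalerAl -scalerAr scalerA (i1_sqr frame) scalerA -expr2 mulrC UE.
have c2 : (c ^+ 2 = a)%g.
  by apply/esym; apply: (lift_eq (m := 1) ai); rewrite expr1z -ee -expr2; apply: liftX.
have c4 : (c ^+ 4 = m)%g.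
  rewrite (expgM c 2 2) c2; apply: lift_uniq (liftX 2 ai) _; by rewrite (i2 frame).
have om3 := om3 frame.
have h2 : (h ^+ 2 = o)%g.
  by apply: lift_uniq (liftX 2 hh) _; rewrite sqrrN -exprM (exprD _ 3 1) om3 mul1r.
have h3 : (h ^+ 3 = m)%g.
  apply: lift_uniq (liftX 3 hh) _.
  by rewrite exprNn -exprM (exprM om 3 2) om3 expr1n mulr1 -signr_odd expr1.
have hE : - om ^+ 2 = q 2%:R^-1 2%:R^-1 2%:R^-1 2%:R^-1.
  by rewrite (om2E frame) hurwN !opprK /hurw !mul1r.
have half2 : 2%:R^-1 + 2%:R^-1 = 1 :> Q2.
  by rewrite -mulr2n -(mulr_natl 2%:R^-1) divff //; exact: Q2_two_neq0.
have hc2 : ((h * c) ^+ 2 = m)%g.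
  apply/esym; apply: (lift_eq (m := 1) m1).
  suff <- : (- om ^+ 2 * e) ^+ 2 = U ^ 1 *: - 1 by apply: liftX; apply: liftM.
  rewrite hE expr1z scalerN UE /e (i1E i j) -scalerAr exprZn (qM frame).
  rewrite !mulr1 !mulr0 !subr0 !addr0 !add0r subrr half2.
  rewrite (qX2 frame) (q_const i j) qmkZ qmkN; congr qmk; ring.
apply: (@O48_of_generators _ (h * c)%g h c).
- by rewrite hc2 c4.
- by rewrite h3 c4.
- by rewrite -mulgA -expg2 hc2 c4.
- apply/eqP; rewrite eq_sym finset.eqEsubset finset.subsetT /=.
  pose H := (<[h * c]> <*> <[h]> <*> <[c]>)%G.
  suff: [set: gT]%SET \subset H by [].
  have Hc : c \in H by rewrite mem_gen // inE cycle_id orbT.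
  have Hh : h \in H by rewrite mem_gen // inE mem_gen // inE cycle_id orbT.
  have Ho : o \in H by rewrite -h2 groupX.
  have Ha : a \in H by rewrite -c2 groupX.
  have Hb : b \in H by rewrite -(conj_a_w ai bj oo) groupJ.
  have /fintype.subsetP KH := T24_part_ind ai bj oo Ha Hb Ho.
  apply/fintype.subsetP => z _; have [x Ex zx] := lift_surj z.
  case: Ex zx => [Tx zx|[y [Ty ->]] zy]; first by apply/KH/T24_partP; exists x.
  have [d dy] := lift_exists frame modE (T24E Ty).
  rewrite (lift_uniq zy (liftM dy ce)) groupM //; apply/KH/T24_partP.
  by exists y.
exact: card_oct.
Qed.

Lemma in_class_oct_O48 : U = 2%:R * w ^+ 2 -> in_class (img (ext T24 e)) is_O48.
Proof. by move=> /is_O48_oct; apply: in_class_sub. Qed.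

(** w (i - j) is the element of T24 e with square -2 w^2 that exchanges om and om^2. It gives the
    involution below, and the conjugates of other standard forms inside the octahedral group. *)
Lemma oct_pE : w *: q 0 1 (-1) 0 = hurw 1 1 (-1) (-1) * e.
Proof.
have half2 : 2%:R^-1 + 2%:R^-1 = 1 :> Q2.
  by rewrite -mulr2n -(mulr_natl 2%:R^-1) divff //; exact: Q2_two_neq0.
rewrite /e (i1E i j) -scalerAr /hurw mul1r mulN1r (qM frame); congr (_ *: _).
rewrite !mulr1 !mulr0 !subr0 !addr0 !add0r opprK subrr half2.
by rewrite -opprD half2 addNr.
Qed.

(** Here w (i - j) has square 2u, so its class is an involution outside T24. An element outside T24
    that centralizes i and j would be a scalar of valuation 1/2. *)
Lemma in_class_oct_T24_C2 : U = - (2%:R * w ^+ 2) -> in_class (img (ext T24 e)) is_T24_C2.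
Proof.
move=> UE; apply: (in_class_sub (finF := mod_group_finite frame modE)).
have [a ai] := lift_exists frame modE (T24E (T24_i i j)).
have [b bj] := lift_exists frame modE (T24E (T24_j i j)).
have [o oo] := lift_exists frame modE (T24E (T24_om i j)).
have l1 := lift1 frame modE.
have Tt : T24 (hurw 1 1 (-1) (-1)) by apply: T24_q.
have [y yy] : exists y : gT, lift y (w *: q 0 1 (-1) 0).
  by apply: lift_exists; right; exists (hurw 1 1 (-1) (-1)); rewrite oct_pE.
have y2 : (y ^+ 2 = 1)%g.
  apply/esym; apply: (lift_eq (m := 1) l1); rewrite expr1z UE.
  suff <- : (w *: q 0 1 (-1) 0) ^+ 2 = (- (2%:R * w ^+ 2))%:A by apply: liftX.
  by rewrite exprZn (qX2 frame) (q_const i j) qmkZ; congr qmk; ring.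
have yK : y \notin T24_partG modE by apply: (notin_part Tt); rewrite -oct_pE.
have gen (z : gT) : exists2 k, k \in T24_partG modE & exists n, z = (k * y ^+ n)%g.
  have [x Ex zx] := lift_surj z; case: Ex zx => [Tx zx|[s [Ts ->]] zs].
    by exists z; [apply/T24_partP; exists x | exists 0%N; rewrite expg0 mulg1].
  have Tst : T24 (s * (hurw 1 1 (-1) (-1))^-1) by apply: (T24M frame) Ts (T24V frame Tt).
  have [k kx] := lift_exists frame modE (T24E Tst).
  exists k; first by apply/T24_partP; eexists; last exact: kx.
  exists 1%N; rewrite expg1; apply: lift_uniq zs _.
  have -> : s * e = s * (hurw 1 1 (-1) (-1))^-1 * (w *: q 0 1 (-1) 0).
    by rewrite oct_pE mulrA mulrVK // Ddiv ?(T24_neq0 frame).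
  exact: liftM.
apply: (T24_C2_of_generators (K := T24_partG modE) (y := y)) => //.
- exact: is_T24_part ai bj oo.
- rewrite -groupV inE; apply/fintype.subsetP => _ /imsetP[k /T24_partP[x Tx kx] ->].
  apply/T24_partP; eexists; last by apply: liftJ kx (liftV yy).
  rewrite invrK oct_pE invrM ?Ddiv ?oct_neq0 ?(T24_neq0 frame Tt) //.
  have -> t : t * e * x * (e^-1 * t^-1) = t * (e * x * e^-1) * t^-1 by rewrite !mulrA.
  by apply: (T24M frame) (T24V frame Tt); apply: (T24M frame) => //; apply: T24_conj.
move=> z zK; have [x Ex zx] := lift_surj z.
case: Ex zx => [Tx zx|[s [Ts ->]] zs]; first by case/negP: zK; apply/T24_partP; exists x.
have se0 : s * e != 0 by rewrite mulD_neq0 ?oct_neq0 ?(T24_neq0 frame).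
(* Conjugation preserves the valuation, so commuting modulo 2u implies commuting in D. *)
have comm (k : gT) (d : D) : lift k d -> v d = 0 -> (k ^ z = k)%g ->
    s * e * d = d * (s * e).
  move=> kd vd /(lift_val_inj (liftJ kd zs) kd).
  have vJ : v ((s * e)^-1 * d * (s * e)) = v d.
    have [d0 _] := kd; have := valuJ Ddiv vP d0 (invD_neq0 se0).
    by rewrite invrK.
  by move=> /(_ vJ) E; rewrite -{1}E -[_ * d * _]mulrA mulVKr ?Ddiv.
have [/eqP aC|aC] := boolP ((a ^ z)%g == a); last first.
  by exists a => //; apply/T24_partP; exists i => //; apply: T24_i.
exists b; first by apply/T24_partP; exists j => //; apply: T24_j.
apply/eqP => bC.
have [c cE] : exists c, s * e = c%:A.
  apply: (center_scalar frame).
    by apply: comm aC; rewrite ?(T24_val frame (T24_i i j)).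
  by apply: comm bC; rewrite ?(T24_val frame (T24_j i j)).
have c0 : c != 0 by apply: contraNneq se0 => c0; rewrite cE c0 scale0r.
by apply: (val_scalar_odd frame c0); rewrite -cE val_TE.
Qed.

End Octahedral.

End TetrahedralClasses.

(** * Embeddings between classes, as obstructions to subconjugacy *)

Section Embeddings.

Local Open Scope group_scope.
Implicit Types (C : group_class) (gT : finGroupType).

Definition embeds C C' := exists gT gT' (h : gT -> gT'),
  [/\ C gT [set: gT]%SET, C' gT' [set: gT']%SET, injective h
    & {morph h : x y / x * y}].

Definition has_card C n := forall gT, C gT [set: gT]%SET -> #|gT| = n.

Lemma in_class_embeds (G : groupType) (F E : set G) g C C' :
    in_class F C -> in_class E C' -> (forall x, F x -> E (x ^ g)) ->
  embeds C C'.
Proof.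
move=> [gT [f [finj fF CT]]] [gT' [f' [f'inj f'E CT']]] FE.
have hP (a : gT) : exists b : gT', f' b = f a ^ g.
  have : E (f a ^ g) by apply: FE; rewrite -fF; exists a.
  by rewrite -f'E => -[b _ bE]; exists b.
exists gT, gT', (fun a => sval (cid (hP a))); split=> //.
  move=> a b; case: cid => /= a' a'E; case: cid => /= b' b'E ab.
  by apply: finj; apply: (conjg_inj g); rewrite -a'E ab.
move=> a b; case: cid => /= c cE; case: cid => /= a' a'E; case: cid => /= b' b'E.
by apply: f'inj; rewrite gmulfM cE a'E b'E gmulfM conjMg.
Qed.

Lemma embeds_dvdn C C' m n : embeds C C' -> has_card C m -> has_card C' n -> (m %| n)%N.
Proof.
move=> [gT [gT' [h [CT CT' hinj hM]]]] /(_ _ CT) <- /(_ _ CT') <-.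
have hMS : {in [set: gT] &, {morph h : x y / x * y}} by move=> x y _ _.
pose hm := Morphism hMS.
rewrite -[#|gT|]cardsT -[#|gT'|]cardsT.
have <- : #|hm @* [set: gT]| = #|[set: gT]|.
  by rewrite card_injm //; apply/injmP => x y _ _; apply: hinj.
by rewrite cardSg // finset.subsetT.
Qed.

Lemma embeds_sym C C' n : embeds C C' -> has_card C n -> has_card C' n -> embeds C' C.
Proof.
move=> [gT [gT' [h [CT CT' hinj hM]]]] /(_ _ CT) cT /(_ _ CT') cT'.
have [h' hK h'K] : bijective h by apply: inj_card_bij; rewrite ?cT ?cT'.
exists gT', gT, h'; split=> //; first exact: can_inj h'K.
by move=> x y; apply: hinj; rewrite hM !h'K.
Qed.

Lemma not_embeds_C3_C4_C6_C2 : ~ embeds is_C3_C4 is_C6_C2.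
Proof.
move=> [gT [gT' [h [CT CT' hinj hM]]]].
have [x [x2 x4]] := C3_C4_order4 CT; apply: x2; apply: hinj.
have h1 : h 1 = 1 by apply: (mulgI (h 1)); rewrite -hM !mulg1.
have hX n : h (x ^+ n) = h x ^+ n.
  by elim: n => [|n IH]; rewrite ?expg0 // !expgS hM IH.
by rewrite hX h1; apply: (C6_C2_order4 CT'); rewrite -hX x4.
Qed.

Lemma has_card_C6_C2 : has_card is_C6_C2 12. Proof. exact: card_C6_C2. Qed.
Lemma has_card_C3_C4 : has_card is_C3_C4 12. Proof. exact: card_C3_C4. Qed.
Lemma has_card_D8 : has_card is_D8 8. Proof. exact: card_D8. Qed.
Lemma has_card_Q8 : has_card is_Q8 8. Proof. exact: card_Q8. Qed.
Lemma has_card_T24 : has_card is_T24 24.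
Proof. by move=> gT; rewrite -cardsT; apply: (card_T24 (G := [set: gT]%G)). Qed.
Lemma has_card_T24_C2 : has_card is_T24_C2 48. Proof. exact: card_T24_C2. Qed.

End Embeddings.

(** * Existence of r with a given square, and uniqueness up to conjugation *)

Section Elements.

Variables (D : falgType Q2) (u : unit_group Z2) (v : D -> rat) (i j : D).
Hypothesis frame : hamilton_frame v i j.

Let Ddiv : is_division_algebra D. Proof. by case: frame => -[]. Qed.

Local Notation U := (twou u).
Local Notation q := (qmk i j).
Local Notation hurw := (hurw i j).
Local Notation om := (om i j).
Local Notation C6 := (C6 i j).
Local Notation C4 := (C4 i).
Local Notation span := (span U).

Implicit Types (x y z r : D) (P C : D -> Prop).

Lemma twouE : U = 2%:R * (unit_group_val u)%:F.
Proof. by rewrite /twou tofracM rmorph_nat. Qed.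

Lemma inverting_om (A B : Q2) : exists2 r, r * om = om ^+ 2 * r &
  r ^+ 2 = (- (2%:R * (A ^+ 2 + 3%:R * B ^+ 2)))%:A.
Proof.
(* The elements that exchange om and om^2 are the pure quaternions orthogonal to i + j + ij: this
   one is A (i - j) + B (i + j - 2 ij). *)
exists (q 0 (A + B) (B - A) (- (2%:R * B))).
  by rewrite (om2E frame) /om /hurw !(qM frame); congr qmk; ring.
by rewrite (qX2 frame) (q_const i j); congr qmk; ring.
Qed.

Lemma inverting_om_sqr (n : Z2) : n \is a GRing.unit ->
  exists2 r, r * om = om ^+ 2 * r & r * r = (2%:R * n%:F)%:A.
Proof.
move=> nU; have [|e [f nE]] := @Z2_unit_norm (- n); first by rewrite unitrN.
have [B fB] : exists B : Q2, f%:F = 2%:R * B.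
  by exists (2%:R^-1 * f%:F); rewrite mulVKf //; exact: Q2_two_neq0.
(* As e^2 - e f + f^2 = (e - f/2)^2 + 3 (f/2)^2, take B = f/2 and A = e - f/2. *)
have [r rom r2] := inverting_om (e%:F - B) B; exists r => //.
rewrite -expr2 r2; congr (_%:A); rewrite -[n]opprK nE.
by rewrite !(rmorphN, rmorphD, rmorphM, rmorphXn) /= fB; ring.
Qed.

(** For u = 3 or -3 mod 8, one of u and -u is 5 times a square, so 2u is 10 s^2 up to sign; and 10 =
    1^2 + 3^2, whence the witness s (j + 3 ij). *)
Lemma inverting_i_sqr (s : Q2) : exists2 y, y * i = - (i * y) &
  y * y = (- (10%:R * s ^+ 2))%:A.
Proof.
exists (q 0 0 s (3%:R * s)).
  have := qM frame 0 0 s (3%:R * s) 0 1 0 0; have := qM frame 0 1 0 0 0 0 s (3%:R * s).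
  by rewrite -(q_i i j) => -> ->; rewrite qmkN; congr qmk; ring.
by rewrite -expr2 (qX2 frame) (q_const i j); congr qmk; ring.
Qed.

Lemma conj_into_trans P C C' : conj_into P C -> conj_into C C' -> conj_into P C'.
Proof.
move=> [z z0 PC] [z' z'0 CC']; exists (z * z'); first exact: mulD_neq0.
move=> x Px; apply/CC'/PC; move: Px; rewrite invrM ?Ddiv //.
by rewrite !mulrA.
Qed.

Lemma conj_into_sub P C C' : conj_into P C -> (forall x, C x -> C' x) -> conj_into P C'.
Proof. by move=> PC CC'; apply: conj_into_trans PC (conj_into_refl CC'). Qed.

Lemma conj_span_ext C r y z : z != 0 -> (forall c, C c -> z * c = c * z) ->
  z * r = y * z -> conj_into (span (ext C r)) (span (ext C y)).
Proof.
move=> z0 zC zr; have zU := Ddiv z0; exists z^-1; first exact: invD_neq0.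
move=> x [m [c [Cc xE]]]; have {xE} -> : x = U ^ m *: (z * c * z^-1).
  by rewrite scalerAl scalerAr -xE invrK !mulrA mulrV // mul1r mulrK.
exists m; eexists; split; last by [].
case: Cc => [Cc|[d [Cd ->]]]; first by left; rewrite zC // mulrK.
by right; exists d; split=> //; rewrite !mulrA zC // -(mulrA d) zr mulrA mulrK.
Qed.

Lemma conj_ext_C4 r y : r * i = - (i * r) -> y * i = - (i * y) -> r != 0 ->
  r * r = y * y -> conj_into (span (ext C4 r)) (span (ext C4 y)).
Proof.
move=> ri yi r0 ry.
have N x : x * i = - (i * x) -> x * i = - i * x /\ x * - i = i * x.
  by move=> xi; rewrite mulNr mulrN xi opprK.
have [ri1 ri2] := N _ ri; have [yi1 yi2] := N _ yi.
have iN : i != - i.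
  apply/eqP => E; have : q 0 1 0 0 = - q 0 1 0 0 by rewrite -(q_i i j).
  rewrite qmkN => /(q_inj frame)[_ /eq_opp_eq0/eqP]; by rewrite oner_eq0.
have iC : i * - i = - i * i by rewrite mulrN mulNr.
have [z [z0 zi zr]] := conj_by_centralizer frame iN iC ri1 ri2 yi1 yi2 r0 ry.
apply: (conj_span_ext z0 _ zr) => c [] ->; rewrite ?mulrN ?mulNr ?mulr1 ?mul1r //.
by rewrite zi.
Qed.

Lemma conj_ext_C6 r y : r * om = om ^+ 2 * r -> y * om = om ^+ 2 * y -> r != 0 ->
  r * r = y * y -> conj_into (span (ext C6 r)) (span (ext C6 y)).
Proof.
move=> ro yo r0 ry.
have oN : om != om ^+ 2 by apply/eqP; apply: (om_neq_om2 frame).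
have oC : om * om ^+ 2 = om ^+ 2 * om by rewrite -exprS -exprSr.
have ro2 := semicommute_om2 frame ro; have yo2 := semicommute_om2 frame yo.
have [z [z0 zo zr]] := conj_by_centralizer frame oN oC ro ro2 yo yo2 r0 ry.
apply: (conj_span_ext z0 _ zr) => c [d [dE cE]].
have zd : z * d = d * z.
  by case: dE => ->; rewrite ?mulr1 ?mul1r // expr2 mulrA zo -mulrA zo mulrA.
by case: cE => ->; rewrite ?mulrN ?mulNr zd.
Qed.

(** r and y are non-central roots of the same quadratic polynomial, hence conjugate. So a group
    whose elements of valuation 0 are 1 and -1 is never maximal: it is conjugate into an extension
    of C6. *)
Lemma conj_ext_C2 r y : v r = 2%:R^-1 -> (r * r = U%:A \/ r * r = - U%:A) ->
  r * r = y * y ->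
  conj_into (span (ext (fun x => x = 1 \/ x = - 1) r)) (span (ext C6 y)).
Proof.
move=> vr rr ry; have r0 := sqr_eq_neq0 rr.
have rn a : r <> a%:A.
  move=> rE; apply: (@val_scalar_odd _ _ _ _ frame a); last by rewrite -rE.
  by apply: contraNneq r0 => a0; rewrite rE a0 scale0r.
have [n rrE] : exists n, r * r = 0 *: r - n%:A.
  case: rr => ->; [exists (- U) | exists U]; rewrite scale0r sub0r // scaleNr opprK //.
have yyE : y * y = 0 *: y - n%:A by rewrite -ry rrE !scale0r.
have [z z0 zE] := intertwine frame rn rrE yyE.
have zU := Ddiv z0.
have : conj_into (span (ext (fun x => x = 1 \/ x = - 1) r))
                 (span (ext (fun x => x = 1 \/ x = - 1) y)).
  apply: (@conj_span_ext _ _ _ z^-1); first exact: invD_neq0.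
    by move=> c [] ->; rewrite ?mulrN ?mulNr mulr1 mul1r.
  by apply: (mulrI zU); apply: (mulIr zU); rewrite mulVKr // -!mulrA mulVr // mulr1.
move=> H; apply: conj_into_sub H _; apply: span_sub.
have C21 x : x = 1 \/ x = - 1 -> C6 x by exists 1; split; first constructor.
by move=> x [/C21|[c [/C21 Cc ->]]]; [left | right; exists c].
Qed.

End Elements.

(** * Obstructions to conjugacy, and the case u = 3 or -3 mod 8 *)

Section Assembly.

Variables (D : falgType Q2) (u : unit_group Z2) (v : D -> rat) (i j : D).
Hypothesis frame : hamilton_frame v i j.

Let Ddiv : is_division_algebra D. Proof. by case: frame => -[]. Qed.
Let vP : extends_Q2_val v. Proof. by case: frame => -[]. Qed.

Local Notation U := (twou u).
Local Notation T24 := (T24 i j).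
Local Notation C6 := (C6 i j).
Local Notation C4 := (C4 i).
Local Notation i1 := (i1 i).
Local Notation span := (span U).
Local Notation proj := (proj u).
Local Notation img := (@img D u).

Implicit Types (x y z r : D) (P C : D -> Prop) (w s : Q2).

Let U0 : U <> 0. Proof. exact: twou_neq0. Qed.
Let vU : v U%:A = 1. Proof. exact: (val_twou u frame). Qed.

Lemma finite_standard_form (F : set (GG D u)) : finite_subgroup F ->
  standard_form v i j U (preimage_pm F).
Proof.
by move=> finF; exact: (saturated_standard frame U0 vU (saturated_preimage frame finF)).
Qed.

Lemma proj_conj_img r g C : r != 0 -> (forall y, C y -> y != 0) ->
    img C (proj r ^ g)%g ->
  exists z m c, [/\ z != 0, C c & z^-1 * r * z = U ^ m *: c].
Proof.
move=> r0 C0; have [z z0 ->] := proj_surj Ddiv g; rewrite -(projJ u Ddiv r0 z0).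
move=> [c Cc] /esym/(proj_eq u Ddiv _ (C0 _ Cc))[|m E]; last by exists z, m, c.
by rewrite !mulD_neq0 ?invD_neq0.
Qed.

Lemma val_conjV r z : r != 0 -> z != 0 -> v (z^-1 * r * z) = v r.
Proof.
by move=> r0 z0; have := valuJ Ddiv vP r0 (invD_neq0 z0); rewrite invrK.
Qed.

Lemma not_conj_into_T24 r g : v r = 2%:R^-1 -> r != 0 -> ~ img T24 (proj r ^ g)%g.
Proof.
move=> vr r0 /proj_conj_img[//|y Ty|z [m [c [z0 Tc E]]]]; first exact: (T24_neq0 frame Ty).
have := val_UzM frame U0 vU m (T24_neq0 frame Tc).
rewrite -E val_conjV // vr (T24_val frame Tc) addr0 => /esym.
exact: half_not_int.
Qed.

(** x = t w (1 + i) has reduced norm 2 w^2, so x^2 = tr(x) x - 2 w^2. If x^2 = 2 w^2, then tr(x) x =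
    4 w^2, and x would be scalar in spite of its valuation 1/2. *)
Lemma oct_element_sqr w t : half_unit_square U w -> T24 t ->
  (t * (w *: i1)) ^+ 2 <> (2%:R * w ^+ 2)%:A.
Proof.
move=> wU Tt; have [a [b [c [d xE]]]] := qP frame (t * (w *: i1)).
have w0 : w <> 0 by move=> w0; case: wU; rewrite w0 expr0n mulr0 ?oppr0.
have Nx : qnorm a b c d = 2%:R * w ^+ 2.
  apply: (nrd_inj frame (x := t * (w *: i1))); first by exists a, b, c, d.
  rewrite -[2%:R * _]mul1r; apply: (nrdM frame); first exact: nrd_T24.
  rewrite mulrC; apply: nrdZ; rewrite (i1E i j); exists 1, 1, 0, 0; split=> //.
  by rewrite /qnorm; ring.
have n0 : 2%:R * w ^+ 2 <> 0 by move=> n0; case: wU; rewrite n0 ?oppr0.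
have e0 := oct_neq0 frame wU.
have x0 : t * (w *: i1) != 0 by rewrite mulD_neq0 ?(T24_neq0 frame Tt).
have vx : v (t * (w *: i1)) = 2%:R^-1.
  by rewrite (valuM vP) ?(T24_neq0 frame Tt) // (T24_val frame Tt) (val_oct frame wU) add0r.
have sq : (t * (w *: i1)) ^+ 2 = (2%:R * a) *: (t * (w *: i1)) - (2%:R * w ^+ 2)%:A.
  by rewrite xE (q_sqr frame) Nx.
rewrite sq => /eqP; rewrite subr_eq -scalerDl => /eqP E.
have xnc c' : t * (w *: i1) <> c'%:A.
  move=> xc; apply: (@val_scalar_odd _ _ _ _ frame c'); last by rewrite -xc.
  by apply: contraNneq x0 => c0; rewrite xc c0 scale0r.
have [a0|a0] := eqVneq (2%:R * a) 0; last first.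
  apply: (xnc ((2%:R * a)^-1 * (2%:R * w ^+ 2 + 2%:R * w ^+ 2))).
  by rewrite -scalerA -E scalerA mulVf // scale1r.
move: E; rewrite a0 scale0r (q_const i j) => /esym/(q_eq0 frame)[n2 _ _ _].
exact/n0/double_eq0.
Qed.

(** Such an r is c j + d ij, with r^2 = -(c^2 + d^2), so a^2 + b^2 + c^2 + d^2 = 0 and the norm form
    is anisotropic. This fixes the sign of r^2. *)
Lemma anticommute_sqr r (a b : Q2) : r * i = - (i * r) ->
  r * r = (a ^+ 2 + b ^+ 2)%:A -> a = 0.
Proof.
have [a' [b' [c [d rE]]]] := qP frame r => ri; rewrite -expr2 rE (qX2 frame).
have [-> ->] : a' = 0 /\ b' = 0 by apply: (anticommute_i frame (c := c) (d := d)); rewrite -rE.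
rewrite (q_const i j) => /(q_inj frame)[E _ _ _].
have /(qnorm_eq0 frame)[-> //] : qnorm a b c d = 0.
by rewrite /qnorm -E; ring.
Qed.

Lemma embeds_conj (F E : set (GG D u)) (C C' : group_class) :
  in_class F C -> in_class E C' ->
  (exists g, forall f, F f -> E (f ^ g)%g) -> embeds C C'.
Proof. by move=> FC EC [g FE]; apply: in_class_embeds FC EC FE. Qed.

Lemma embeds_same (E : set (GG D u)) (C C' : group_class) :
  in_class E C -> in_class E C' -> embeds C C'.
Proof. by move=> EC EC'; apply: (in_class_embeds (g := 1%g) EC EC') => x; rewrite conjg1. Qed.

Section UnitPlusMinusThree.

(** The D8 and Q8 cases differ only by the sign in [Us], so the class of order 8 is a parameter. *)
Variables (C8 : group_class) (s : Q2).
Hypotheses (Us : U = 10%:R * s ^+ 2 \/ U = - (10%:R * s ^+ 2))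
  (nsqU : forall w, ~ half_unit_square U w) (C8_card : has_card C8 8)
  (C8_class : forall y, y * i = - (i * y) -> y * y = (- (10%:R * s ^+ 2))%:A ->
     in_class (img (ext C4 y)) C8).

Lemma maximal_classes_pm3 :
  maximal_finite_classes (GG D u) [:: is_C3_C4; is_C6_C2; C8; is_T24].
Proof.
have uU := unit_groupP u.
have [rp rpo rpp] := inverting_om_sqr frame uU.
have {rpp} rpp : rp * rp = U%:A by rewrite rpp -twouE.
have NuU : - unit_group_val u \is a GRing.unit by rewrite unitrN.
have [rm rmo rmm] := inverting_om_sqr frame NuU.
have {rmm} rmm : rm * rm = - U%:A by rewrite rmm rmorphN mulrN -twouE scaleNr.
have [y yi yy] := inverting_i_sqr frame s.
have yyU : y * y = U%:A \/ y * y = - U%:A.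
  by case: Us => ->; [right | left]; rewrite yy ?scaleNr ?opprK.
pose L := [:: ((is_C3_C4 : group_class), img (ext C6 rm));
  ((is_C6_C2 : group_class), img (ext C6 rp));
  (C8, img (ext C4 y)); ((is_T24 : group_class), img T24)].
have clm : in_class (img (ext C6 rm)) is_C3_C4 by apply: (in_class_C3_C4 frame).
have clp : in_class (img (ext C6 rp)) is_C6_C2 by apply: (in_class_C6_C2 frame).
have cly : in_class (img (ext C4 y)) C8 by apply: C8_class.
have clT : in_class (img T24) is_T24 by apply: (in_class_T24 u frame).
have modm := mod_group_C6 frame rmo (or_intror rmm).
have modp := mod_group_C6 frame rpo (or_introl rpp).
have mody := mod_group_C4 frame yi yyU.
have modT := mod_group_T24 u frame.
have cm := has_card_C3_C4; have cp := has_card_C6_C2; have cT := has_card_T24.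
have notT C r : C 1 -> (r * r = U%:A \/ r * r = - U%:A) ->
    ~ exists g, forall f, img (ext C r) f -> img T24 (f ^ g)%g.
  move=> C1 rr [g H]; apply: (@not_conj_into_T24 r g).
  - exact: (val_sqr frame rr).
  - exact: (sqr_eq_neq0 rr).
  by apply: H; exists r => //; right; exists 1; rewrite mul1r.
have npm := not_embeds_C3_C4_C6_C2.
have nmp : ~ embeds is_C6_C2 is_C3_C4 by move=> E; apply: npm; apply: embeds_sym E cp cm.
have C6_1 : C6 1 by exists 1; split; [constructor 1 | left].
have C4_1 : C4 1 by constructor 1.
have dvd (C C' : group_class) (m n : nat) :
    has_card C m -> has_card C' n -> ~~ (m %| n)%N -> ~ embeds C C'.
  by move=> cC cC' /negP H E; apply: H; apply: embeds_dvdn E cC cC'.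
apply: (@maximal_classes_of_representatives _ L).
- move=> p; rewrite /L /= => -[|[|[|[|//]]]] <-; split=> //; exact: (mod_group_finite frame).
- move=> F finF.
  have cover C (c : group_class) : (forall x, C x -> x != 0) -> List.In (c, img C) L ->
      conj_into (preimage_pm F) (span C) ->
      exists2 p, List.In p L & exists g, forall f, F f -> p.2 (f ^ g)%g.
    by move=> C0 LC FC; exists (c, img C) => //; apply: (conj_into_img frame).
  have coverm := cover (ext C6 rm) is_C3_C4; have coverp := cover (ext C6 rp) is_C6_C2.
  have {coverm} coverm : conj_into (preimage_pm F) (span (ext C6 rm)) ->
      exists2 p, List.In p L & exists g, forall f, F f -> p.2 (f ^ g)%g.
    by apply: coverm; [case: modm | left].
  have {coverp} coverp : conj_into (preimage_pm F) (span (ext C6 rp)) ->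
      exists2 p, List.In p L & exists g, forall f, F f -> p.2 (f ^ g)%g.
    by apply: coverp; [case: modp | right; left].
  have [H|w wU _|r ri rr H|r ro rr H|r vr rr H] := finite_standard_form finF.
  + by apply: cover H; [case: modT | right; right; right; left].
  + by case: (nsqU wU).
  + apply: (@cover (ext C4 y) C8); [by case: mody | by right; right; left |].
    apply: (conj_into_trans frame H); apply: (conj_ext_C4 u frame ri yi (sqr_eq_neq0 rr)).
    have s0 : s <> 0 by move=> s0; case: Us; rewrite s0 expr0n mulr0 ?oppr0.
    (* 10 s^2 = s^2 + (3 s)^2 is a sum of two squares, which excludes the wrong sign of r^2. *)
    have rrN : r * r <> (10%:R * s ^+ 2)%:A.
      move=> E; apply: s0; apply: (@anticommute_sqr r s (3%:R * s) ri).
      by rewrite E; congr (_%:A); ring.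
    case: Us => UE; case: rr => rr; rewrite UE in rr.
    * by case: rrN.
    * by rewrite rr yy scaleNr.
    * by rewrite rr yy.
    * by case: rrN; rewrite rr scaleNr opprK.
  + have r0 := sqr_eq_neq0 rr; case: rr => rr; [apply: coverp | apply: coverm].
      by apply: (conj_into_trans frame H); apply: (conj_ext_C6 u frame ro rpo r0); rewrite rr.
    by apply: (conj_into_trans frame H); apply: (conj_ext_C6 u frame ro rmo r0); rewrite rr.
  have rr' := rr; case: rr' => rr'; [apply: coverp | apply: coverm].
    by apply: (conj_into_trans frame H); apply: (conj_ext_C2 frame vr rr); rewrite rr'.
  by apply: (conj_into_trans frame H); apply: (conj_ext_C2 frame vr rr); rewrite rr'.
- move=> p p'; rewrite /L /= => -[|[|[|[|//]]]] <- -[|[|[|[|//]]]] <- //= H; exfalso.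
  + by apply: npm; apply: embeds_conj H.
  + by apply: (dvd _ _ _ _ cm C8_card) => //; apply: embeds_conj H.
  + by apply: notT H => //; right.
  + by apply: nmp; apply: embeds_conj H.
  + by apply: (dvd _ _ _ _ cp C8_card) => //; apply: embeds_conj H.
  + by apply: notT H => //; left.
  + by apply: (dvd _ _ _ _ C8_card cm) => //; apply: embeds_conj H.
  + by apply: (dvd _ _ _ _ C8_card cp) => //; apply: embeds_conj H.
  + by apply: notT H.
  + by apply: (dvd _ _ _ _ cT cm) => //; apply: embeds_conj H.
  + by apply: (dvd _ _ _ _ cT cp) => //; apply: embeds_conj H.
  + by apply: (dvd _ _ _ _ cT C8_card) => //; apply: embeds_conj H.
move=> p p' E; rewrite /L /= => -[|[|[|[|//]]]] <- -[|[|[|[|//]]]] <- //= E1 E2; exfalso;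
  have e1 := embeds_same E1 E2; have e2 := embeds_same E2 E1 => {E1 E2}.
- exact: npm.
- exact: (dvd _ _ _ _ cm C8_card _ e1).
- exact: (dvd _ _ _ _ cT cm _ e2).
- exact: nmp.
- exact: (dvd _ _ _ _ cp C8_card _ e1).
- exact: (dvd _ _ _ _ cT cp _ e2).
- exact: (dvd _ _ _ _ C8_card cm _ e1).
- exact: (dvd _ _ _ _ C8_card cp _ e1).
- exact: (dvd _ _ _ _ cT C8_card _ e2).
- exact: (dvd _ _ _ _ cT cm _ e1).
- exact: (dvd _ _ _ _ cT cp _ e1).
- exact: (dvd _ _ _ _ cT C8_card _ e1).
Qed.

End UnitPlusMinusThree.

End Assembly.

(** * The case u = 1 or -1 mod 8 *)

Section UnitPlusMinusOne.

Variables (D : falgType Q2) (u : unit_group Z2) (v : D -> rat) (i j : D).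
Hypothesis frame : hamilton_frame v i j.

Let Ddiv : is_division_algebra D. Proof. by case: frame => -[]. Qed.
Let vP : extends_Q2_val v. Proof. by case: frame => -[]. Qed.

Local Notation U := (twou u).
Local Notation q := (qmk i j).
Local Notation hurw := (hurw i j).
Local Notation T24 := (T24 i j).
Local Notation om := (om i j).
Local Notation C6 := (C6 i j).
Local Notation i1 := (i1 i).
Local Notation span := (span U).
Local Notation proj := (proj u).
Local Notation img := (@img D u).

Implicit Types (x y z r : D) (P C : D -> Prop).

Let U0 : U <> 0. Proof. exact: twou_neq0. Qed.
Let vU : v U%:A = 1. Proof. exact: (val_twou u frame). Qed.

Variables (CA CE : group_class) (w : Q2).
Hypothesis wU : half_unit_square U w.

Let e := w *: i1.

Variable r : D.
(** 2 w^2 is the square that [ext T24 e] does not realize: its element w (i - j), which also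
    exchanges om and om^2, has square -2 w^2. Thus r^2 is 2u or -2u according to the sign in [wU],
    and [CA] varies accordingly. *)
Hypotheses (ro : r * om = om ^+ 2 * r) (rr : r * r = (2%:R * w ^+ 2)%:A).
Hypotheses (CA_card : has_card CA 12) (CE_card : has_card CE 48).
Hypotheses (CA_class : in_class (img (ext C6 r)) CA)
           (CE_class : in_class (img (ext T24 e)) CE).

Let w0 : w <> 0.
Proof. by move=> w0; case: wU; rewrite w0 expr0n mulr0 ?oppr0. Qed.

Let rrU : r * r = U%:A \/ r * r = - U%:A.
Proof. by case: wU => ->; [left | right]; rewrite rr // scaleNr opprK. Qed.

Let signs x : (x * x = U%:A \/ x * x = - U%:A) ->
  x * x = r * r \/ x * x = (- (2%:R * w ^+ 2))%:A.
Proof.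
by rewrite rr; case: wU => ->; case=> ->; rewrite ?scaleNr ?opprK;
  [left | right | right | left].
Qed.

Let oct_into C t y : T24 t -> y = t * e -> (forall c, C c -> T24 c) -> forall x,
  span (ext C y) x -> span (ext T24 e) x.
Proof.
move=> Tt yE CT; apply: span_sub => z Cz; apply: (ext_absorb frame Tt yE).
by case: Cz => [/CT|[c [/CT Tc ->]]]; [left | right; exists c].
Qed.

Lemma maximal_classes_pm1 : maximal_finite_classes (GG D u) [:: CA; CE].
Proof.
have r0 := sqr_eq_neq0 rrU.
have modA := mod_group_C6 frame ro rrU.
have modE := mod_group_oct frame wU.
have C6_1 : C6 1 by exists 1; split; [constructor 1 | left].
have noAE : ~ exists g, forall f, img (ext C6 r) f -> img (ext T24 e) (f ^ g)%g.
  move=> [g H].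
  have /(proj_conj_img frame r0)[|z [m [c [z0 Ec E]]]] : img (ext T24 e) (proj r ^ g)%g.
  - by apply: H; exists r => //; right; exists 1; rewrite mul1r.
  - by case: modE.
  have vr := val_sqr frame rrU.
  have c0 : c != 0 by have [E0 _ _ _] := modE; apply: E0.
  have := val_UzM frame U0 vU m c0; rewrite -E (val_conjV frame) // vr.
  (* By valuations the conjugate of r is an element t e with no power of U involved, and its square
     is excluded by [oct_element_sqr]. *)
  case: Ec E c0 => [Tc E c0|[t [Tt ->]] E c0].
    by rewrite (T24_val frame Tc) addr0 => /esym; apply: half_not_int.
  rewrite (valuM vP) ?(oct_neq0 frame wU) ?(T24_neq0 frame Tt) //.
  rewrite (T24_val frame Tt) (val_oct frame wU) add0r => vE.
  have m0 : m = 0.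
    have /eqP : (m%:~R : rat) = 0 by lra.
    by rewrite intr_eq0 => /eqP.
  move: E; rewrite m0 expr0z scale1r => E.
  apply: (oct_element_sqr frame wU Tt); rewrite -/e -E expr2.
  have -> : z^-1 * r * z * (z^-1 * r * z) = z^-1 * (r * r) * z.
    by rewrite !mulrA mulrK // Ddiv.
  by rewrite rr mulr_algr -scalerAl mulVr ?Ddiv.
have dvd (C C' : group_class) (m n : nat) :
    has_card C m -> has_card C' n -> ~~ (m %| n)%N -> ~ embeds C C'.
  by move=> cC cC' /negP H E; apply: H; apply: embeds_dvdn E cC cC'.
pose L := [:: (CA, img (ext C6 r)); (CE, img (ext T24 e))].
apply: (@maximal_classes_of_representatives _ L).
- by move=> p; rewrite /L /= => -[|[|//]] <-; split=> //; exact: (mod_group_finite frame).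
- move=> F finF.
  have coverA : conj_into (preimage_pm F) (span (ext C6 r)) ->
      exists2 p, List.In p L & exists g, forall f, F f -> p.2 (f ^ g)%g.
    move=> FC; exists (CA, img (ext C6 r)); first by left.
    by apply: (conj_into_img frame) FC; case: modA.
  have coverE : conj_into (preimage_pm F) (span (ext T24 e)) ->
      exists2 p, List.In p L & exists g, forall f, F f -> p.2 (f ^ g)%g.
    move=> FC; exists (CE, img (ext T24 e)); first by right; left.
    by apply: (conj_into_img frame) FC; case: modE.
  have Tt : T24 (hurw 1 1 (-1) (-1)) by apply: T24_q.
  have yE := oct_pE frame w; set y := w *: _ in yE.
  have yo : y * om = om ^+ 2 * y.
    rewrite /y qmkZ (om2E frame) /om /hurw !(qM frame); congr qmk; ring.
  have yy : y * y = (- (2%:R * w ^+ 2))%:A.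
    by rewrite /y qmkZ (qM frame) (q_const i j); congr qmk; ring.
  have [H|w' w'U H|x xi xx H|x xo xx H|x vx xx H] := finite_standard_form frame finF.
  + by apply/coverE/(conj_into_sub frame H)/span_sub => x Tx; left.
  + have two (a b : Q2) : 2%:R * a = 2%:R * b -> a = b by move/(mulfI Q2_two_neq0).
    (* w' need not be w, but w'^2 = -w^2 is excluded by anisotropy, so w' is w or -w. *)
    have ww : w' ^+ 2 = w ^+ 2 \/ w' ^+ 2 = - w ^+ 2.
      case: wU => E1; case: w'U => E2.
      * by left; apply: two; rewrite -E1 -E2.
      * by right; apply: two; rewrite mulrN -E1 E2 opprK.
      * by right; apply: two; rewrite mulrN -E1 -E2.
      * by left; apply: two; apply: oppr_inj; rewrite -E1 -E2.
    have [t Tt' yE'] : exists2 t, T24 t & w' *: i1 = t * e.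
      case: ww => [/eqP|E].
        rewrite eqf_sqr => /orP[]/eqP ->; first by exists 1; [exact: T24_1 | rewrite mul1r].
        by exists (- 1); [apply/T24N/T24_1 | rewrite mulN1r scaleNr].
      have /(qnorm_eq0 frame)[_ /w0 //] : qnorm w' w 0 0 = 0.
      by rewrite /qnorm E; ring.
    apply/coverE/(conj_into_sub frame H)/span_sub => x.
    exact: (ext_absorb frame Tt' yE').
  + case: (signs xx) => xxE.
      case: w0; apply: (anticommute_sqr frame (r := x) (b := w) xi).
      by rewrite xxE rr; congr (_%:A); ring.
    apply/coverE/(conj_into_trans frame H).
    (* 2 w^2 = w^2 + w^2 being excluded by the preceding step, x has square -2 w^2; inside T24 e
       this square is realized by j e, which also anticommutes with i. *)
    have jeE : j * e = q 0 0 w (- w).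
      rewrite /e (i1E i j) -scalerAr; have := qM frame 0 0 1 0 1 1 0 0.
      by rewrite -(q_j i j) => ->; rewrite qmkZ; congr qmk; ring.
    have jei : j * e * i = - (i * (j * e)).
      rewrite jeE; have := qM frame 0 0 w (- w) 0 1 0 0.
      have := qM frame 0 1 0 0 0 0 w (- w); rewrite -(q_i i j) => -> ->.
      by rewrite qmkN; congr qmk; ring.
    apply: (conj_into_sub frame (conj_ext_C4 u frame xi jei (sqr_eq_neq0 xx) _)).
      by rewrite xxE jeE (qM frame) (q_const i j); congr qmk; ring.
    by apply: (oct_into (T24_j i j) erefl) => c; apply: C4_T24.
  + case: (signs xx) => xxE.
      by apply/coverA/(conj_into_trans frame H)/(conj_ext_C6 u frame xo ro (sqr_eq_neq0 xx)).
    apply/coverE/(conj_into_trans frame H).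
    apply: (conj_into_sub frame (conj_ext_C6 u frame xo yo (sqr_eq_neq0 xx) _)).
      by rewrite xxE yy.
    exact: (oct_into Tt yE (C6_T24 frame)).
  case: (signs xx) => xxE.
    by apply/coverA/(conj_into_trans frame H)/(conj_ext_C2 frame vx xx).
  apply/coverE/(conj_into_trans frame H).
  apply: (conj_into_sub frame (conj_ext_C2 (y := y) frame vx xx _)).
    by rewrite xxE yy.
  exact: (oct_into Tt yE (C6_T24 frame)).
- move=> p p'; rewrite /L /= => -[|[|//]] <- -[|[|//]] <- //= H; exfalso.
  by apply: (dvd _ _ _ _ CE_card CA_card) => //; apply: embeds_conj H.
move=> p p' E; rewrite /L /= => -[|[|//]] <- -[|[|//]] <- //= E1 E2; exfalso;
  have e1 := embeds_same E1 E2; have e2 := embeds_same E2 E1 => {E1 E2}.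
- exact: (dvd _ _ _ _ CE_card CA_card _ e2).
- exact: (dvd _ _ _ _ CE_card CA_card _ e1).
Qed.

End UnitPlusMinusOne.

(** * The four residue classes of u modulo 8 *)

Section SquareClasses.

Variables (D : falgType Q2) (u : unit_group Z2) (v : D -> rat) (i j : D).
Hypothesis frame : hamilton_frame v i j.

Local Notation U := (twou u).

Let un := unit_group_val u.

(** The class 5 mod 8 is represented by both 5 and -3. If n = w^2, then w^2 + 3 t^2 = 0; if n =
    -w^2, then w^2 + (2 s)^2 + s^2 = 0. Both contradict the anisotropy of the norm form. *)
Lemma not_half_unit_square (n s t : Z2) : un = n \/ un = - n ->
  n = 5%:R * s ^+ 2 -> n = - 3%:R * t ^+ 2 -> forall w, ~ half_unit_square U w.
Proof.
move=> un_n ns nt w wU.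
have n0 : n%:F <> 0.
  move=> /eqP; rewrite tofrac_eq0 => /eqP n0.
  by have := unit_groupP u; rewrite -/un; case: un_n => ->; rewrite n0 ?oppr0 unitr0.
have two (a b : Q2) : 2%:R * a = 2%:R * b -> a = b by move/(mulfI Q2_two_neq0).
have uw : un%:F = w ^+ 2 \/ un%:F = - w ^+ 2.
  by case: wU; rewrite twouE => E; [left | right]; apply: two; rewrite E ?mulrN.
have nw : n%:F = w ^+ 2 \/ n%:F = - w ^+ 2.
  case: un_n => E; first by rewrite -E.
  have -> : n = - un by rewrite E opprK.
  by rewrite rmorphN /=; case: uw => ->; [right | left; rewrite opprK].
have nsF : n%:F = 5%:R * s%:F ^+ 2 by rewrite ns rmorphM rmorphXn /= rmorph_nat.
have ntF : n%:F = - (3%:R * t%:F ^+ 2).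
  by rewrite nt mulNr rmorphN rmorphM rmorphXn /= rmorph_nat.
case: nw => E; apply: n0.
  have /(qnorm_eq0 frame)[_ t0 _ _] : qnorm w t%:F t%:F t%:F = 0.
    by rewrite /qnorm -E ntF; ring.
  by rewrite ntF t0 expr0n mulr0 oppr0.
have /(qnorm_eq0 frame)[_ _ s0 _] : qnorm w (2%:R * s%:F) s%:F 0 = 0.
  have w2 : w ^+ 2 = - n%:F by rewrite E opprK.
  by rewrite /qnorm w2 nsF; ring.
by rewrite nsF s0 expr0n mulr0.
Qed.

Let five_unit : 5%:R \is a @GRing.unit Z2.
Proof. by have -> : 5%:R = 1 + 2%:R * 2%:R :> Z2; [ring | apply: Z2_unit_odd]. Qed.

Let N3_unit : - 3%:R \is a @GRing.unit Z2.
Proof.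
by rewrite unitrN; have -> : 3%:R = 1 + 2%:R * 1 :> Z2; [ring | apply: Z2_unit_odd].
Qed.

Lemma maximal_classes_1 : Z2_cong8 un 1 ->
  maximal_finite_classes (GG D u) [:: is_C6_C2; is_O48].
Proof.
case=> z uE; have [s sE] := Z2_square_class (unitr1 _) uE.
have UE : U = 2%:R * s%:F ^+ 2 by rewrite twouE -/un sE mul1r rmorphXn.
have [r ro rr] := inverting_om_sqr frame (unit_groupP u).
have {rr} rr : r * r = U%:A by rewrite rr -twouE.
have wU : half_unit_square U s%:F by left.
apply: (maximal_classes_pm1 frame wU ro).
- by rewrite rr UE.
- exact: has_card_C6_C2.
(* The presentation bounds the order from above, the octahedral model from below. *)
- move=> gT O; apply/eqP; rewrite eqn_leq -cardsT; apply/andP; split.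
    by apply: (O48_pres_card (H := [set: gT]%G)); apply: (isoGrp_hom (G := [set: gT]%G)).
  have O' := is_O48_oct frame wU UE.
  rewrite cardsT (card_O48 O O') -cardsT; exact: card_oct.
- exact: (in_class_C6_C2 frame).
exact: (in_class_oct_O48 frame).
Qed.

Lemma maximal_classes_N1 : Z2_cong8 un (- 1) ->
  maximal_finite_classes (GG D u) [:: is_C3_C4; is_T24_C2].
Proof.
case=> z uE; have N1 : -1 \is a @GRing.unit Z2 by rewrite unitrN1.
have [|s sE] := @Z2_square_class un (-1) z N1; first by rewrite uE; ring.
have UE : U = - (2%:R * s%:F ^+ 2).
  by rewrite twouE -/un sE mulN1r rmorphN rmorphXn /= mulrN.
have NuU : - un \is a GRing.unit by rewrite unitrN unit_groupP.
have [r ro rr] := inverting_om_sqr frame NuU.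
have {rr} rr : r * r = - U%:A by rewrite rr rmorphN mulrN -twouE scaleNr.
have wU : half_unit_square U s%:F by right.
apply: (maximal_classes_pm1 frame wU ro).
- by rewrite rr UE scaleNr opprK.
- exact: has_card_C3_C4.
- exact: has_card_T24_C2.
- exact: (in_class_C3_C4 frame).
exact: (in_class_oct_T24_C2 frame).
Qed.

Lemma maximal_classes_3 : Z2_cong8 un 3 ->
  maximal_finite_classes (GG D u) [:: is_C3_C4; is_C6_C2; is_D8; is_T24].
Proof.
case=> z uE.
have [|s sE] := @Z2_square_class (- un) 5%:R (- z - 1) five_unit.
  by rewrite uE; ring.
have [|t tE] := @Z2_square_class (- un) (- 3%:R) (- z) N3_unit.
  by rewrite uE; ring.
have UE : U = - (10%:R * s%:F ^+ 2).
  rewrite twouE -/un -[un]opprK sE rmorphN rmorphM rmorphXn /= rmorph_nat; ring.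
apply: (maximal_classes_pm3 frame (s := s%:F)); first by right.
- by apply: (not_half_unit_square _ sE tE); right; rewrite opprK.
- exact: has_card_D8.
- by move=> y yi yy; apply: (in_class_D8 frame) => //; rewrite ?yy UE //; left.
Qed.

Lemma maximal_classes_N3 : Z2_cong8 un (- 3) ->
  maximal_finite_classes (GG D u) [:: is_C3_C4; is_C6_C2; is_Q8; is_T24].
Proof.
case=> z uE.
have [|s sE] := @Z2_square_class un 5%:R (z - 1) five_unit.
  by rewrite uE; ring.
have [|t tE] := @Z2_square_class un (- 3%:R) z N3_unit.
  by rewrite uE; ring.
have UE : U = 10%:R * s%:F ^+ 2.
  rewrite twouE -/un sE rmorphM rmorphXn /= rmorph_nat; ring.
apply: (maximal_classes_pm3 frame (s := s%:F)); first by left.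
- by apply: (not_half_unit_square _ sE tE); left.
- exact: has_card_Q8.
- by move=> y yi yy; apply: (in_class_Q8 frame) => //; rewrite ?yy UE scaleNr //; right.
Qed.

End SquareClasses.

Theorem theorem4p29 (D : falgType Q2) (u : unit_group Z2) (hD : is_DD D 2) :
  [/\ Z2_cong8 (unit_group_val u) 1 ->
        maximal_finite_classes (GG D u) [:: is_C6_C2; is_O48],
      Z2_cong8 (unit_group_val u) (-1) ->
        maximal_finite_classes (GG D u) [:: is_C3_C4; is_T24_C2],
      Z2_cong8 (unit_group_val u) 3 ->
        maximal_finite_classes (GG D u) [:: is_C3_C4; is_C6_C2; is_D8; is_T24]
    & Z2_cong8 (unit_group_val u) (-3) ->
        maximal_finite_classes (GG D u) [:: is_C3_C4; is_C6_C2; is_Q8; is_T24]].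
Proof.
have [v [i [j frame]]] := is_DD_hamilton hD; split.
- exact: (maximal_classes_1 frame).
- exact: (maximal_classes_N1 frame).
- exact: (maximal_classes_3 frame).
- exact: (maximal_classes_N3 frame).
Qed.
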